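(* Let $n\ge 1$, let $B\subset \mathrm{SL}_n(\mathbb{C})$ be the Borel subgroup of upper triangular matrices, and let $\mathscr{X}_n$ be the variety of complete quadrics in $\mathbb{P}^{n-1}$ (with its natural $\mathrm{SL}_n$-action). Then the number $b(\mathscr{X}_n)$ of $B$-orbits in $\mathscr{X}_n$ equals the number of skew standard Young tableaux with $n$ boxes, i.e. $$b(\mathscr{X}_n)=\sum f^{\lambda^1\times\cdots\times\lambda^k},$$ where the sum runs over all $k\ge1$ and all sequences $(\lambda^1,\dots,\lambda^k)$ of nonempty partitions with $|\lambda^1|+\cdots+|\lambda^k|=n$, and $f^{\lambda^1\times\cdots\times\lambda^k}$ denotes the number of standard Young tableaux of the skew-diagram $\lambda^1\times\cdots\times\lambda^k$.
   Context: The variety of complete quadrics $\mathscr{X}_n$ is the closure of the image of the map $[A]\mapsto([\Lambda^1 A],[\Lambda^2A],\dots,[\Lambda^{n-1}A])\in\prod_{i=1}^{n-1}\mathbb{P}(\Lambda^i(\mathrm{Sym}_n))$, where $A$ ranges over invertible symmetric complex $n\times n$ matrices; equivalently it is the wonderful embedding of the space $\mathrm{SL}_n/\widetilde{\mathrm{SO}}_n$ of smooth quadric hypersurfaces in $\mathbb{P}^{n-1}$. $\mathrm{SL}_n$ acts via $g\cdot A=(g^{\top})^{-1}Ag^{-1}$ (and the induced action on exterior powers). Partitions are identified with their (English) Young diagrams. For partitions $\lambda,\mu$, the skew-diagram $\lambda\times\mu$ is obtained by placing the diagram of $\mu$ below that of $\lambda$ so that the rightmost box of the first row of $\mu$ is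 immediately below and to the left of the lowest box in the first column of $\lambda$; $\lambda^1\times\cdots\times\lambda^r$ is defined inductively in the same way. A (skew) standard Young tableau on a diagram with $n$ boxes is a filling with $1,\dots,n$, each used once, increasing left to right along rows and top to bottom along columns. *)

(* Defs.v *)
From HB Require Import structures.
From mathcomp Require Import all_boot all_order all_algebra.
From mathcomp Require Export complex.
From mathcomp Require Import boolp classical_sets functions cardinality fsbigop.
From mathcomp Require Export reals.
From mathcomp Require Import mpoly.

Set Implicit Arguments.
Unset Strict Implicit.
Unset Printing Implicit Defensive.

Import GRing.Theory.
Local Open Scope classical_set_scope.
Local Open Scope ring_scope.

(* The i-subsets of {0, ..., n-1}, as increasing tuples; they index the basis
   e_I = e_{I_0} /\ ... /\ e_{I_{i-1}} of the i-th exterior power of K^n. *)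
Definition multi_index (n i : nat) :=
  {t : i.-tuple 'I_n | sorted ltn (map val t)}.

Definition ext_dim (n i : nat) : nat := #|{: multi_index n i}|.

(* The matrix of the i-th exterior power of A (the i-th compound matrix). *)
Definition compound (K : fieldType) (n i : nat) (A : 'M[K]_n) :
    'M[K]_(ext_dim n i) :=
  \matrix_(a, b)
    \det (mxsub (tnth (val (enum_val a))) (tnth (val (enum_val b))) A).

Section CompleteQuadrics.
Variables (K : fieldType) (n : nat).

(* k : 'I_n.-1 stands for the exponent i = k.+1, which ranges over 1 .. n-1. *)
Let d (k : 'I_n.-1) := ext_dim n k.+1.

Definition quadric_tuple := forall k : 'I_n.-1, {vspace 'M[K]_(d k)}.

(* A point of P(V) is a one-dimensional subspace of V; here V is the space of
   symmetric bilinear forms on the (k+1)-st exterior power of K^n. *)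
Definition proj_prod : set quadric_tuple :=
  [set x | forall k, \dim (x k) = 1%N /\
           forall M, M \in x k -> M^T = M].

Definition compound_point (A : 'M[K]_n) : quadric_tuple :=
  fun k => <[compound k.+1 A]>%VS.

Definition smooth_quadrics : set quadric_tuple :=
  compound_point @` [set A | A^T = A /\ A \in unitmx].

(* One polynomial variable for each matrix entry of each factor. *)
Definition coord_index := {k : 'I_n.-1 & ('I_(d k) * 'I_(d k))%type}.

Definition coords (v : forall k, 'M[K]_(d k)) : 'I_#|{: coord_index}| -> K :=
  fun j => let t := enum_val j in v (tag t) (tagged t).1 (tagged t).2.

Definition multihomogeneous (f : {mpoly K[#|{: coord_index}|]}) : Prop :=
  exists e : 'I_n.-1 -> nat, forall m, m \in msupp f ->
    forall k, (\sum_(j | tag (enum_val j : coord_index) == k) m j)%N = e k.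

Definition vanishes_at (f : {mpoly K[#|{: coord_index}|]}) (x : quadric_tuple) :
    Prop :=
  forall v : (forall k, 'M[K]_(d k)),
    (forall k, v k != 0 /\ x k = <[v k]>%VS) -> f.@[coords v] = 0.

Definition zariski_closed (Z : set quadric_tuple) : Prop :=
  exists F : set {mpoly K[#|{: coord_index}|]},
    (forall f, F f -> multihomogeneous f) /\
    Z = [set x | proj_prod x /\ forall f, F f -> vanishes_at f x].

Definition zariski_closure (S : set quadric_tuple) : set quadric_tuple :=
  [set x | forall Z, zariski_closed Z -> S `<=` Z -> Z x].

Definition complete_quadrics : set quadric_tuple :=
  zariski_closure smooth_quadrics.

(* Induced by g . A = (g^T)^-1 A g^-1 through functoriality of exterior
   powers. *)
Definition quadric_act (g : 'M[K]_n) (x : quadric_tuple) : quadric_tuple :=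
  fun k => (linfun (mulmx (compound k.+1 (invmx g^T)) \o
                    mulmxr (compound k.+1 (invmx g))) @: x k)%VS.

Definition SL_borel : set 'M[K]_n :=
  [set g | \det g = 1 /\ forall i j : 'I_n, (j < i)%N -> g i j = 0].

Definition borel_orbit (x : quadric_tuple) : set quadric_tuple :=
  [set quadric_act g x | g in SL_borel].

Definition borel_orbits : set (set quadric_tuple) :=
  borel_orbit @` complete_quadrics.

End CompleteQuadrics.

Arguments complete_quadrics K n : clear implicits.
Arguments borel_orbits K n : clear implicits.

Definition is_partition (la : seq nat) : bool := sorted geq la && (0 \notin la)%N.

(* A box is a pair (row, column), counted from 0, downwards and rightwards. *)
Definition diagram (la : seq nat) : seq (nat * nat) :=
  [seq (r, c) | r <- iota 0 (size la), c <- iota 0 (nth 0%N la r)].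

Definition shift (dr dc : nat) (D : seq (nat * nat)) : seq (nat * nat) :=
  [seq (b.1 + dr, b.2 + dc)%N | b <- D].

Definition height (D : seq (nat * nat)) : nat := (\max_(b <- D) b.1.+1)%N.

(* D x mu: D moves right by mu_1 and mu goes below it, in the columns from 0.
   The lowest box of the first column of D, at (height D - 1, 0), ends up at
   (height D - 1, mu_1), and the last box of the first row of mu at
   (height D, mu_1 - 1). *)
Definition skew_prod (D : seq (nat * nat)) (mu : seq nat) : seq (nat * nat) :=
  shift 0 (head 0%N mu) D ++ shift (height D) 0 (diagram mu).

(* The empty diagram is a left unit for skew_prod, so this is
   ((la^1 x la^2) x ...) x la^k. *)
Definition skew_diagram (las : seq (seq nat)) : seq (nat * nat) :=
  foldl skew_prod [::] las.

(* The entries are 0, ..., n-1 instead of 1, ..., n. *)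
Definition is_syt (D : seq (nat * nat))
    (T : {ffun seq_sub D -> 'I_(size D)}) : bool :=
  injectiveb T &&
  [forall b : seq_sub D, forall b' : seq_sub D,
    (((val b).1 == (val b').1) && ((val b).2 < (val b').2)%N
     || ((val b).2 == (val b').2) && ((val b).1 < (val b').1)%N)
    ==> (T b < T b')%N].

Definition syt_count (D : seq (nat * nat)) : nat :=
  #|[pred T : {ffun seq_sub D -> 'I_(size D)} | is_syt T]|.

Definition partition_seqs (n : nat) : set (seq (seq nat)) :=
  [set las | [/\ (0 < size las)%N,
                 all (fun la => is_partition la && (la != [::])) las &
                 sumn (map sumn las) = n]].

Lemma finite_seqs (T : choiceType) (A : set T) (m : nat) : finite_set A ->
  finite_set [set s : seq T | (size s <= m)%N /\ {in s, forall x, A x}].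
Proof.
move=> finA; elim: m => [|m IHm].
  apply: (sub_finite_set _ (finite_set1 [::])) => s [/=].
  by rewrite leqn0 size_eq0 => /eqP.
set B := [set s | _] in IHm.
suff fin : finite_set ([set [::]] `|` (fun p => p.1 :: p.2) @` (A `*` B)).
  apply: sub_finite_set fin => -[|x s] [/= szs inA]; [by left|right].
  exists (x, s) => //; split=> /=; first by apply: inA; rewrite mem_head.
  by split=> // y ys; apply: inA; rewrite inE ys orbT.
rewrite finite_setU; split; first exact: finite_set1.
by apply: finite_image; apply: finite_setX.
Qed.

Lemma size_le_sumn (s : seq nat) : all (leq 1) s ->
  (size s <= sumn s)%N /\ {in s, forall x, (x <= sumn s)%N}.
Proof.
elim: s => //= a s IHs /andP[a0 /IHs[h1 h2]]; split; first by rewrite -add1n leq_add.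
move=> x; rewrite inE => /orP[/eqP->|/h2 h]; first exact: leq_addr.
exact: leq_trans h (leq_addl _ _).
Qed.

(* Hence the finitely supported sum over partition_seqs n is a genuine sum
   rather than the default value 0. *)
Lemma finite_partition_seqs (n : nat) : finite_set (partition_seqs n).
Proof.
pose B := [set s : seq nat | (size s <= n)%N /\ {in s, forall x, `I_n.+1 x}].
apply: (sub_finite_set _ (@finite_seqs _ B n _)); last first.
  by apply: finite_seqs; apply: finite_II.
move=> las [_ /allP hp hs].
have pos (la : seq nat) : is_partition la -> all (leq 1) la.
  move=> /andP[_ h0]; apply/allP => x xla; rewrite lt0n.
  by apply: contra h0 => /eqP <-.
have h1 : all (leq 1) (map sumn las).
  apply/allP => _ /mapP[la /hp /andP[pla]] + ->.
  by case: la pla => // a la /pos /= /andP[a0 _] _; rewrite (leq_trans a0) ?leq_addr.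
have [] := size_le_sumn h1; rewrite hs size_map => sz le.
split=> // la lal; have /andP[/pos/size_le_sumn[szla lela] _] := hp _ lal.
have len : (sumn la <= n)%N by apply: le; apply: map_f.
split; first exact: leq_trans szla len.
by move=> x /lela h; rewrite /= ltnS; apply: leq_trans h len.
Qed.

(* Main.v *)
(** Every complete quadric has a B-translate of the form: the limit at t = 0 of
    the compounds of diag(t ^ w) P_s, where s is an involution of {0, ..., n-1}
    and w a weight with w o s = w, that is, an ordered set partition with an
    involution on each block.

    To see this, let x be in the closure. A linear form built from the complex
    conjugate of a component of x shows that for a generic g all the leading
    coefficients of g x are nonzero. Where the leading coefficients do not
    vanish, the factors L and D of A = L D L^T, with D taken through the ratios
    of consecutive diagonal entries, are regular functions of the compounds of
    A, and the identities expressing the compounds through L and the ratios are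
    closed conditions. So x is a translate of the limit of a diagonal matrix
    with weights, and the Bruhat decomposition of the translating matrix
    followed by triangular congruence on the blocks gives the normal form.
    Conversely, such limits are in the closure because a polynomial that
    vanishes for t <> 0 vanishes at t = 0. Different normal forms are in
    different orbits, because lower triangular changes of basis preserve the
    supports of the partial monomial matrices that are their components.

    On the other side, the largest entry of a tableau gives the recursion of
    linear extensions. The relation DU = UD + 1 in Young's lattice shows that
    the numbers of standard tableaux of all shapes of size n satisfy the
    recurrence t(n+2) = t(n+1) + (n+1) t(n) of the numbers of involutions.
    Removing one block at a time then gives the same recurrence for the skew
    tableaux and for the normal forms. *)

Require Import Defs.
From mathcomp Require Import all_boot all_order all_algebra all_fingroup.
From mathcomp Require Import zify ring.

Set Implicit Arguments.
Unset Strict Implicit.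
Unset Printing Implicit Defensive.

Import Order.TTheory GRing.Theory Num.Theory.

(** * Linear extensions and standard Young tableaux *)

(** The closure is given by the vanishing of polynomials alone, so no curve of smooth quadrics
    through a given boundary point is at hand. Facts about boundary points are therefore identities
    between fractions of multidegree 0 that hold on the smooth quadrics and survive after the
    denominators are cleared. Ratios of consecutive diagonal entries are the right coordinates for
    this: every diagonal minor divided by the leading one is a polynomial in them, which still makes
    sense when some ratios are 0, and each zero ratio becomes a jump of the weight.

    The Borel subgroup acts through inverse transposes, hence as lower triangular congruence; the
    condition on the determinant disappears because scalars act trivially on lines. One symmetric
    elimination, [congruent_involution], serves the normal form, the square roots of symmetric
    matrices, the Bruhat decomposition and the factorization [L D L^T].

    A limit depends only on the order of the weights. Replacing each weight by the number of indices
    of smaller weight makes the data canonical, and these ranks are the block labels that the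
    enumeration counts. *)

Lemma eq_card_can_in (T U : finType) (A : {pred T}) (B : {pred U})
    (f : T -> U) (g : U -> T) :
  (forall x, x \in A -> f x \in B /\ g (f x) = x) ->
  (forall y, y \in B -> g y \in A /\ f (g y) = y) -> #|A| = #|B|.
Proof.
move=> fP gP; have injf : {in A &, injective f}.
  by move=> x y /fP[_ fx] /fP[_ fy] e; rewrite -fx e.
rewrite -(card_in_imset injf); apply: eq_card => y; apply/imsetP/idP.
  by move=> [x /fP[? _] ->].
by move=> /gP[? <-]; exists (g y); rewrite ?gP.
Qed.

Section LinearExtensions.
Variables (T : eqType) (lt : rel T).

Definition maximal_in (D : seq T) (b : T) := all (fun c => ~~ lt b c) D.

(** Each [b] is a candidate for the carrier of the largest label, and the fuel [m] is meant to be
    [size D]. Maximality tests only pairs related by [lt], which suits [before]: it compares boxes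
    of a common row or column and is not transitive. *)
Fixpoint lext_rec (m : nat) (D : seq T) : nat :=
  if m is m'.+1 then \sum_(b <- D | maximal_in D b) lext_rec m' (rem b D) else 1.

Definition lext (D : seq T) := lext_rec (size D) D.

Lemma perm_rem (b : T) (D D' : seq T) :
  perm_eq D D' -> perm_eq (rem b D) (rem b D').
Proof.
move=> DD'; apply/seq.permP => p; case: (boolP (b \in D)) => bD.
  have bD' : b \in D' by rewrite -(perm_mem DD').
  have := seq.permP DD' p.
  by rewrite (seq.permP (perm_to_rem bD)) (seq.permP (perm_to_rem bD')) /= => /addnI.
by rewrite !rem_id ?(seq.permP DD') // -(perm_mem DD').
Qed.

Lemma rem_cat (b : T) (D E : seq T) :
  rem b (D ++ E) = if b \in D then rem b D ++ E else D ++ rem b E.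
Proof.
elim: D => //= c D IHD; rewrite inE eq_sym; case: eqP => //= _.
by rewrite IHD; case: ifP.
Qed.

Lemma lext_rec_perm m (D D' : seq T) :
  perm_eq D D' -> lext_rec m D = lext_rec m D'.
Proof.
elim: m D D' => //= m IHm D D' DD'; rewrite (perm_big _ DD') /=.
rewrite [RHS]big_mkcond [LHS]big_mkcond; apply: eq_bigr => b _.
by rewrite /maximal_in (perm_all _ DD'); case: ifP => // _; apply/IHm/perm_rem.
Qed.

Lemma lext_perm (D D' : seq T) : perm_eq D D' -> lext D = lext D'.
Proof. by move=> DD'; rewrite /lext (perm_size DD'); apply: lext_rec_perm. Qed.

Lemma lext_nil : lext [::] = 1. Proof. by []. Qed.

Lemma lextE (D : seq T) : D != [::] ->
  lext D = \sum_(b <- D | maximal_in D b) lext (rem b D).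
Proof.
rewrite /lext; case sD: (size D) => [|m]; first by move/size0nil: sD => ->.
move=> _ /=; rewrite big_seq_cond [RHS]big_seq_cond; apply: eq_bigr => b /andP[bD _].
by rewrite size_rem // sD.
Qed.

(* Without relations between the two parts, the largest label sits in either
   part, which is Pascal's rule. *)
Lemma lext_cat (D E : seq T) :
  {in D & E, forall b c, ~~ lt b c && ~~ lt c b} -> uniq (D ++ E) ->
  lext (D ++ E) = 'C(size D + size E, size D) * (lext D * lext E).
Proof.
move: {2}(size D + size E) (leqnn (size D + size E)) => m.
elim: m D E => [|m IHm] D E.
  by rewrite leqn0 addn_eq0 => /andP[/nilP-> /nilP->].
case: (altP (D =P [::])) => [->|D0] szm inc uDE.
  by rewrite /= bin0 mul1n lext_nil mul1n.
case: (altP (E =P [::])) => [->|E0].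
  by rewrite /= cats0 addn0 binn mul1n lext_nil muln1.
rewrite lextE; last by case: (D) D0.
have D'0 : 0 < size D by rewrite lt0n size_eq0.
have E'0 : 0 < size E by rewrite lt0n size_eq0.
have [uD /hasPn disj uE] := and3P (etrans (esym (cat_uniq D E)) uDE).
rewrite big_cat /=.
have -> : \sum_(b <- D | maximal_in (D ++ E) b) lext (rem b (D ++ E)) =
    'C((size D).-1 + size E, (size D).-1) * (lext D * lext E).
  rewrite (lextE D0) big_distrl big_distrr /= big_seq_cond [RHS]big_seq_cond.
  apply: eq_big => b.
    case: (boolP (b \in D)) => //= bD; rewrite /maximal_in all_cat andbC.
    have -> // : all (fun c => ~~ lt b c) E.
    by apply/allP => c cE; have /andP[] := inc _ _ bD cE.
  move=> /andP[bD _]; rewrite rem_cat bD IHm ?size_rem //; first by lia.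
  - by move=> x y /mem_rem xD yE; apply: inc.
  - rewrite cat_uniq rem_uniq // uE andbT /=.
    by apply/hasPn => x /disj; apply: contra; apply: mem_rem.
have -> : \sum_(b <- E | maximal_in (D ++ E) b) lext (rem b (D ++ E)) =
    'C(size D + (size E).-1, size D) * (lext D * lext E).
  rewrite (lextE E0) big_distrr big_distrr /= big_seq_cond [RHS]big_seq_cond.
  apply: eq_big => b.
    case: (boolP (b \in E)) => //= bE; rewrite /maximal_in all_cat.
    have -> // : all (fun c => ~~ lt b c) D.
    by apply/allP => c cD; have /andP[] := inc _ _ cD bE.
  move=> /andP[bE _]; have bD : (b \in D) = false by apply/negbTE/disj.
  rewrite rem_cat bD IHm ?size_rem //; first by lia.
  - by move=> x y xD /mem_rem yE; apply: inc.
  - rewrite cat_uniq rem_uniq // uD andbT /=.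
    by apply/hasPn => x /mem_rem/disj.
rewrite -mulnDl; congr (_ * _).
rewrite -(prednK D'0) -(prednK E'0) /=.
by rewrite [in RHS]addSn binS addnC addSnnS.
Qed.

End LinearExtensions.

Lemma lext_map (T U : eqType) (lt : rel T) (lt' : rel U) (f : T -> U) (D : seq T) :
  injective f -> (forall b c, lt' (f b) (f c) = lt b c) ->
  lext lt' (map f D) = lext lt D.
Proof.
move=> injf fP; rewrite /lext size_map.
move: (size D) => m; elim: m D => //= m IHm E; rewrite big_map.
apply: eq_big => [b|b _]; first by rewrite /maximal_in all_map; apply: eq_all => c /=; rewrite fP.
rewrite -IHm; congr lext_rec.
by elim: E => //= c E IHE; rewrite (inj_eq injf); case: ifP => //= _; rewrite IHE.
Qed.

(** * Tableaux as labelings, counted by removing the largest label *)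

Section Labelings.
Variables (T : finType) (lt : rel T) (N : nat).

(** The codomain is fixed by [N] so that it stays the same when the induction removes an element of
    [X]; the value [ord0] outside [X] makes restriction to [X] lossless. *)
Definition labeling (X : {set T}) (f : {ffun T -> 'I_N.+1}) : bool :=
  [&& [forall x, (x \notin X) ==> (f x == ord0)],
      [forall x in X, f x < #|X|],
      [forall x in X, forall y in X, (f x == f y) ==> (x == y)] &
      [forall x in X, forall y in X, lt x y ==> (f x < f y)]].

Lemma labelingP (X : {set T}) (f : {ffun T -> 'I_N.+1}) :
  reflect [/\ forall x, x \notin X -> f x = ord0, forall x, x \in X -> f x < #|X|,
              {in X &, injective f} & {in X &, forall x y, lt x y -> f x < f y}]
          (labeling X f).
Proof.
apply: (iffP and4P) => -[h1 h2 h3 h4]; split.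
- by move=> x xX; apply/eqP; move/forallP/(_ x): h1; rewrite xX.
- by move=> x xX; move/forall_inP: h2; apply.
- move=> x y xX yX e; move/forall_inP/(_ x xX)/forall_inP/(_ y yX): h3.
  by rewrite e eqxx => /eqP.
- by move=> x y xX yX; move/forall_inP/(_ x xX)/forall_inP/(_ y yX)/implyP: h4.
- by apply/forallP => x; apply/implyP => /h1 ->.
- by apply/forall_inP.
- apply/forall_inP => x xX; apply/forall_inP => y yX.
  by apply/implyP => /eqP/h3 ->.
- apply/forall_inP => x xX; apply/forall_inP => y yX.
  by apply/implyP/h4.
Qed.

Definition relabel (b : T) (i : nat) (f : {ffun T -> 'I_N.+1}) : {ffun T -> 'I_N.+1} :=
  [ffun x => if x == b then inord i else f x].

(** Labelings are sorted by the element [b] with the top label [#|X| - 1]. If [b] is maximal,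
    deleting its label is a bijection onto the labelings of [X :\ b]; otherwise there are none. *)
Lemma card_labeling (X : {set T}) : #|X| <= N ->
  #|[pred f | labeling X f]| = lext lt (enum X).
Proof.
move: {2}#|X| (erefl #|X|) => m; elim: m X => [|m IHm] X cX leN.
  move/cards0_eq: cX => ->; rewrite enum_set0 lext_nil.
  rewrite (@eq_card1 _ [ffun=> ord0]) // => f; rewrite !inE; apply/labelingP/eqP.
    by move=> [h _ _ _]; apply/ffunP => x; rewrite ffunE h ?inE.
  by move=> ->; split => x; rewrite ?inE ?ffunE.
rewrite lextE -?size_eq0 -?cardE ?cX //.
have -> : #|[pred f | labeling X f]| =
    \sum_(b in X) #|[pred f : {ffun T -> 'I_N.+1} | labeling X f & f b == inord m]|.
  transitivity (\sum_(f : {ffun T -> 'I_N.+1} | labeling X f) \sum_(b in X | f b == inord m) 1).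
    rewrite -sum1_card; apply: eq_bigr => f /labelingP[f0 fm finj _].
    suff [b bX fb] : exists2 b, b \in X & f b = inord m.
      rewrite (big_pred1 b) // => c; apply/andP/eqP => [[cX' /eqP fc]|-> //].
        by apply: finj => //; rewrite fc fb.
      by rewrite bX fb.
    (* [f] is injective on [X], so by cardinality it takes every value below [m.+1], in particular
       [m]. *)
    have : [set x | inord m == x] \subset f @: X.
      have -> : f @: X = [set i : 'I_N.+1 | i < m.+1].
        apply/eqP; rewrite eqEcard card_in_imset // cX; apply/andP; split.
          by apply/subsetP => _ /imsetP[x /fm + ->]; rewrite inE cX.
        rewrite -[leqRHS]card_ord; have lN : m.+1 <= N.+1 by rewrite -cX ltnW.
        have injw : injective (widen_ord lN) by move=> i j /(congr1 val) /= /val_inj.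
        rewrite -(card_imset _ injw); apply/subset_leq_card.
        apply/subsetP => i; rewrite inE => im; apply/imsetP; exists (Ordinal im) => //.
        exact: val_inj.
      apply/subsetP => x; rewrite !inE => /eqP <-; rewrite inordK // -cX; exact: leqW.
    by move=> /subsetP/(_ (inord m)); rewrite inE eqxx => /(_ isT)/imsetP[b ? ->]; exists b.
  rewrite (exchange_big_dep (mem X)) /=; last by move=> f b _ /andP[].
  by apply: eq_bigr => b bX; rewrite -sum1_card; apply: eq_bigl => f; rewrite !inE bX.
rewrite -big_enum [RHS]big_mkcond /= [LHS]big_seq [RHS]big_seq.
under eq_bigl => b do rewrite mem_enum.
under [RHS]eq_bigl => b do rewrite mem_enum.
apply: eq_bigr => b bX.
have mN : m <= N by rewrite ltnW // -cX.
case: ifP => [/allP bmax|bmax]; last first.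
  apply: eq_card0 => f; rewrite !inE; apply/negP => /andP[/labelingP[_ fm _ fmono] /eqP fb].
  move/negP: bmax; apply; apply/allP => c; rewrite mem_enum => cX'; apply/negP => /(fmono _ _ bX cX').
  by have := fm _ cX'; rewrite cX fb inordK // ltnS => h1 /(leq_trans) /(_ h1); rewrite ltnn.
have cXb : #|X :\ b| = m by have := cardsD1 b X; rewrite bX cX => -[].
have -> : lext lt (rem b (enum X)) = lext lt (enum (X :\ b)).
  apply: lext_perm; apply: uniq_perm; rewrite ?rem_uniq ?enum_uniq // => x.
  by rewrite (rem_filter _ (enum_uniq _)) mem_filter !mem_enum !inE.
rewrite -IHm // ?cXb //.
apply: (@eq_card_can_in _ _ _ _ (relabel b 0) (relabel b m)) => f; rewrite !inE.
  move=> /andP[/labelingP[f0 fm finj fmono] /eqP fb]; split; last first.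
    by apply/ffunP => x; rewrite !ffunE; case: eqP => // ->.
  apply/labelingP; split => [x|x|x y|x y].
  - rewrite !inE negb_and negbK ffunE; case: eqP => //= _; last exact: f0.
    by move=> _; apply: val_inj; rewrite /= inordK.
  - rewrite !inE ffunE => /andP[xb xX]; rewrite (negbTE xb) cXb ltn_neqAle.
    rewrite -ltnS -cX fm // andbT; apply: contra xb => /eqP fxm.
    by apply/eqP/finj => //; rewrite fb; apply/val_inj; rewrite /= inordK.
  - by rewrite !inE !ffunE => /andP[/negbTE-> ?] /andP[/negbTE-> ?]; apply: finj.
  - by rewrite !inE !ffunE => /andP[/negbTE-> ?] /andP[/negbTE-> ?]; apply: fmono.
move=> /labelingP[f0 fm finj fmono]; split; last first.
  apply/ffunP => x; rewrite !ffunE; case: eqP => // ->.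
  by apply: val_inj; rewrite f0 ?inE ?eqxx //= inordK.
have fmX x : x \in X -> x != b -> f x < m by rewrite -cXb => ? ?; apply: fm; rewrite !inE; apply/andP.
apply/andP; split; last by rewrite ffunE eqxx.
apply/labelingP; split => [x|x|x y|x y].
- by move=> xX; rewrite ffunE; case: eqP xX => [->|_ xX]; rewrite ?bX // f0 // !inE (negbTE xX) andbF.
- by move=> xX; rewrite ffunE cX; case: eqP => [_|/eqP xb]; rewrite ?inordK // leqW ?fmX.
- move=> xX yX; rewrite !ffunE; case: eqP => [->|/eqP xb]; case: eqP => [->|/eqP yb] //.
  + by move=> /(congr1 val)/=; rewrite inordK // => e; have := fmX _ yX yb; rewrite -e ltnn.
  + by move=> /(congr1 val)/=; rewrite inordK // => e; have := fmX _ xX xb; rewrite e ltnn.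
  + by apply: finj; rewrite !inE; apply/andP.
- move=> xX yX ltxy; rewrite !ffunE; case: eqP => [xb|/eqP xb].
    by have := bmax y; rewrite mem_enum -xb ltxy => /(_ yX).
  case: eqP => [yb|/eqP yb]; first by rewrite inordK // fmX.
  by apply: fmono => //; rewrite !inE; apply/andP.
Qed.

End Labelings.

Definition before (b c : nat * nat) : bool :=
  (b.1 == c.1) && (b.2 < c.2) || (b.2 == c.2) && (b.1 < c.1).

Lemma syt_count_lext (D : seq (nat * nat)) : uniq D ->
  syt_count D = lext before D.
Proof.
move=> uD; pose lt (x y : seq_sub D) := before (val x) (val y).
have cD : #|[set: seq_sub D]| = size D by rewrite cardsT card_seq_sub.
have -> : lext before D = lext lt (enum [set: seq_sub D]).
  rewrite -(lext_map (lt' := before) (f := val)) //; last exact: val_inj.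
  apply: lext_perm; apply: uniq_perm => //.
    by rewrite map_inj_uniq ?enum_uniq //; apply: val_inj.
  move=> b; apply/idP/mapP => [bD|[x _ ->]]; last exact: ssvalP.
  by exists (SeqSub bD); rewrite // mem_enum inE.
rewrite -(@card_labeling _ lt (size D)) ?cD // /syt_count.
(* [D0] only supplies the default value of [insubd] in [ofN]; on labelings the bound on the labels
   keeps every value in range. *)
have D0 (x : seq_sub D) : 0 < size D by rewrite -has_predT; apply/hasP; exists (ssval x) => //; apply: ssvalP.
pose toN (f : {ffun seq_sub D -> 'I_(size D)}) : {ffun seq_sub D -> 'I_(size D).+1} :=
  [ffun x => widen_ord (leqnSn _) (f x)].
pose ofN (f : {ffun seq_sub D -> 'I_(size D).+1}) : {ffun seq_sub D -> 'I_(size D)} :=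
  [ffun x => insubd (Ordinal (D0 x)) (val (f x))].
apply: (eq_card_can_in (f := toN) (g := ofN)) => f; rewrite !inE.
  move=> /andP[/injectiveP finj /forallP fmono]; split; last first.
    by apply/ffunP => x; rewrite !ffunE; apply: val_inj; rewrite val_insubd /= ltn_ord.
  apply/labelingP; split => [x|x|x y _ _|x y _ _ ltxy]; rewrite ?inE // ?ffunE ?cD //=.
    by move/(congr1 val) => /= /val_inj/finj.
  by move/(_ x)/forallP/(_ y)/implyP: fmono; apply.
move=> /labelingP[_ fm finj fmono].
have vof x : val (ofN f x) = f x.
  by have := fm x; rewrite inE cD ffunE val_insubd => /(_ isT) ->.
split; last by apply/ffunP => x; apply: val_inj; rewrite ffunE /= -[RHS]vof.
apply/andP; split.
  by apply/injectiveP => x y /(congr1 val); rewrite !vof => /val_inj/finj; apply.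
apply/forallP => x; apply/forallP => y; apply/implyP => ltxy.
by have := fmono x y; rewrite -!vof; apply; rewrite ?inE.
Qed.

(** * Adding and removing boxes in Young's lattice *)

Section YoungLattice.

Notation row la r := (nth 0 la r).

Lemma partitionP (la : seq nat) :
  reflect ((forall i, row la i.+1 <= row la i) /\
           (forall i, i < size la -> 0 < row la i)) (is_partition la).
Proof.
apply: (iffP andP) => [[/(sortedP 0) dec no0]|[dec pos]].
  split=> i; last by move=> ila; rewrite lt0n; apply: contra no0 => /eqP <-; apply: mem_nth.
  by case: (ltnP i.+1 (size la)) => [/dec //|h]; rewrite nth_default.
split; first by apply/(sortedP 0) => i _; apply: dec.
by apply/negP => /(nthP 0)[i /pos + e]; rewrite e.
Qed.

Lemma eq_partition (la mu : seq nat) : is_partition la -> is_partition mu ->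
  (forall i, row la i = row mu i) -> la = mu.
Proof.
move=> /partitionP[_ pla] /partitionP[_ pmu] e; apply: (@eq_from_nth _ 0) => [|i _]; last exact: e.
apply/eqP; rewrite eqn_leq; apply/andP; split; rewrite leqNgt; apply/negP.
  by move=> /pla; rewrite e nth_default.
by move=> /pmu; rewrite -e nth_default.
Qed.

Lemma partition_size (la : seq nat) : is_partition la -> size la <= sumn la.
Proof.
move=> /andP[_ h0]; have [] // := @size_le_sumn la.
by apply/allP => x xla; rewrite lt0n; apply: contra h0 => /eqP <-.
Qed.

Definition addable (la : seq nat) (r : nat) := (r == 0) || (row la r < row la r.-1).
Definition removable (la : seq nat) (r : nat) := row la r.+1 < row la r.
(** A removable row of length 1 is the last row, so cutting there, instead of writing 0, keeps the
    sequence free of zeros. *)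
Definition remove_box (la : seq nat) (r : nat) :=
  if row la r == 1 then take r la else set_nth 0 la r (row la r).-1.

Lemma addable_size (la : seq nat) r : addable la r -> r <= size la.
Proof. by case: r => // r /=; rewrite /addable /=; apply: contraLR; rewrite -ltnNge => h; rewrite !nth_default // ltnW. Qed.

Lemma removable_size (la : seq nat) r : removable la r -> r < size la.
Proof. by apply: contraLR; rewrite -leqNgt /removable => h; rewrite !nth_default // ltnW. Qed.

Lemma row_remove (la : seq nat) r : is_partition la -> removable la r ->
  forall i, row (remove_box la r) i = row la i - (r == i).
Proof.
move=> /partitionP[dec _] rem i; rewrite /remove_box; case: eqP => [r1|_]; last first.
  by rewrite nth_set_nth /= eq_sym; case: eqP => [->|_]; rewrite ?subn1 ?subn0.
have rla := removable_size rem.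
case: (ltnP i r) => ir; first by rewrite nth_take // (gtn_eqF ir) subn0.
rewrite nth_default; last by rewrite size_takel // ltnW.
case: eqP => [<-|/eqP ri]; first by rewrite r1.
suff -> : row la i = 0 by [].
have {ri}ir : r < i by rewrite ltn_neqAle ri ir.
apply/eqP; rewrite -leqn0 -ltnS -r1.
apply: leq_trans rem; rewrite ltnS -(subnKC ir); elim: (i - _) => [|m IHm]; first by rewrite addn0.
by apply: leq_trans IHm; rewrite addnS; apply: dec.
Qed.

Lemma add_partition (la : seq nat) r : is_partition la -> addable la r ->
  is_partition (incr_nth la r).
Proof.
move=> /partitionP[dec pos] add; apply/partitionP; split=> i; rewrite !nth_incr_nth.
  have := dec i; case: eqP => [e|_]; last by lia.
  by move: add; rewrite /addable e /=; lia.
move=> iS; case: eqP => // /eqP ri; apply: pos; move: iS; rewrite size_incr_nth.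
case: (ltnP r (size la)) => // _; rewrite ltnS leq_eqVlt eq_sym (negbTE ri) /= => /leq_trans; apply.
exact: addable_size.
Qed.

Lemma remove_partition (la : seq nat) r : is_partition la -> removable la r ->
  is_partition (remove_box la r).
Proof.
move=> pla rem; have [dec pos] := partitionP _ pla; apply/partitionP; split=> i.
  by rewrite !row_remove //; have := dec i; move: rem; rewrite /removable; case: (r =P i) => [->|_]; case: eqP; lia.
have rla := removable_size rem.
rewrite row_remove // /remove_box; case: eqP => [r1|r1].
  by rewrite size_takel ?(ltnW rla) // => ir; rewrite (gtn_eqF ir) subn0 pos // (ltn_trans ir).
rewrite size_set_nth (maxn_idPr rla) => ila; have := pos _ ila.
by case: eqP => [<-|_]; lia.
Qed.

Lemma removable_add (la : seq nat) r : is_partition la -> removable (incr_nth la r) r.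
Proof.
by move=> /partitionP[dec _]; rewrite /removable !nth_incr_nth; have := dec r; lia.
Qed.

Lemma addable_remove (la : seq nat) r : is_partition la -> removable la r ->
  addable (remove_box la r) r.
Proof.
move=> pla rem; rewrite /addable; case: r rem => //= r rem.
rewrite !row_remove //; have /partitionP[dec _] := pla; have := dec r.
by move: rem; rewrite /removable; lia.
Qed.

Lemma addK_box (la : seq nat) r : is_partition la -> addable la r ->
  remove_box (incr_nth la r) r = la.
Proof.
move=> pla add; apply: eq_partition => // [|i].
  by apply: remove_partition; rewrite ?add_partition ?removable_add.
by rewrite row_remove ?add_partition ?removable_add // nth_incr_nth addKn.
Qed.

Lemma removeK_box (la : seq nat) r : is_partition la -> removable la r ->
  incr_nth (remove_box la r) r = la.
Proof.
move=> pla rem; apply: eq_partition => // [|i].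
  by apply: add_partition; rewrite ?remove_partition ?addable_remove.
rewrite nth_incr_nth row_remove //; move: rem; rewrite /removable.
by case: eqP => [->|_]; lia.
Qed.

Lemma sumn_incr_nth (la : seq nat) r : sumn (incr_nth la r) = (sumn la).+1.
Proof.
elim: la r => [|a la IHla] [|r] //=; last by rewrite IHla addnS.
by elim: r => //= r ->.
Qed.

Lemma sumn_remove (la : seq nat) r : is_partition la -> removable la r ->
  sumn la = (sumn (remove_box la r)).+1.
Proof. by move=> pla rem; rewrite -(sumn_incr_nth _ r) removeK_box. Qed.

(** Off the diagonal the up and down operators commute path by path; the surplus 1 in DU = UD + 1
    comes from [r = s] alone, through [sum_addable]. *)
Lemma add_remove_comm (la : seq nat) r s : is_partition la -> r != s ->
  addable la r && removable (incr_nth la r) s =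
  removable la s && addable (remove_box la s) r.
Proof.
move=> pla rs; have [dec _] := partitionP _ pla.
apply/andP/andP => -[].
  move=> add; rewrite /removable !nth_incr_nth (negbTE rs) => rem.
  have rem' : removable la s by rewrite /removable; lia.
  split=> //; move: add; rewrite /addable; case: r rs rem => //= r rs rem.
  by rewrite !row_remove //; move: rs rem; rewrite !eqSS; case: (r =P s) => [->|]; lia.
move=> rem; rewrite /addable; case: r rs => [|r] rs /=; rewrite ?row_remove //.
  move=> _; split=> //; move: rem; rewrite /removable !nth_incr_nth (negbTE rs) /=; lia.
move=> add; split; first by lia.
move: rem rs add; rewrite /removable !nth_incr_nth eqSS eq_sym.
by rewrite (eq_sym s r); case: (r =P s) => [->|]; case: eqP; lia.
Qed.

Lemma remove_add_comm (la : seq nat) r s : is_partition la -> r != s ->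
  addable la r -> removable (incr_nth la r) s ->
  remove_box (incr_nth la r) s = incr_nth (remove_box la s) r.
Proof.
move=> pla rs add rem; have /andP[rem' add'] : removable la s && addable (remove_box la s) r.
  by rewrite -add_remove_comm // add.
apply: eq_partition => [||i].
- by apply: remove_partition; rewrite ?add_partition.
- by apply: add_partition; rewrite ?remove_partition.
rewrite row_remove ?add_partition // !nth_incr_nth row_remove //.
by move: rem' rs; rewrite /removable; case: (r =P i) => [->|_]; case: (s =P i) => [<-|_]; lia.
Qed.

(** Row [r.+1] is addable exactly when row [r] is removable. Row 0, always addable, is the surplus
    one, and the last index is not removable because it lies past the diagram. *)
Lemma sum_addable (la : seq nat) N : size la < N ->
  \sum_(r < N | addable la r) 1 = (\sum_(r < N | removable la r) 1).+1.
Proof.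
case: N => // N szN; rewrite [LHS]big_mkcond [in RHS]big_mkcond /= big_ord_recl big_ord_recr /=.
by rewrite [X in _ = (_ + X).+1]ifN ?addn0 // /removable !nth_default // ltnW.
Qed.

Lemma mem_diagram (la : seq nat) b : (b \in diagram la) = (b.2 < row la b.1).
Proof.
apply/allpairsPdep/idP => [[r [c []]]|lt].
  by rewrite !mem_iota /= add0n => _ h ->.
exists b.1, b.2; rewrite !mem_iota /= !add0n -surjective_pairing; split=> //.
by rewrite ltnNge; apply/negP => h; rewrite nth_default in lt.
Qed.

Lemma uniq_diagram (la : seq nat) : uniq (diagram la).
Proof.
apply: allpairs_uniq_dep => [|r _|]; rewrite ?iota_uniq //.
by move=> [r c] [s d] _ _ /= [-> ->].
Qed.

Lemma maximal_diagram (la : seq nat) r c : is_partition la -> c < row la r ->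
  maximal_in before (diagram la) (r, c) = removable la r && (c == (row la r).-1).
Proof.
move=> /partitionP[dec _] lt; apply/allP/andP => [h|[rem /eqP ec] [i j]].
  have h1 := h (r, c.+1); have h2 := h (r.+1, c).
  rewrite !mem_diagram /before /= in h1 h2.
  by rewrite /removable; split; move: h1 h2; rewrite !eqxx ?ltnSn ?orbT /=; lia.
rewrite mem_diagram /before /= => ji; apply/negP => /orP[/andP[/eqP e]|/andP[/eqP e ri]].
  by rewrite e in ec *; lia.
have : row la i <= row la r.+1.
  rewrite -(subnKC ri); elim: (i - _) => [|m IHm]; first by rewrite addn0.
  by apply: leq_trans IHm; rewrite addnS; apply: dec.
by move: rem; rewrite /removable; lia.
Qed.

Definition num_syt (la : seq nat) : nat := lext before (diagram la).

(** The largest entry sits at the end of a removable row. [N] may exceed the number of rows, so that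
    the sums for [la] and for its neighbours in Young's lattice share one index range. *)
Lemma num_sytE (la : seq nat) N : is_partition la -> la != [::] -> size la <= N ->
  num_syt la = \sum_(r < N | removable la r) num_syt (remove_box la r).
Proof.
move=> pla la0 szN; rewrite /num_syt lextE; last first.
  have [_ pos] := partitionP _ pla; apply/eqP => d0.
  have : (0, 0) \in diagram la by rewrite mem_diagram pos // lt0n size_eq0.
  by rewrite d0.
transitivity (\sum_(r < size la | removable la r) num_syt (remove_box la r)); last first.
  rewrite (big_ord_widen_cond _ (removable la) (fun r => num_syt (remove_box la r)) szN).
  by apply: eq_bigl => r; case: (boolP (removable la r)) => //= /removable_size ->.
rewrite big_mkcond /= big_allpairs_dep /=.
rewrite -[in iota 0 _](subn0 (size la)) -/(index_iota 0 (size la)) big_mkord [RHS]big_mkcond /=; apply: eq_bigr => r _.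
case: (boolP (removable la r)) => rem.
  rewrite (bigD1_seq (row la r).-1) ?iota_uniq ?mem_iota //=; last first.
    by move: rem; rewrite /removable; lia.
  rewrite maximal_diagram ?rem ?eqxx //=; last by move: rem; rewrite /removable; lia.
  rewrite big1_seq ?addn0 => [|c /andP[/negbTE cr]]; last first.
    by rewrite mem_iota /= => cl; rewrite maximal_diagram // cr andbF.
  apply: lext_perm; apply: uniq_perm; rewrite ?rem_uniq ?uniq_diagram // => -[i j].
  rewrite (rem_filter _ (uniq_diagram _)) mem_filter !mem_diagram /= xpair_eqE row_remove //.
  by move: rem; rewrite /removable; case: (val r =P i) => [->|]; rewrite ?eqxx /=; [|case: eqP]; lia.
rewrite big1_seq // => c; rewrite mem_iota /= => cl.
by rewrite maximal_diagram // (negbTE rem).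
Qed.

Lemma num_syt_nil : num_syt [::] = 1. Proof. by []. Qed.

(* The relation DU = UD + 1 of Young's lattice, evaluated on num_syt. *)
Lemma sum_num_syt_add (la : seq nat) N : is_partition la -> size la < N ->
  \sum_(r < N | addable la r) num_syt (incr_nth la r) = (sumn la).+1 * num_syt la.
Proof.
move: {2}(sumn la) (erefl (sumn la)) => m; elim: m la => [|m IHm] la sla pla szN.
  have la0 : la = [::].
    by apply/nilP; rewrite /nilp -leqn0 -sla partition_size.
  rewrite la0 in szN *; case: N szN => // N _.
  rewrite big_mkcond big_ord_recl /= big1 ?addn0 => [|i _].
    by rewrite num_syt_nil (@num_sytE [:: 1] 2) // big_mkcond !big_ord_recl big_ord0.
  by rewrite /addable /= nth_nil.
have la0 : la != [::] by case: (la) sla.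
pose F r s := num_syt (remove_box (incr_nth la r) s).
pose G s r := num_syt (incr_nth (remove_box la s) r).
have fE (r : 'I_N) : addable la r -> num_syt (incr_nth la r) = num_syt la +
    \sum_(s < N | (s != r) && removable (incr_nth la r) s) F r s.
  move=> add; have padd := add_partition pla add.
  rewrite (@num_sytE _ N) //; first last.
  - rewrite size_incr_nth; case: ifP => // _; exact: ltnW.
  - by rewrite -size_eq0 size_incr_nth; case: ifP => //; rewrite size_eq0.
  rewrite (bigD1 r) /=; last exact: removable_add.
  by rewrite addK_box //; congr addn; apply: eq_bigl => s; rewrite andbC.
under eq_bigr => r add do rewrite fE //.
rewrite big_split /=.
have -> : \sum_(r < N | addable la r) \sum_(s < N | (s != r) && removable (incr_nth la r) s) F r s =
   \sum_(s < N | removable la s) \sum_(r < N | (r != s) && addable (remove_box la s) r) G s r.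
  rewrite (exchange_big_dep (fun s : 'I_N => removable la s)) /=; last first.
    move=> r s add /andP[sr rem]; have := add_remove_comm pla (_ : val r != s).
    by rewrite eq_sym sr add rem => /(_ isT)/esym/andP[].
  apply: eq_bigr => s rem; apply: eq_big => r.
    case: (altP (s =P r)) => [->|sr]; rewrite ?eqxx ?andbF //=.
    rewrite eq_sym sr /=; have := add_remove_comm pla (_ : val r != s).
    by rewrite eq_sym sr rem => /(_ isT) ->.
  by move=> /and3P[add sr rem']; rewrite /F /G remove_add_comm // eq_sym.
(* Both sides receive the missing terms [r = s], in which the removed box is put back. This
   completes each inner sum, and the induction hypothesis applies to [remove_box la s]. *)
apply/eqP; rewrite -(eqn_add2r (\sum_(s < N | removable la s) num_syt la)) -addnA -big_split /=.
have -> : \sum_(s < N | removable la s)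
      (\sum_(r < N | (r != s) && addable (remove_box la s) r) G s r + num_syt la) =
    \sum_(s < N | removable la s) sumn la * num_syt (remove_box la s).
  apply: eq_bigr => s rem; have srem := sumn_remove pla rem.
  rewrite srem -IHm ?remove_partition //.
  - rewrite [RHS](bigD1 s) /=; last exact: addable_remove.
    by rewrite removeK_box // addnC; congr addn; apply: eq_bigl => r; rewrite andbC.
  - by move: srem; rewrite sla => -[].
  - apply: leq_ltn_trans szN; rewrite /remove_box; case: ifP => _.
      by rewrite size_take; case: ltnP => // /ltnW.
    by rewrite size_set_nth (maxn_idPr (removable_size rem)).
rewrite -big_distrr /= -num_sytE //; last exact: ltnW.
have addE := sum_addable szN.
have sumc (P : pred 'I_N) : \sum_(s | P s) num_syt la = (\sum_(s | P s) 1) * num_syt la.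
  by rewrite [RHS]big_distrl /=; apply: eq_bigr => s _; rewrite mul1n.
by rewrite !sumc addE !mulSn addnAC.
Qed.
(** A partition is reached once from each of its removable boxes, hence [undup]. *)
Fixpoint partitions (n : nat) : seq (seq nat) :=
  if n is n'.+1 then
    undup [seq incr_nth la r | la <- partitions n', r <- [seq r <- iota 0 n | addable la r]]
  else [:: [::]].

Lemma partitionsS n : partitions n.+1 =
  undup [seq incr_nth la r | la <- partitions n, r <- [seq r <- iota 0 n.+1 | addable la r]].
Proof. by []. Qed.

Lemma partitions_uniq n : uniq (partitions n).
Proof. by case: n => //= n; apply: undup_uniq. Qed.

Lemma exists_removable (la : seq nat) : is_partition la -> la != [::] ->
  exists r, removable la r.
Proof.
move=> /partitionP[_ pos] la0; exists (size la).-1.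
have sz0 : 0 < size la by rewrite lt0n size_eq0.
by rewrite /removable prednK // nth_default // pos // prednK.
Qed.

Lemma mem_partitions n (la : seq nat) :
  (la \in partitions n) = is_partition la && (sumn la == n).
Proof.
elim: n la => [|n IHn] la.
  rewrite inE; apply/eqP/andP => [-> //|[pla /eqP s0]].
  by apply/nilP; rewrite /nilp -leqn0 -s0 partition_size.
rewrite partitionsS mem_undup; apply/allpairsPdep/andP => [[mu [r []]]|[pla /eqP sla]].
  rewrite IHn mem_filter => /andP[pmu /eqP smu] /andP[add _] ->.
  by rewrite add_partition // sumn_incr_nth smu.
have [r rem] : exists r, removable la r by apply: exists_removable => //; case: (la) sla.
exists (remove_box la r), r; rewrite removeK_box //; split=> //.
  by rewrite IHn remove_partition //= -eqSS -(sumn_remove pla rem) sla.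
rewrite mem_filter addable_remove // mem_iota /= add0n ltnS.
rewrite -ltnS -sla; apply: leq_trans (partition_size pla); exact: removable_size.
Qed.

Definition num_all_syt (n : nat) := \sum_(la <- partitions n) num_syt la.

(** Both sides run over the covers between levels [n] and [n.+1], indexed from above and from below.
    For a fixed row [r], removing and adding a box in that row are inverse bijections. *)
Lemma sum_partitions_covers n N (H : seq nat -> seq nat -> nat) : n < N ->
  \sum_(mu <- partitions n.+1) \sum_(r < N | removable mu r) H (remove_box mu r) mu =
  \sum_(nu <- partitions n) \sum_(r < N | addable nu r) H nu (incr_nth nu r).
Proof.
move=> nN; rewrite (exchange_big_dep predT) // [RHS](exchange_big_dep predT) //.
apply: eq_bigr => r _; rewrite -big_filter -[RHS]big_filter.
rewrite (perm_big [seq incr_nth nu r | nu <- [seq nu <- partitions n | addable nu r]]).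
  rewrite big_map !big_filter big_seq_cond [RHS]big_seq_cond; apply: eq_bigr => nu.
  by rewrite mem_partitions => /andP[/andP[pnu _] add]; rewrite addK_box.
apply: uniq_perm => [||mu]; first by rewrite filter_uniq // partitions_uniq.
  rewrite map_inj_in_uniq ?filter_uniq // ?partitions_uniq // => la mu.
  rewrite !mem_filter !mem_partitions => /and3P[ala pla _] /and3P[amu pmu _] e.
  by rewrite -(addK_box pla ala) e addK_box.
rewrite mem_filter mem_partitions; apply/and3P/mapP => [[rem pmu /eqP smu]|[nu]].
  exists (remove_box mu r); rewrite ?removeK_box // mem_filter addable_remove //=.
  by rewrite mem_partitions remove_partition //= -eqSS -(sumn_remove pmu rem) smu.
rewrite mem_filter mem_partitions => /and3P[add pnu /eqP snu] ->.
by rewrite removable_add ?add_partition ?sumn_incr_nth ?snu.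
Qed.

(** Going down one level and up again counts each [nu] of size [n.+1] once per addable row, that is,
    once plus once per removable row. The single terms give t(n+1); the others, pushed down once
    more, give (n+1) t(n) by [sum_num_syt_add]. *)
Lemma num_all_syt_rec n :
  num_all_syt n.+2 = num_all_syt n.+1 + n.+1 * num_all_syt n.
Proof.
have szN m la k : la \in partitions m -> m <= k -> size la <= k.
  rewrite mem_partitions => /andP[pla /eqP <-]; apply: leq_trans; exact: partition_size.
have numE m N mu : m < N -> mu \in partitions m.+1 ->
    num_syt mu = \sum_(r < N | removable mu r) num_syt (remove_box mu r).
  move=> mN mup; have := mup; rewrite mem_partitions => /andP[pmu /eqP smu].
  rewrite (@num_sytE _ N) ?(szN _ _ _ mup) //.
  by case: (mu) smu.
rewrite {1}/num_all_syt big_seq (eq_bigr _ (fun mu => @numE n.+1 n.+3 mu (leqnSn _))) -big_seq.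
rewrite (@sum_partitions_covers _ _ (fun nu _ => num_syt nu)) //.
transitivity (\sum_(nu <- partitions n.+1) (num_syt nu +
     \sum_(r < n.+3 | removable nu r) num_syt nu)).
  rewrite big_seq [RHS]big_seq; apply: eq_bigr => nu nup.
  have sumc (P : pred 'I_n.+3) : \sum_(s | P s) num_syt nu = (\sum_(s | P s) 1) * num_syt nu.
    by rewrite [RHS]big_distrl /=; apply: eq_bigr => s _; rewrite mul1n.
  by rewrite !sumc sum_addable ?ltnS ?(szN _ _ _ nup) // mulSn.
rewrite big_split /= (@sum_partitions_covers _ _ (fun _ mu => num_syt mu)); last by lia.
congr addn; rewrite big_distrr /= big_seq [RHS]big_seq; apply: eq_bigr => la lap.
have := lap; rewrite mem_partitions => /andP[pla /eqP sla].
by rewrite sum_num_syt_add ?sla // ltnS (szN _ _ _ lap) //; lia.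
Qed.

Fixpoint involutions (n : nat) : nat :=
  if n is n'.+1 then
    if n' is n''.+1 then involutions n' + n' * involutions n'' else 1
  else 1.

Lemma num_all_sytE n : num_all_syt n = involutions n.
Proof.
suff: num_all_syt n = involutions n /\ num_all_syt n.+1 = involutions n.+1 by case.
elim: n => [|n [IH1 IH2]]; last by split; rewrite // num_all_syt_rec IH1 IH2.
split; rewrite /num_all_syt big_seq1 //.
by rewrite (@num_sytE _ 2) // big_mkcond !big_ord_recl big_ord0.
Qed.

End YoungLattice.

(** * Skew-diagrams and sequences of partitions *)

Lemma partition_head (mu : seq nat) r : is_partition mu -> nth 0 mu r <= head 0 mu.
Proof.
move=> /partitionP[dec _]; rewrite -nth0; elim: r => // r IHr.
exact: leq_trans (dec r) IHr.
Qed.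

Lemma size_diagram (la : seq nat) : size (diagram la) = sumn la.
Proof.
rewrite size_allpairs_dep; congr sumn; apply: (@eq_from_nth _ 0); rewrite size_map size_iota //.
by move=> i il; rewrite (nth_map 0) ?size_iota // nth_iota // size_iota.
Qed.

Lemma shift_inj a b : injective (fun x : nat * nat => (x.1 + a, x.2 + b)).
Proof. by move=> [x y] [z t] [] /addIn -> /addIn ->. Qed.

Lemma lext_shift a b (D : seq (nat * nat)) : lext before (shift a b D) = lext before D.
Proof.
apply: lext_map => [|x y]; first exact: shift_inj.
by rewrite /before /= !eqn_add2r !ltn_add2r.
Qed.

Lemma in_height (D : seq (nat * nat)) b : b \in D -> b.1 < height D.
Proof. move=> bD; exact: leq_bigmax_seq. Qed.

(** The two factors share neither a row nor a column, so [before] relates no box of one to a box of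
    the other, and their counts multiply up to a binomial coefficient. *)
Lemma skew_prod_cross (D : seq (nat * nat)) mu : is_partition mu ->
  {in shift 0 (head 0 mu) D & shift (height D) 0 (diagram mu),
   forall b c, (b.1 < c.1) && (c.2 < b.2)}.
Proof.
move=> pmu _ _ /mapP[b bD ->] /mapP[c cmu ->] /=; rewrite !addn0.
apply/andP; split; first by apply: leq_trans (in_height bD) (leq_addl _ _).
move: cmu; rewrite mem_diagram => /leq_trans/(_ (partition_head _ pmu)) /leq_trans; apply.
exact: leq_addl.
Qed.

Lemma uniq_skew_prod (D : seq (nat * nat)) mu : is_partition mu -> uniq D ->
  uniq (skew_prod D mu).
Proof.
move=> pmu uD; rewrite cat_uniq !map_inj_uniq ?uD ?uniq_diagram ?andbT //; try exact: shift_inj.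
apply/hasPn => c cmu; apply/negP => cD.
by have := skew_prod_cross pmu cD cmu; rewrite ltnn.
Qed.

Lemma lext_skew_prod (D : seq (nat * nat)) mu : is_partition mu -> uniq D ->
  lext before (skew_prod D mu) =
  'C(size D + sumn mu, sumn mu) * num_syt mu * lext before D.
Proof.
move=> pmu uD; rewrite lext_cat; first last.
- exact: uniq_skew_prod.
- move=> b c bD cmu; have /andP[h1 h2] := skew_prod_cross pmu bD cmu.
  by rewrite /before; lia.
rewrite !lext_shift !size_map size_diagram -/(num_syt mu).
by rewrite -bin_sub ?leq_addr // addKn; lia.
Qed.

Lemma skew_diagram_rcons las mu :
  skew_diagram (rcons las mu) = skew_prod (skew_diagram las) mu.
Proof. by rewrite /skew_diagram -cats1 foldl_cat. Qed.

Lemma skew_diagram_uniq las : all is_partition las ->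
  uniq (skew_diagram las) /\ size (skew_diagram las) = sumn (map sumn las).
Proof.
elim/last_ind: las => // las mu IH; rewrite all_rcons => /andP[pmu /IH[uD szD]].
rewrite skew_diagram_rcons uniq_skew_prod //; split=> //.
by rewrite size_cat !size_map size_diagram szD map_rcons sumn_rcons.
Qed.

(** The last partition is the one split off because [skew_prod] attaches it to the whole diagram of
    its predecessors. *)
Fixpoint block_sequences (f n : nat) : seq (seq (seq nat)) :=
  if (f, n) is (f'.+1, n'.+1) then
    [seq rcons p.1 p.2 | m <- iota 0 n,
       p <- [seq (las, mu) | las <- block_sequences f' (n' - m), mu <- partitions m.+1]]
  else [:: [::]].

(* f bounds the depth of the recursion (n <= f suffices), and m.+1 is the size of
   the last block. *)
Fixpoint block_count (f n : nat) : nat :=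
  if (f, n) is (f'.+1, n'.+1) then
    \sum_(m < n) 'C(n, m.+1) * involutions m.+1 * block_count f' (n' - m)
  else 1.

Lemma block_sequencesS f n : block_sequences f.+1 n.+1 =
  [seq rcons p.1 p.2 | m <- iota 0 n.+1,
     p <- [seq (las, mu) | las <- block_sequences f (n - m), mu <- partitions m.+1]].
Proof. by []. Qed.

Lemma block_countS f n : block_count f.+1 n.+1 =
  \sum_(m < n.+1) 'C(n.+1, m.+1) * involutions m.+1 * block_count f (n - m).
Proof. by []. Qed.

Lemma sumn_partitions_eq0 (las : seq (seq nat)) :
  all (fun la => is_partition la && (la != [::])) las ->
  (sumn (map sumn las) == 0) = (las == [::]).
Proof.
case: las => //= la las /andP[/andP[pla la0] _]; apply/negbTE; rewrite -lt0n.
apply: leq_trans (leq_addr _ _); apply: leq_trans (partition_size pla).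
by rewrite lt0n size_eq0.
Qed.

Lemma mem_block_sequences f n las : n <= f -> (las \in block_sequences f n) =
  all (fun la => is_partition la && (la != [::])) las && (sumn (map sumn las) == n).
Proof.
elim: f n las => [|f IHf] n las.
  rewrite leqn0 => /eqP -> /=; rewrite inE.
  by apply/eqP/andP => [-> //|[al]]; rewrite sumn_partitions_eq0 // => /eqP.
case: n => [_|n].
  by rewrite inE; apply/eqP/andP => [-> //|[al]]; rewrite sumn_partitions_eq0 // => /eqP.
rewrite ltnS block_sequencesS => nf; apply/allpairsPdep/andP.
  move=> [m [_ [+ /allpairsP[p [p1 p2 ->]] ->]]] /=; rewrite mem_iota /= add0n => mn.
  move: p1 p2; rewrite IHf; last by lia.
  rewrite mem_partitions => /andP[al /eqP s1] /andP[pp /eqP s2].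
  rewrite all_rcons al pp map_rcons sumn_rcons s1 s2 addnS subnK //; split=> //.
  by case: (p.2) s2.
case/lastP: las => [[]|las mu []] //.
rewrite all_rcons map_rcons sumn_rcons => /andP[/andP[pmu mu0] al] /eqP s.
have smu : 0 < sumn mu.
  by apply: leq_trans (partition_size pmu); rewrite lt0n size_eq0.
exists (sumn mu).-1, (las, mu); split=> //; first by rewrite mem_iota; lia.
apply/allpairsP; exists (las, mu); rewrite mem_partitions pmu prednK //=; split=> //.
by rewrite IHf; [rewrite al /=; lia|lia].
Qed.

Lemma block_sequences_uniq f n : uniq (block_sequences f n).
Proof.
elim: f n => [|f IHf] [|n] //; rewrite block_sequencesS.
apply: allpairs_uniq_dep => [|m _|]; first exact: iota_uniq.
  by apply: allpairs_uniq => //; [apply: partitions_uniq|move=> [? ?] [? ?] _ _ [-> ->]].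
move=> [m p] [m' p'] /allpairsPdep[m1 [p1 [_ + e1]]] /allpairsPdep[m2 [p2 [_ + e2]]] /=.
case: e1 => -> ->; case: e2 => -> ->.
move=> /allpairsP[[a b] [_ /= h1 ->]] /allpairsP[[a' b'] [_ /= h2 ->]] /= /rcons_inj[-> e].
(* The index [m] is recovered from the size [m.+1] of the last partition. *)
by move: h1 h2; rewrite e !(mem_partitions _.+1) => /andP[_ /eqP ->] /andP[_ /eqP[->]].
Qed.

Lemma sum_block_sequences f n : n <= f ->
  \sum_(las <- block_sequences f n) syt_count (skew_diagram las) = block_count f n.
Proof.
have unit_sum : syt_count (skew_diagram [::]) = 1 by rewrite syt_count_lext.
elim: f n => [|f IHf] [|n] nf; rewrite ?big_seq1 // block_sequencesS block_countS.
rewrite big_allpairs_dep -[iota 0 _](_ : index_iota 0 n.+1 = _) // big_mkord.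
apply: eq_bigr => m _; rewrite -IHf; last by lia.
rewrite big_allpairs_dep big_distrr big_seq [RHS]big_seq.
apply: eq_bigr => las; rewrite mem_block_sequences; last by lia.
move=> /andP[/allP al /eqP slas].
have all_part : all is_partition las by apply/allP => la /al /andP[].
have [uD szD] := skew_diagram_uniq all_part.
rewrite -num_all_sytE /num_all_syt big_distrr big_distrl big_seq [RHS]big_seq.
apply: eq_bigr => mu; rewrite mem_partitions => /andP[pmu /eqP smu].
rewrite skew_diagram_rcons !syt_count_lext // ?uniq_skew_prod //.
by rewrite lext_skew_prod // szD slas smu addnS subnK // -ltnS.
Qed.

(** * Counting ordered set partitions with an involution on each block *)

Section InvolutionCount.
Variable T : finType.
Implicit Types (X S : {set T}) (s : {ffun T -> T}).

Definition involution_on X s : bool :=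
  [forall x, (s (s x) == x) && ((x \notin X) ==> (s x == x))].

Lemma involution_onP X s :
  reflect (involutive s /\ forall x, x \notin X -> s x = x) (involution_on X s).
Proof.
apply: (iffP forallP) => [h|[h1 h2] x].
  by split=> x; have /andP[/eqP e /implyP i] := h x; rewrite ?e // => /i/eqP.
by rewrite h1 eqxx /=; apply/implyP => /h2 ->.
Qed.

Lemma involution_mem X s x : involution_on X s -> (s x \in X) = (x \in X).
Proof.
move=> /involution_onP[h1 h2]; apply/idP/idP; apply: contraLR => xX.
  by rewrite h2.
by have := h2 _ xX; rewrite h1 => e; rewrite e.
Qed.

Lemma card_involution_on X : #|[pred s | involution_on X s]| = involutions #|X|.
Proof.
move: {2}#|X| (leqnn #|X|) => n; elim: n X => [|n IHn] X.
  rewrite leqn0 cards_eq0 => /eqP ->; rewrite cards0.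
  rewrite (@eq_card1 _ [ffun x => x]) // => s; rewrite !inE; apply/involution_onP/eqP.
    by move=> [_ h]; apply/ffunP => x; rewrite ffunE h ?inE.
  by move=> ->; split=> x; rewrite !ffunE.
case: (set_0Vmem X) => [->|[x xX]] cX.
  by apply: IHn; rewrite cards0.
have cXx := cardsD1 x X; rewrite xX add1n in cXx.
have -> : #|[pred s | involution_on X s]| =
    \sum_(y in X) #|[pred s : {ffun T -> T} | involution_on X s & s x == y]|.
  rewrite -sum1_card (partition_big (fun s => s x) (mem X)) /=; last first.
    by move=> s; rewrite !inE => /involution_mem ->.
  by apply: eq_bigr => y yX; rewrite -sum1_card; apply: eq_bigl => s; rewrite !inE.
rewrite (bigD1 x) //=.
have -> : #|[pred s : {ffun T -> T} | involution_on X s & s x == x]| = involutions #|X :\ x|.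
  rewrite -IHn; last by rewrite -ltnS -cXx.
  apply: eq_card => s; rewrite !inE; apply/andP/involution_onP.
    move=> [/involution_onP[h1 h2] /eqP sx]; split=> // y.
    by rewrite !inE negb_and negbK => /orP[/eqP ->|/h2].
  move=> [h1 h2]; split; last by rewrite h2 // !inE eqxx.
  by apply/involution_onP; split=> // y yX; rewrite h2 // !inE negb_and yX orbT.
rewrite (eq_bigr (fun=> involutions #|X :\ x|.-1)); last first.
  move=> y /andP[yX yx].
  have cXxy : #|X :\ x :\ y| = #|X :\ x|.-1 by rewrite (cardsD1 y (X :\ x)) !inE yx yX.
  rewrite -cXxy -IHn; last by rewrite cXxy; lia.
  (* [f] dissolves the 2-cycle of [x] and [y] into two fixed points, and [g] restores it. *)
  pose f s : {ffun T -> T} := [ffun z => if (z == x) || (z == y) then z else s z].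
  pose g s : {ffun T -> T} := [ffun z => if z == x then y else if z == y then x else s z].
  apply: (eq_card_can_in (f := f) (g := g)) => s; rewrite !inE.
    move=> /andP[/involution_onP[h1 h2] /eqP sx].
    have sy : s y = x by rewrite -sx h1.
    split; last first.
      apply/ffunP => z; rewrite !ffunE; case: (z =P x) => [->|_] //=.
      by case: (z =P y) => [->|_].
    have sinj := can_inj h1.
    apply/involution_onP; split=> z; rewrite !ffunE.
      case: (boolP ((z == x) || (z == y))) => [e|/norP[zx zy]] /=; first by rewrite e.
      have [-> ->] : (s z == x) = false /\ (s z == y) = false.
        by split; [rewrite -sy|rewrite -sx]; rewrite (inj_eq sinj); apply: negbTE.
      by rewrite h1.
    rewrite !inE !negb_and !negbK orbCA orbA orbC.
    by case: (z =P x) => //= _; case: (z =P y) => //= _; rewrite orbF => /h2.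
  move=> /involution_onP[h1 h2].
  have sx : s x = x by rewrite h2 // !inE eqxx andbF.
  have sy : s y = y by rewrite h2 // !inE eqxx.
  have sinj := can_inj h1; split; last first.
    apply/ffunP => z; rewrite !ffunE; case: (z =P x) => [->|_] //=.
    by case: (z =P y) => [->|_].
  have -> : g s x == y by rewrite ffunE !eqxx.
  rewrite andbT; apply/involution_onP; split=> z; rewrite !ffunE.
    case: (altP (z =P x)) => [->|zx]; first by rewrite (negbTE yx) eqxx.
    case: (altP (z =P y)) => [->|zy]; first by rewrite eqxx.
    have [-> ->] : (s z == x) = false /\ (s z == y) = false.
      by split; [rewrite -sx|rewrite -sy]; rewrite (inj_eq sinj); apply: negbTE.
    by rewrite h1.
  move=> zX; case: eqP => [e|_]; first by rewrite e xX in zX.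
  case: eqP => [e|_]; first by rewrite e yX in zX.
  by rewrite h2 // !inE (negbTE zX) !andbF.
rewrite sum_nat_const cXx.
have -> : #|[pred y in X | y != x]| = #|X :\ x|.
  by apply: eq_card => y; rewrite !inE andbC.
by case: #|X :\ x|.
Qed.

Variable N : nat.
Implicit Types (w : {ffun T -> 'I_N.+1}).

(* An ordered set partition of X with an involution on each block; a block is
   labelled by c plus the number of elements in the blocks before it. *)
Definition block_involution (c : nat) X (sw : {ffun T -> T} * {ffun T -> 'I_N.+1}) : bool :=
  involution_on X sw.1 &&
  [forall x, if x \in X then (sw.2 (sw.1 x) == sw.2 x) &&
               (sw.2 x == c + #|[set y in X | sw.2 y < sw.2 x]| :> nat)
             else sw.2 x == ord0].

Lemma block_involutionP c X s w :
  reflect [/\ involution_on X s, forall x, x \notin X -> w x = ord0,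
              forall x, x \in X -> w (s x) = w x &
              forall x, x \in X -> w x = c + #|[set y in X | w y < w x]| :> nat]
          (block_involution c X (s, w)).
Proof.
apply: (iffP andP) => /= -[inv h]; [split=> // x xX|].
- by move/forallP/(_ x): h; rewrite (negbTE xX) => /eqP.
- by move/forallP/(_ x): h; rewrite xX => /andP[/eqP].
- by move/forallP/(_ x): h; rewrite xX => /andP[_ /eqP].
- move=> h1 h2; split=> //; apply/forallP => x; case: ifP => xX; last by rewrite h // xX.
  by rewrite h1 // eqxx /=; apply/eqP/h2.
Qed.

(** [S] is the first block: it carries the smallest label [c], the next block starts at [c + #|S|],
    and the involution preserves labels and so splits along [S]. The bound on [c + #|X|] makes all
    labels fit. *)
Lemma card_block_involution_fiber c X S : S \subset X -> S != set0 -> c + #|X| <= N.+1 ->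
  #|[pred sw | block_involution c X sw & [set x in X | sw.2 x == c :> nat] == S]| =
  involutions #|S| * #|[pred sw | block_involution (c + #|S|) (X :\: S) sw]|.
Proof.
move=> SX S0 leN; rewrite -card_involution_on -cardX.
have S1 : 0 < #|S| by rewrite lt0n cards_eq0.
have cN : c < N.+1 by apply: leq_trans leN; rewrite -addn1 leq_add2l (leq_trans S1) // subset_leq_card.
have sub_inS x : x \in S -> x \in X by move=> xS; apply: (subsetP SX).
pose f (sw : {ffun T -> T} * {ffun T -> 'I_N.+1}) :=
  ([ffun x => if x \in S then sw.1 x else x] : {ffun T -> T},
   ([ffun x => if x \in S then x else sw.1 x] : {ffun T -> T},
    [ffun x => if x \in S then ord0 else sw.2 x] : {ffun T -> 'I_N.+1})).
pose g (p : {ffun T -> T} * ({ffun T -> T} * {ffun T -> 'I_N.+1})) :=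
  ([ffun x => if x \in S then p.1 x else p.2.1 x] : {ffun T -> T},
   [ffun x => if x \in S then inord c else p.2.2 x] : {ffun T -> 'I_N.+1}).
apply: (eq_card_can_in (f := f) (g := g)) => [[s w]|[s1 [s2 w2]]]; rewrite !inE /=.
  move=> /andP[/block_involutionP[inv w0 ws wx] /eqP defS].
  have [h1 h2] := involution_onP _ _ inv.
  have inS x : (x \in S) = (x \in X) && (w x == c :> nat) by rewrite -defS inE.
  have sS x : (s x \in S) = (x \in S).
    rewrite !inS involution_mem //; case: (boolP (x \in X)) => //= xX; by rewrite ws.
  have wS x : x \in S -> w x = inord c.
    by rewrite inS => /andP[_ /eqP e]; apply: val_inj; rewrite /= inordK.
  split; last first.
    rewrite /g /=; congr pair; apply/ffunP => x; rewrite !ffunE; first by case: (x \in S).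
    by case: (boolP (x \in S)) => // /wS ->.
  apply/andP; split.
    apply/involution_onP; split=> x; rewrite !ffunE; last by move/negbTE ->.
    by case: (boolP (x \in S)) => [xS|/negbTE xS]; rewrite ?sS ?xS ?h1.
  apply/block_involutionP; split.
  - apply/involution_onP; split=> x; rewrite !ffunE.
      by case: (boolP (x \in S)) => [xS|/negbTE xS]; rewrite ?sS ?xS ?h1.
    by rewrite !inE negb_and negbK; case: ifP => //= _; apply: h2.
  - by move=> x; rewrite !inE negb_and negbK ffunE; case: ifP => //= _; apply: w0.
  - by move=> x; rewrite !inE !ffunE => /andP[/negbTE xS xX]; rewrite xS sS xS ws.
  move=> x; rewrite !inE !ffunE => /andP[/negbTE xS xX]; rewrite xS {1}wx // -addnA; congr addn.
  have cw : c < w x.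
    rewrite ltn_neqAle eq_sym; move: xS; rewrite inS xX => /= ->.
    by rewrite wx // leq_addr.
  (* All of [S] lies strictly below [x], which accounts for the new offset [c + #|S|]. *)
  rewrite -(cardsID S [set y in X | w y < w x]); congr addn; apply: eq_card => y; rewrite !inE.
    by rewrite !inS; case: (y \in X) => //=; case: eqP => [->|]; rewrite ?cw ?andbF.
  by rewrite ffunE; case: (y \in S).
move=> /andP[inv1 /block_involutionP[inv2 w0 ws wx]].
have [h1 h1'] := involution_onP _ _ inv1; have [h2 h2'] := involution_onP _ _ inv2.
have s2S x : x \notin S -> s2 x \notin S.
  move=> xS; case: (boolP (x \in X)) => xX.
    have : s2 x \in X :\: S by rewrite (involution_mem _ inv2) !inE xS.
    by rewrite !inE => /andP[].
  by rewrite h2' // !inE negb_and xX orbT.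
have w2c x : x \in X :\: S -> c < w2 x by move=> /wx ->; lia.
split; last first.
  rewrite /f /=; congr (_, (_, _)); apply/ffunP => x; rewrite !ffunE; case: (boolP (x \in S)) => // xS.
  - by rewrite h1' // xS.
  - by rewrite h2' // !inE xS.
  - by rewrite w0 // !inE xS.
have wE x : [ffun x => if x \in S then inord c else w2 x] x = if x \in S then inord c else w2 x.
  by rewrite ffunE.
apply/andP; split; last first.
  apply/eqP/setP => x; rewrite !inE wE; case: (boolP (x \in S)) => [xS|xS].
    by rewrite sub_inS // inordK // eqxx.
  case: (boolP (x \in X)) => //= xX; apply/negbTE; rewrite neq_ltn w2c ?orbT //.
  by rewrite !inE xS.
apply/block_involutionP; split.
- apply/involution_onP; split=> x; rewrite !ffunE.
    case: (boolP (x \in S)) => xS; first by rewrite involution_mem ?xS ?h1.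
    by rewrite (negbTE (s2S _ xS)) h2.
  by move=> xX; rewrite ifN; [rewrite h2' // !inE negb_and xX orbT|apply: contra xX; apply: sub_inS].
- move=> x xX; rewrite ffunE ifN; last by apply: contra xX; apply: sub_inS.
  by rewrite w0 // !inE negb_and xX orbT.
- move=> x xX; rewrite !ffunE; case: (boolP (x \in S)) => xS; first by rewrite involution_mem ?xS.
  by rewrite (negbTE (s2S _ xS)) ws // !inE xS.
move=> x xX; rewrite wE; case: (boolP (x \in S)) => xS.
  rewrite inordK // eq_card0 ?addn0 // => y; rewrite !inE wE.
  case: (boolP (y \in X)) => //= yX; case: (boolP (y \in S)) => yS; first by rewrite inordK // ltnn.
  by apply/negbTE; rewrite -leqNgt ltnW // w2c // !inE yS.
have xXS : x \in X :\: S by rewrite !inE xS.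
rewrite {1}wx // -addnA; congr addn.
rewrite -(cardsID S [set y in X | _]); congr addn; apply: eq_card => y; rewrite !inE wE.
  case: (boolP (y \in S)) => yS; rewrite ?andbF // sub_inS // inordK //=.
  by rewrite w2c.
by case: (y \in S).
Qed.

Lemma card_block_involution0 c : #|[pred sw | block_involution c set0 sw]| = 1.
Proof.
rewrite (@eq_card1 _ ([ffun x => x], [ffun=> ord0])) // => -[s w].
rewrite !inE xpair_eqE; apply/block_involutionP/andP.
  move=> [/involution_onP[_ h] w0 _ _]; split; apply/eqP/ffunP => x; rewrite ffunE.
    by rewrite h ?inE.
  by rewrite w0 ?inE.
move=> [/eqP-> /eqP->]; split=> [|x|x|x]; rewrite ?inE ?ffunE //.
by apply/involution_onP; split=> x; rewrite !ffunE.
Qed.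

Lemma card_block_involution c X f : #|X| <= f -> c + #|X| <= N.+1 ->
  #|[pred sw | block_involution c X sw]| = block_count f #|X|.
Proof.
elim: f c X => [|f IHf] c X leX leN.
  have X0 : X = set0 by apply/cards0_eq/eqP; rewrite -leqn0.
  by rewrite X0 cards0 card_block_involution0.
case: (set_0Vmem X) => [->|[x xX]] in leX leN *.
  by rewrite cards0 card_block_involution0.
case cX: #|X| => [|n]; first by move: xX; rewrite (cards0_eq cX) inE.
rewrite block_countS.
(* The fibres are indexed by the first block. It is nonempty: an element of minimal label has
   nothing below it and so has label [c]. *)
have -> : #|[pred sw | block_involution c X sw]| = \sum_(S : {set T} | (S \subset X) && (S != set0))
    #|[pred sw | block_involution c X sw & [set x in X | sw.2 x == c :> nat] == S]|.
  rewrite -sum1_card (partition_big (fun sw : {ffun T -> T} * {ffun T -> 'I_N.+1} =>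
    [set x in X | sw.2 x == c :> nat])
    (fun S : {set T} => (S \subset X) && (S != set0))) /=; last first.
    move=> [s w]; rewrite inE /= => /block_involutionP[_ _ _ wx].
    apply/andP; split; first by apply/subsetP => y; rewrite inE => /andP[].
    apply/set0Pn; case: (@arg_minnP _ x (fun y => y \in X) (fun y => val (w y)) xX) => y yX ymin.
    exists y; rewrite inE yX wx // eq_card0 ?addn0 ?eqxx // => z; rewrite !inE.
    by case: (boolP (z \in X)) => //= /ymin; rewrite leqNgt => /negbTE.
  by apply: eq_bigr => S _; rewrite -sum1_card; apply: eq_bigl => sw; rewrite !inE.
(* A fibre depends on [S] only through its size, so the sum over [S] collects into binomial
   coefficients. *)
pose G m := involutions m.+1 * block_count f (n - m).
rewrite (eq_bigr (fun S : {set T} => G #|S|.-1)); last first.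
  move=> S /andP[SX S0]; rewrite card_block_involution_fiber //.
  have S1 : 0 < #|S| by rewrite lt0n cards_eq0.
  have cXS : #|X :\: S| = #|X| - #|S| by rewrite cardsD (setIidPr SX).
  have SleX := subset_leq_card SX.
  rewrite IHf /G ?prednK //; last 2 first.
  - by rewrite cXS; lia.
  - by rewrite cXS; lia.
  by congr (_ * block_count _ _); rewrite cXS; lia.
have SX1 (S : {set T}) : S \subset X -> S != set0 -> #|S|.-1 < n.+1.
  by move=> SX; rewrite -cards_eq0; have := subset_leq_card SX; lia.
have binE k : 'C(n.+1, k) = #|[set A : {set T} | A \subset X & #|A| == k]|.
  by rewrite cards_draws cX.
rewrite (partition_big (fun S : {set T} => inord #|S|.-1 : 'I_n.+1) predT) //.
apply: eq_bigr => m _; rewrite -mulnA -/(G m) binE -sum_nat_const.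
apply: eq_big => S; last by move=> /andP[/andP[SX S0] /eqP <-]; rewrite inordK // SX1.
rewrite inE; apply/andP/andP => [[/andP[SX S0] /eqP <-]|[SX /eqP cS]].
  by rewrite SX inordK ?SX1 // prednK // lt0n cards_eq0.
by rewrite SX -cards_eq0 cS /= inord_val.

Qed.

End InvolutionCount.

Local Open Scope ring_scope.

(** * Compound matrices and triangular congruence *)

Section MultiIndex.
Variables n i : nat.
Implicit Types I J L : multi_index n i.

Definition mset I : {set 'I_n} := [set x in val I].

Lemma mi_sorted I : sorted ltn (map val (val I)).
Proof. exact: valP I. Qed.

Lemma mi_uniq I : uniq (val I).
Proof.
by rewrite -(map_inj_uniq val_inj); apply: sorted_uniq (mi_sorted I); [apply: ltn_trans|apply: ltnn].
Qed.

Lemma mi_inj I : injective (tnth (val I)).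
Proof. by apply/tuple_uniqP; apply: mi_uniq. Qed.

Lemma mi_tnth I a : tnth (val I) a \in mset I.
Proof. by rewrite inE mem_tnth. Qed.

Lemma mi_tnthP I x : x \in mset I -> exists a, x = tnth (val I) a.
Proof. by rewrite inE => /tnthP. Qed.

Lemma card_mset I : #|mset I| = i.
Proof. by rewrite cardsE (card_uniqP (mi_uniq I)) size_tuple. Qed.

Lemma mset_inj : injective mset.
Proof.
move=> I J /setP e; apply/val_inj/val_inj/(inj_map val_inj).
apply: (irr_sorted_eq ltn_trans ltnn (mi_sorted I) (mi_sorted J)) => x.
by apply/mapP/mapP => -[y yI ->]; exists y => //; have := e y; rewrite !inE yI.
Qed.

Lemma mi_of_set (S : {set 'I_n}) : #|S| = i -> exists I, mset I = S.
Proof.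
move=> cS; have sz : size (enum S) == i by rewrite -cardE cS.
have st : sorted ltn (map val (Tuple sz)).
  rewrite /= {1}/enum_mem -enumT; apply: (@subseq_sorted _ _ ltn_trans _ (iota 0 n)).
    by rewrite -val_enum_ord map_subseq ?filter_subseq.
  exact: iota_ltn_sorted.
exists (Sub (Tuple sz) st); apply/setP => x.
by rewrite inE SubK /= mem_enum.
Qed.

Lemma mset_sub I J : mset I \subset mset J -> I = J.
Proof. by move=> sIJ; apply/mset_inj/eqP; rewrite eqEcard sIJ !card_mset leqnn. Qed.

Definition wsum (w : 'I_n -> nat) I : nat := (\sum_a w (tnth (val I) a))%N.

Lemma wsumE w I : wsum w I = (\sum_(x in mset I) w x)%N.
Proof.
have -> : mset I = tnth (val I) @: setT.
  by apply/setP => x; apply/idP/imsetP => [/mi_tnthP[a ->]|[a _ ->]]; rewrite ?mi_tnth //; exists a.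
by rewrite (big_imset _ (in2W (@mi_inj I))); apply: eq_bigl => a; rewrite inE.
Qed.

End MultiIndex.

Section Minors.
Variables (R : comNzRingType) (n i : nat).
Implicit Types (A B : 'M[R]_n) (I J L : multi_index n i).

Definition minor A I J : R := \det (mxsub (tnth (val I)) (tnth (val J)) A).

(** Every support argument for minors below goes through a surviving term of the Leibniz
    expansion. *)
Lemma minor_neq0 A I J : minor A I J != 0 ->
  exists s : 'S_i, forall a, A (tnth (val I) a) (tnth (val J) (s a)) != 0.
Proof.
move=> nz; suff /existsP[s /forallP] : [exists s : 'S_i, forall a,
    A (tnth (val I) a) (tnth (val J) (s a)) != 0] by exists s.
apply: contraNT nz => /existsPn nz.
rewrite /minor /determinant big1 // => s _.
have /forallPn[a] := nz s; rewrite negbK => /eqP e.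
by rewrite (bigD1 a) //= mxE e mul0r mulr0.
Qed.

Lemma minor1 I J : minor (1%:M : 'M[R]_n) I J = (I == J)%:R.
Proof.
case: eqP => [<-|/eqP neq].
  transitivity (\det (1%:M : 'M[R]_i)); last exact: det1.
  congr (\det _); apply/matrixP => a b.
  by rewrite !mxE (inj_eq (@mi_inj _ _ I)).
apply/eqP; apply: contraNT neq => /minor_neq0[s sP]; apply/eqP/mset_sub/subsetP => x.
move=> /mi_tnthP[a ->]; have := sP a; rewrite !mxE.
by case: (tnth (val I) a =P _) => [-> _|_]; rewrite ?mi_tnth // eqxx. 
Qed.

Lemma minor_tr A I J : minor A^T I J = minor A J I.
Proof. by rewrite /minor -det_tr; congr (\det _); apply/matrixP => a b; rewrite !mxE. Qed.

Lemma minorZ c A I J : minor (c *: A) I J = c ^+ i * minor A I J.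
Proof. by rewrite /minor -detZ; congr (\det _); apply/matrixP => a b; rewrite !mxE. Qed.

(** The Cauchy-Binet formula. Multilinearity gives a sum over maps [f]; a non-injective one repeats
    a row, and an injective one is the increasing enumeration of its image after a permutation,
    whose sign reassembles the minor of [A]. *)
Lemma minorM A B I J :
  minor (A *m B) I J = \sum_(L : multi_index n i) minor A I L * minor B L J.
Proof.
pose X a x := A (tnth (val I) a) x; pose Y x b := B x (tnth (val J) b).
pose G (f : {ffun 'I_i -> 'I_n}) := \det (\matrix_(a, b) Y (f a) b) * \prod_a X a (f a).
transitivity (\sum_(f : {ffun 'I_i -> 'I_n}) G f).
  rewrite /minor /determinant.
  transitivity (\sum_(s : 'S_i) \sum_(f : {ffun 'I_i -> 'I_n})
      (-1) ^+ s * \prod_a (X a (f a) * Y (f a) (s a))).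
    apply: eq_bigr => s _; rewrite -big_distrr /=; congr (_ * _).
    rewrite -(bigA_distr_bigA (fun a x => X a x * Y x (s a))) /=.
    by apply: eq_bigr => a _; rewrite !mxE.
  rewrite exchange_big; apply: eq_bigr => f _; rewrite /G mulrC big_distrr /=.
  apply: eq_bigr => s _; rewrite big_split mulrCA; congr (_ * (_ * _)).
  by apply: eq_bigr => a _; rewrite !mxE.
rewrite (bigID (fun f : {ffun 'I_i -> 'I_n} => injectiveb f)) /= addrC big1 ?add0r => [|f]; last first.
  move=> /injectivePn[a [b Dab Eab]]; rewrite /G.
  by rewrite (determinant_alternate Dab) ?mul0r // => c; rewrite !mxE Eab.
pose h (p : multi_index n i * 'S_i) : {ffun 'I_i -> 'I_n} :=
  [ffun a => tnth (val p.1) (p.2 a)].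
have hE p a : h p a = tnth (val p.1) (p.2 a) by rewrite ffunE.
have hinj : injective h.
  move=> [L s] [L' s'] /ffunP e; have eL : L = L'.
    apply/mset_sub/subsetP => _ /mi_tnthP[a ->].
    by have := e (s^-1%g a); rewrite !hE /= permKV => ->; apply: mi_tnth.
  congr pair => //; apply/permP => a; apply: (@mi_inj _ _ L).
  by have := e a; rewrite !hE /= -eL.
transitivity (\sum_(p in [set: multi_index n i * 'S_i]) G (h p)).
  rewrite -(big_imset G (in2W hinj)).
  apply: eq_bigl => f; apply/injectiveP/imsetP => [finj|[p _ ->] a b].
    have [|L defL] := @mi_of_set n i (f @: setT).
      by rewrite card_imset // cardsT card_ord.
    have /fin_all_exists[s sP] a : exists b, f a = tnth (val L) b.
      by apply: mi_tnthP; rewrite defL imset_f.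
    have sinj : injective s by move=> a b e; apply: finj; rewrite !sP e.
    by exists (L, perm sinj) => //; apply/ffunP => a; rewrite hE permE.
  by rewrite !hE => /mi_inj/perm_inj.
rewrite (eq_bigl predT) => [|p]; last by rewrite inE.
rewrite -(pair_bigA _ (fun L s => G (h (L, s)))) /=; apply: eq_bigr => L _.
rewrite /minor [\det (mxsub _ _ A)]/determinant big_distrl /=; apply: eq_bigr => s _.
rewrite [RHS]mulrAC /G; congr (_ * _); last by apply: eq_bigr => a _; rewrite !mxE hE.
rewrite -det_perm -det_mulmx -row_permE; congr (\det _); apply/matrixP => a b.
by rewrite !mxE hE.
Qed.

End Minors.

Definition lower_mx (R : nmodType) n (A : 'M[R]_n) : Prop :=
  forall x y : 'I_n, (x < y)%N -> A x y = 0.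

Section MinorWeights.
Variables (R : comNzRingType) (n i : nat).
Implicit Types (A B : 'M[R]_n) (I J : multi_index n i).

(** A surviving Leibniz term pairs each row index with a column index that is no larger. The sum of
    the indices turns this into a numerical order for which the compound of a lower triangular
    matrix is again triangular. *)
Lemma minor_lower A I J : lower_mx A ->
  minor A I J != 0 -> (wsum val J < wsum val I)%N || (I == J).
Proof.
move=> lA nz; have [s sP] := minor_neq0 nz.
have sle a : (tnth (val J) (s a) <= tnth (val I) a)%N.
  by rewrite leqNgt; apply: contra (sP a) => /lA ->.
have wJ : wsum val J = (\sum_a tnth (val J) (s a))%N by rewrite /wsum (reindex_perm s).
have [leq0 eq0] : (\sum_a tnth (val J) (s a) <= wsum val I ?= iff
    [forall a, tnth (val J) (s a) == tnth (val I) a :> nat])%N.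
  exact: (leqif_sum (fun a _ => leqif_eq (sle a))).
rewrite wJ ltn_neqAle leq0 andbT eq0; case: (boolP [forall a, _]) => //= /forallP e.
apply/eqP/mset_sub/subsetP => _ /mi_tnthP[a ->].
by have /eqP/val_inj <- := e a; apply: mi_tnth.
Qed.

(** In the [(I, I)] entry of the product, a term at another [J] would make the index sum drop from
    [I] to [J] and again from [J] to [I]. *)
Lemma minor_unit_diag A B I : lower_mx A -> lower_mx B -> A *m B = 1%:M -> minor A I I != 0.
Proof.
move=> lA lB AB; have := minor1 R I I; rewrite -AB minorM eqxx (bigD1 I) //= big1 ?addr0.
  by move=> e; apply: contra_eq_neq e => ->; rewrite mul0r eq_sym oner_neq0.
move=> J JI; apply/eqP; apply: contraTT JI; rewrite negbK => nz.
have nzA : minor A I J != 0 by apply: contra nz => /eqP ->; rewrite mul0r.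
have nzB : minor B J I != 0 by apply: contra nz => /eqP ->; rewrite mulr0.
case/orP: (minor_lower lA nzA) => [h1|/eqP-> //].
by case/orP: (minor_lower lB nzB) => [h2|//]; have := ltn_trans h1 h2; rewrite ltnn.
Qed.

End MinorWeights.

Lemma sum_multi_index (V : nmodType) n i (F : multi_index n i -> V) :
  \sum_L F L = \sum_(a < ext_dim n i) F (enum_val a).
Proof. by apply: reindex; apply/onW_bij/enum_val_bij. Qed.

Section Compound.
Variables (K : fieldType) (n i : nat).
Implicit Types (A B : 'M[K]_n) (I J : multi_index n i).

Lemma compoundE A a b : compound i A a b = minor A (enum_val a) (enum_val b).
Proof. by rewrite mxE. Qed.

Lemma compoundM A B : compound i (A *m B) = compound i A *m compound i B.
Proof.
apply/matrixP => a b; rewrite compoundE mxE minorM sum_multi_index.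
by apply: eq_bigr => c _; rewrite !compoundE.
Qed.

Lemma compound1 : compound i (1%:M : 'M[K]_n) = 1%:M.
Proof. by apply/matrixP => a b; rewrite compoundE minor1 mxE (inj_eq enum_val_inj). Qed.

Lemma compound_tr A : compound i A^T = (compound i A)^T.
Proof. by apply/matrixP => a b; rewrite compoundE mxE compoundE minor_tr. Qed.

Lemma compoundZ c A : compound i (c *: A) = c ^+ i *: compound i A.
Proof. by apply/matrixP => a b; rewrite compoundE [RHS]mxE compoundE minorZ. Qed.

Lemma compoundV A : A \in unitmx -> compound i A *m compound i (invmx A) = 1%:M.
Proof. by move=> uA; rewrite -compoundM mulmxV ?compound1. Qed.

Lemma compound_unit A : A \in unitmx -> compound i A \in unitmx.
Proof. by move=> /compoundV/mulmx1_unit[]. Qed.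

End Compound.

(** * Symmetric matrices under lower triangular congruence that preserves weights *)

Definition block_supported (R : nmodType) n (w : 'I_n -> nat) (A : 'M[R]_n) : Prop :=
  forall i j, w i != w j -> A i j = 0.

Section Congruence.
Variables (K : numClosedFieldType) (n : nat) (w : 'I_n -> nat).
Implicit Types (A b : 'M[K]_n).

Lemma lower_mxM A B : lower_mx A -> lower_mx B -> lower_mx (A *m B).
Proof.
move=> lA lB i j ij; rewrite mxE big1 // => k _.
case: (ltnP i k) => ik; first by rewrite lA // mul0r.
by rewrite lB ?mulr0 // (leq_ltn_trans ik).
Qed.

Lemma block_supportedM A B :
  block_supported w A -> block_supported w B -> block_supported w (A *m B).
Proof.
move=> bA bB i j ij; rewrite mxE big1 // => k _.
case: (altP (w i =P w k)) => [e|ik]; last by rewrite bA // mul0r.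
by rewrite bB ?mulr0 // -e.
Qed.

Lemma det_lower A : lower_mx A -> \det A = \prod_i A i i.
Proof. by move=> lA; apply: det_trig; apply/is_trig_mxP. Qed.

Lemma lower_diag_neq0 A i : lower_mx A -> A \in unitmx -> A i i != 0.
Proof.
move=> lA; rewrite unitmxE det_lower // unitfE prodf_seq_neq0 => /allP/(_ i).
by rewrite mem_index_enum => /(_ isT).
Qed.

Lemma lower_mxV A : lower_mx A -> A \in unitmx -> lower_mx (invmx A).
Proof.
move=> lA uA i j; have [m] := ubnP (val i); elim: m i => // m IHm i im ij.
have /matrixP/(_ i j) := mulmxV uA; rewrite !mxE (_ : i == j = false); last first.
  by apply/negbTE; rewrite neq_ltn ij.
rewrite (bigD1 i) //= big1 ?addr0 => [/eqP|k ki].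
  by rewrite mulf_eq0 (negbTE (lower_diag_neq0 _ lA uA)) => /eqP.
case: (ltnP i k) => ik; first by rewrite lA // mul0r.
have {}ki : (k < i)%N by rewrite ltn_neqAle ki.
by rewrite IHm ?mulr0 //; [exact: leq_trans ki im|exact: ltn_trans ki ij].
Qed.

Definition congruent A A' : Prop :=
  exists b, [/\ lower_mx b, b \in unitmx, block_supported w b & A' = b *m A *m b^T].

Lemma congruent_refl A : congruent A A.
Proof.
exists 1%:M; split; rewrite ?unitmx1 ?trmx1 ?mul1mx ?mulmx1 //.
- by move=> i j ij; rewrite mxE (_ : i == j = false) //; apply/negbTE; rewrite neq_ltn ij.
- by move=> i j ij; rewrite mxE; case: (i =P j) ij => // ->; rewrite eqxx.
Qed.

Lemma congruent_trans A B C : congruent A B -> congruent B C -> congruent A C.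
Proof.
move=> [b [lb ub wb ->]] [c [lc uc wc ->]]; exists (c *m b); split.
- exact: lower_mxM.
- by rewrite unitmx_mul uc.
- exact: block_supportedM.
- by rewrite trmx_mul !mulmxA.
Qed.

Lemma congruent_sym A A' : congruent A A' -> A^T = A -> A'^T = A'.
Proof. by move=> [b [_ _ _ ->]] sA; rewrite !trmx_mul trmxK sA mulmxA. Qed.

Lemma congruent_unit A A' : congruent A A' -> A \in unitmx -> A' \in unitmx.
Proof. by move=> [b [_ ub _ ->]] uA; rewrite !unitmx_mul unitmx_tr ub uA. Qed.

Lemma congruent_block A A' : congruent A A' -> block_supported w A -> block_supported w A'.
Proof.
move=> [b [_ _ wb ->]] wA; apply: block_supportedM; first exact: block_supportedM.
by move=> i j ij; rewrite mxE wb // eq_sym.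
Qed.

(** Row [j] is subtracted [c l] times from each row [l], and likewise for columns. The condition on
    [c] is what keeps the transforming matrix lower triangular and within the blocks. *)
Lemma congruent_eliminate A (j : 'I_n) (c : 'I_n -> K) :
  (forall l, c l != 0 -> (j < l)%N /\ w l = w j) ->
  exists2 A', congruent A A' & forall l m,
    A' l m = A l m - c l * A j m - c m * A l j + c l * c m * A j j.
Proof.
move=> cP; pose b : 'M[K]_n := 1%:M - \matrix_(l, m) (c l * (m == j)%:R).
have bE (M : 'M[K]_n) l m : (b *m M) l m = M l m - c l * M j m.
  rewrite mulmxBl mul1mx !mxE; congr (_ - _); rewrite (bigD1 j) //= big1 => [|k kj].
    by rewrite mxE eqxx mulr1 addr0.
  by rewrite mxE (negbTE kj) mulr0 mul0r.
have bTE (M : 'M[K]_n) l m : (M *m b^T) l m = M l m - c m * M l j.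
  by rewrite -[M *m _]trmxK trmx_mul trmxK mxE bE !mxE.
have lb : lower_mx b.
  move=> l m lm; rewrite !mxE (_ : l == m = false); last first.
    by apply/negbTE; rewrite neq_ltn lm.
  case: (m =P j) => [mj|]; last by rewrite mulr0 subr0.
  case: (eqVneq (c l) 0) => [->|/cP[jl _]]; first by rewrite mul0r subr0.
  by move: jl; rewrite -mj ltnNge ltnW.
exists (b *m A *m b^T); last first.
  by move=> l m; rewrite bTE !bE; ring.
exists b; split=> //.
  rewrite unitmxE det_lower // big1 ?unitr1 // => l _; rewrite !mxE eqxx.
  case: (l =P j) => [->|]; last by rewrite mulr0 subr0.
  case: (eqVneq (c j) 0) => [->|/cP[]]; first by rewrite mul0r subr0.
  by rewrite ltnn.
move=> l m lm; rewrite !mxE (_ : l == m = false); last first.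
  by case: (l =P m) lm => // ->; rewrite eqxx.
case: (m =P j) => [mj|]; last by rewrite mulr0 subr0.
case: (eqVneq (c l) 0) => [->|/cP[_ wl]]; first by rewrite mul0r subr0.
by rewrite mj wl eqxx in lm.
Qed.

Lemma congruent_scale A (d : 'I_n -> K) : (forall l, d l != 0) ->
  exists2 A', congruent A A' & forall l m, A' l m = d l * d m * A l m.
Proof.
move=> d0; pose b : 'M[K]_n := diag_mx (\row_l d l).
have lb : lower_mx b.
  by move=> l m lm; rewrite !mxE (_ : l == m = false) // ; apply/negbTE; rewrite neq_ltn lm.
exists (b *m A *m b^T).
  exists b; split=> //.
    rewrite unitmxE det_lower // unitfE prodf_seq_neq0; apply/allP => l _.
    by rewrite !mxE eqxx mulr1n /= d0.
  by move=> l m lm; rewrite !mxE; case: (l =P m) lm => // ->; rewrite eqxx.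
by move=> l m; rewrite /b tr_diag_mx mul_mx_diag mul_diag_mx !mxE; ring.
Qed.

Definition function_mx (s : 'I_n -> 'I_n) : 'M[K]_n := \matrix_(i, j) (s i == j)%:R.

(* Induction on the complement of S: the pivot is the first nonzero entry (i, j) of
   the first row i outside S, and i and j join S. *)
Lemma congruent_reduce (S : {set 'I_n}) A (s : 'I_n -> 'I_n) :
  A^T = A -> A \in unitmx -> block_supported w A ->
  {in S, forall i, s i \in S /\ s (s i) = i} ->
  {in S, forall i j, A i j = (s i == j)%:R} ->
  exists s', involutive s' /\ congruent A (function_mx s').
Proof.
have [m] := ubnP #|~: S|; elim: m S A s => // m IHm S A s cS sA uA wA sS AS.
have symA i j : A i j = A j i by rewrite -[in LHS]sA mxE.
case: (set_0Vmem (~: S)) => [S0|[i0 i0S]].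
  have inS i : i \in S by have := in_set0 i; rewrite -S0 inE => /negbFE.
  exists s; split=> [i|]; first by have [] := sS i (inS i).
  suff -> : function_mx s = A by exact: congruent_refl.
  by apply/matrixP => i j; rewrite mxE AS.
case: (@arg_minnP _ i0 (fun i => i \in ~: S) val i0S) => i; rewrite inE => iS imin.
have ltS (l : 'I_n) : (l < i)%N -> l \in S.
  by move=> li; apply: contraLR li => lS; rewrite -leqNgt imin // inE.
have A0S l k : l \in S -> k \notin S -> A l k = 0.
  by move=> lS kS; rewrite AS //; case: eqP kS => // <-; have [-> ] := sS l lS.
have [j0 j0P] : exists j, A i j != 0.
  apply/existsP; apply: contraLR uA => /existsPn h; rewrite unitmxE unitfE negbK.
  rewrite (expand_det_row _ i) big1 // => j _.
  by have := h j; rewrite negbK => /eqP->; rewrite mul0r.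
case: (@arg_minnP _ j0 (fun j => A i j != 0) val j0P) => j Aij jmin.
have jS : j \notin S by apply: contra Aij => jS; rewrite symA A0S.
have ij : (i <= j)%N by apply: imin; rewrite inE.
have wij : w i = w j by apply/eqP; apply: contraNT Aij => /wA ->.
(* This clears row [i] to the right of the pivot; to the left it vanishes already by the minimality
   of [j]. *)
pose c (l : 'I_n) := if (j < l)%N then A i l / A i j else 0.
have cS0 l : l \in S -> c l = 0.
  by move=> lS; rewrite /c; case: ifP => // _; rewrite symA A0S // mul0r.
have ci : c i = 0 by rewrite /c ltnNge ij.
have cj : c j = 0 by rewrite /c ltnn.
have [|A1 cA1 A1E] := @congruent_eliminate A j c.
  move=> l; rewrite /c; case: ifP => [jl nz|]; last by rewrite eqxx.
  split=> //; rewrite -wij; apply/esym/eqP; apply: contraNT nz => /wA ->.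
  by rewrite mul0r.
have sA1 := congruent_sym cA1 sA; have uA1 := congruent_unit cA1 uA.
have symA1 k l : A1 k l = A1 l k by rewrite -[in LHS]sA1 mxE.
have wA1 := congruent_block cA1 wA.
have A1S : {in S, forall k l, A1 k l = (s k == l)%:R}.
  by move=> k kS l; rewrite A1E cS0 // (A0S k j) // AS //; ring.
have A1i l : A1 i l = if l == j then A i j else 0.
  rewrite A1E ci; case: (altP (l =P j)) => [->|lj]; first by rewrite cj; ring.
  rewrite /c; case: ltnP => jl; first by field.
  rewrite (_ : A i l = 0); first by ring.
  by apply/eqP; apply: contraTT jl => /jmin; rewrite -ltnNge ltn_neqAle eq_sym lj.
have cardS (T : {set 'I_n}) : i \in T -> S \subset T -> (#|~: T| < m)%N.
  move=> iT ST; apply: leq_trans (_ : #|~: S| <= m)%N; last by [].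
  apply: proper_card; apply/properP; split; first by rewrite setCS.
  by exists i; rewrite !inE ?iS ?iT.
case: (altP (i =P j)) => [eij|neij].
  (* A diagonal pivot is scaled to 1, which takes a square root. *)
  have [|A2 cA2 A2E] := @congruent_scale A1 (fun l => if l == i then (sqrtC (A i i))^-1 else 1).
    move=> l; case: ifP => _; rewrite ?oner_eq0 // invr_eq0 sqrtC_eq0.
    by rewrite [X in A i X]eij.
  have cA := congruent_trans cA1 cA2.
  have [||||||s' [s'i s'c]] := IHm (i |: S) A2 (fun l => if l == i then i else s l).
  - by apply: cardS; rewrite ?setU11 ?subsetU1.
  - exact: congruent_sym cA sA.
  - exact: congruent_unit cA uA.
  - exact: congruent_block cA wA.
  - move=> k; rewrite !inE; case: eqP => [->|_] /=; first by rewrite eqxx.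
    move=> kS; have [h1 h2] := sS k kS; rewrite h1 orbT h2; split=> //.
    by case: eqP => // e; rewrite -e h1 in iS.
  - move=> k; rewrite !inE => kS l; rewrite A2E; case: (altP (k =P i)) kS => [->|ki] /= kS.
      rewrite A1i -eij (eq_sym i l); case: (l =P i) => [_|_]; last by rewrite mulr0.
      have nz : sqrtC (A i i) != 0 by rewrite sqrtC_eq0 [X in A i X]eij.
      by move: nz (sqrtCK (A i i)); move: (sqrtC _) => r nz <- /=; field.
    rewrite A1S // mul1r; case: (s k =P l) => [sk|_]; last by rewrite mulr0.
    case: (l =P i) => [li|_]; last by rewrite mulr1.
    by move: iS; rewrite -li -sk; have [->] := sS k kS.
  by exists s'; split=> //; apply: congruent_trans cA s'c.
have A1ii : A1 i i = 0 by rewrite A1i (negbTE neij).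
have A1ij : A1 i j = A i j by rewrite A1i eqxx.
(* Row [i] now has its only nonzero entry in column [j] and so clears that column. The entry
   [(j, j)] is hit once from the row and once from the column, hence the factor 2. *)
pose c' (l : 'I_n) := if l == i then 0 else if l == j then A1 j j / (A i j *+ 2) else A1 l j / A i j.
have c'S0 l : l \in S -> c' l = 0.
  move=> lS; rewrite /c'; case: (l =P i) => // _; case: (l =P j) => [lj|_]; first by rewrite lj (negbTE jS) in lS.
  rewrite A1S //; case: eqP => [e|_]; last by rewrite mul0r.
  by move: jS; rewrite -e; have [->] := sS l lS.
have [|A2 cA2 A2E] := @congruent_eliminate A1 i c'.
  move=> l nz; split.
    rewrite ltnNge leq_eqVlt; apply: contra nz => /orP[/eqP/val_inj->|/ltS/c'S0->//].
    by rewrite /c' eqxx.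
  rewrite wij; apply/eqP; apply: contraNT nz => wlj; rewrite /c'; case: (l =P i) => // _.
  case: (l =P j) => [lj|_]; first by rewrite lj eqxx in wlj.
  by rewrite wA1 // mul0r.
have c'i : c' i = 0 by rewrite /c' eqxx.
have A2i l : A2 i l = if l == j then A i j else 0.
  by rewrite A2E c'i A1ii A1i; case: eqP => _; ring.
have A2j l : A2 j l = if l == i then A i j else 0.
  rewrite A2E A1ii (A1i l) (symA1 j i) A1ij; case: (altP (l =P i)) => [->|li].
    by rewrite c'i (negbTE neij) symA1 A1ij; ring.
  case: (altP (l =P j)) => [->|lj].
    by rewrite /c' eq_sym (negbTE neij) eqxx; field.
  have -> : c' l = A1 l j / A i j by rewrite /c' (negbTE li) (negbTE lj).
  by rewrite symA1; field.
have A2S : {in S, forall k l, A2 k l = (s k == l)%:R}.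
  move=> k kS l; rewrite A2E c'S0 // (A1S k kS i) A1S //.
  have -> : s k == i = false by apply/negbTE; apply: contra iS => /eqP <-; have [] := sS k kS.
  by rewrite !mul0r mulr0 !subr0 addr0.
have [|A3 cA3 A3E] := @congruent_scale A2 (fun l => if l == i then (A i j)^-1 else 1).
  by move=> l; case: ifP => _; rewrite ?oner_eq0 // invr_eq0.
have cA := congruent_trans cA1 (congruent_trans cA2 cA3).
pose s1 (l : 'I_n) := if l == i then j else if l == j then i else s l.
have ji : j == i = false by rewrite eq_sym (negbTE neij).
have s1S l : l \in S -> s1 l = s l.
  move=> lS; rewrite /s1; case: eqP => [e|_]; first by rewrite -e lS in iS.
  by case: eqP => [e|//]; rewrite -e lS in jS.
have [||||||s' [s'i s'c]] := IHm (i |: (j |: S)) A3 s1.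
- by apply: cardS; rewrite ?setU11 // setUA subsetUr.
- exact: congruent_sym cA sA.
- exact: congruent_unit cA uA.
- exact: congruent_block cA wA.
- move=> k; rewrite !inE => /or3P[/eqP->|/eqP->|kS].
  + by rewrite /s1 eqxx ji !eqxx orbT.
  + by rewrite /s1 ji !eqxx.
  + by have [h1 h2] := sS k kS; rewrite !s1S // h1 !orbT.
- move=> k; rewrite !inE => kS l; rewrite A3E.
  case/or3P: kS => [/eqP->|/eqP->|kS].
  + rewrite /s1 eqxx A2i (eq_sym j l); case: (l =P j) => [->|_]; last by rewrite mulr0.
    by rewrite ji mulr1 mulVf.
  + rewrite /s1 ji eqxx A2j (eq_sym i l); case: (l =P i) => [_|_]; last by rewrite mulr0.
    by rewrite mul1r mulVf.
  + rewrite s1S // A2S //; case: (s k =P l) => [sk|_]; last by rewrite mulr0.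
    have [skS _] := sS k kS; rewrite -sk.
    have -> : s k == i = false by apply/negbTE; apply: contraNneq iS => <-.
    have -> : k == i = false by apply/negbTE; apply: contraNneq iS => <-.
    by rewrite !mulr1.
by exists s'; split=> //; apply: congruent_trans cA s'c.
Qed.

Lemma congruent_involution A : A^T = A -> A \in unitmx -> block_supported w A ->
  exists s, involutive s /\ congruent A (function_mx s).
Proof. by move=> *; apply: (@congruent_reduce set0 A id) => // i; rewrite inE. Qed.

End Congruence.

Section SquareRoot.
Variables (K : numClosedFieldType) (n : nat).
Implicit Types (A S : 'M[K]_n).

Lemma tr_function_mx (s : 'I_n -> 'I_n) : involutive s ->
  (function_mx K s)^T = function_mx K s.
Proof.
by move=> si; apply/matrixP => i j; rewrite !mxE (can2_eq si si) eq_sym.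
Qed.

Lemma function_mxK (s : 'I_n -> 'I_n) : involutive s ->
  function_mx K s *m function_mx K s = 1%:M.
Proof.
move=> si; apply/matrixP => i j; rewrite !mxE (bigD1 (s i)) //= big1 => [|k ki].
  by rewrite !mxE eqxx si mul1r addr0.
by rewrite !mxE eq_sym (negbTE ki) mul0r.
Qed.

(* With e = (1 + P) / 2 and f = (1 - P) / 2 the projectors of an involution P,
   (e + i f)^2 = e - f = P. *)
Lemma sym_square_root A : A^T = A -> A \in unitmx -> exists S, A = S *m S^T.
Proof.
move=> sA uA; have [|s [si [b [_ ub _ bA]]]] := @congruent_involution K n (fun=> 0%N) A sA uA.
  by move=> i j; rewrite eqxx.
set P := function_mx K s in bA; have sP : P^T = P by apply: tr_function_mx.
have PP : P *m P = 1%:M by apply: function_mxK.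
pose Q := ((1 + 'i) / 2) *: 1%:M + ((1 - 'i) / 2) *: P : 'M[K]_n.
have QQ : Q *m Q = P.
  rewrite /Q mulmxDl !mulmxDr -!scalemxAl -!scalemxAr !mul1mx mulmx1 PP !scalerA.
  have i2 := sqrCi K; rewrite expr2 in i2.
  apply/matrixP => x y; rewrite !mxE; set d := (x == y)%:R; set p := (s x == y)%:R.
  transitivity ((1 + 'i * 'i) / 2 * d + (1 - 'i * 'i) / 2 * p : K); first by field.
  by rewrite i2; field.
have sQ : Q^T = Q by rewrite /Q linearD !linearZ /= trmx1 sP.
exists (invmx b *m Q); rewrite trmx_mul sQ -mulmxA (mulmxA Q) QQ bA !mulmxA mulVmx // mul1mx.
by rewrite -mulmxA -trmx_mul mulVmx // trmx1 mulmx1.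
Qed.

End SquareRoot.

Section LowerPermUpper.
Variables (K : numClosedFieldType) (n : nat).

(* The Bruhat decomposition, from the symmetric case applied to the matrix
   with off-diagonal blocks h and h^T. *)
Lemma lower_perm_upper (h : 'M[K]_n) : h \in unitmx ->
  exists b c (s : 'S_n), [/\ lower_mx b, b \in unitmx, lower_mx c, c \in unitmx &
    h = b *m perm_mx s *m c^T].
Proof.
move=> uh; pose A : 'M[K]_(n + n) := block_mx 0 h h^T 0.
have sA : A^T = A by rewrite /A tr_block_mx !trmx0 trmxK.
have uA : A \in unitmx.
  suff AB : A *m block_mx 0 (invmx h^T) (invmx h) 0 = 1%:M by have [] := mulmx1_unit AB.
  rewrite /A mulmx_block !mul0mx !mulmx0 !add0r !addr0 !mulmxV ?unitmx_tr //.
  by rewrite -scalar_mx_block.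
have [|s [si [b [lb ub _ bA]]]] := @congruent_involution K _ (fun=> 0%N) A sA uA.
  by move=> i j; rewrite eqxx.
have bE : b = block_mx (ulsubmx b) 0 (dlsubmx b) (drsubmx b).
  rewrite -[LHS]submxK; congr block_mx; apply/matrixP => i j.
  by rewrite !mxE lb //= ltn_addr.
set b1 := ulsubmx b in bE; set b2 := drsubmx b in bE.
have /andP[ub1 ub2] : (b1 \in unitmx) && (b2 \in unitmx).
  move: ub; rewrite !unitmxE bE det_lblock unitrM.
  by [].
have fE : function_mx K s = block_mx 0 (b1 *m h *m b2^T)
   (b2 *m h^T *m b1^T) (b2 *m h^T *m (dlsubmx b)^T + dlsubmx b *m h *m b2^T).
  rewrite bA {1 2}bE /A tr_block_mx !mulmx_block !trmx0 !mul0mx !mulmx0 !add0r !addr0.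
  by rewrite !mul0mx add0r.
(* The upper left block is 0, so [s] sends the first half of the indices into the second, and the
   upper right block is a permutation matrix. *)
have sr (i : 'I_n) : exists j, s (lshift n i) = rshift n j.
  case: (splitP (s (lshift n i))) => j sj; last by exists j; apply: val_inj.
  have /matrixP/(_ (lshift n i) (lshift n j)) := fE.
  rewrite block_mxEul !mxE.
  have -> : s (lshift n i) = lshift n j by apply: val_inj.
  by rewrite eqxx => /eqP; rewrite oner_eq0.
have [t tP] := fin_all_exists sr.
have tinj : injective t.
  move=> i j e; have : s (lshift n i) = s (lshift n j) by rewrite !tP e.
  by move/(can_inj si)/lshift_inj.
exists (invmx b1), (invmx b2), (perm tinj).
have lb1 : lower_mx b1 by move=> i j ij; rewrite !mxE lb.
have lb2 : lower_mx b2 by move=> i j ij; rewrite !mxE lb //= ltn_add2l.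
split; rewrite ?unitmx_inv //; try exact: lower_mxV.
have -> : perm_mx (perm tinj) = b1 *m h *m b2^T.
  apply/matrixP => i j; have /matrixP/(_ (lshift n i) (rshift n j)) := fE.
  by rewrite block_mxEur => <-; rewrite !mxE tP permE (inj_eq (@rshift_inj _ _)).
by rewrite !mulmxA mulVmx // mul1mx -mulmxA -trmx_mul mulVmx // trmx1 mulmx1.
Qed.

End LowerPermUpper.

(** * Weighted limits of compounds: normal forms and their uniqueness *)

Section MinimalWeight.
Variables (n i : nat).
Implicit Types (w : 'I_n -> nat) (I J : multi_index n i).

Definition min_weight w I : bool := [forall J : multi_index n i, (wsum w I <= wsum w J)%N].

(** Exchanging [x] for [y] gives one direction; for the other, [I] and [J] are compared on their
    differences, which have equal size. Minimality thus depends only on the order of the weights. *)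
Lemma min_weightP w I : reflect {in mset I & ~: mset I, forall x y, w x <= w y}%N (min_weight w I).
Proof.
apply: (iffP forallP) => [min x y xI|ex J].
  rewrite in_setC => yI; have [|J defJ] := @mi_of_set n i (y |: mset I :\ x).
    rewrite cardsU1 in_setD1 (negbTE yI) andbF.
    by have := cardsD1 x (mset I); rewrite xI card_mset.
  have := min J; rewrite !wsumE defJ (big_setD1 x) // big_setU1 ?in_setD1 ?(negbTE yI) ?andbF //=.
  by rewrite leq_add2r.
rewrite !wsumE (big_setID (mset J)) [leqRHS](big_setID (mset I)) /= setIC leq_add2l.
have cIJ : #|mset I :\: mset J| = #|mset J :\: mset I|.
  by have := cardsID (mset J) (mset I); have := cardsID (mset I) (mset J); rewrite !card_mset setIC; lia.
case: (set_0Vmem (mset J :\: mset I)) => [J0|[y0 y0J]].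
  have /eqP : #|mset I :\: mset J| = 0%N by rewrite cIJ J0 cards0.
  by rewrite cards_eq0 => /eqP->; rewrite big_set0.
case: (@arg_minnP _ y0 (fun y => y \in mset J :\: mset I) w y0J) => y yJ ymin.
apply: (@leq_trans (#|mset J :\: mset I| * w y)%N).
  rewrite -cIJ -sum_nat_const; apply: leq_sum => x; rewrite in_setD => /andP[_ xI].
  by move: yJ; rewrite in_setD => /andP[yI _]; apply: ex; rewrite ?in_setC.
by rewrite -sum_nat_const; apply: leq_sum => z /ymin.
Qed.

End MinimalWeight.

Section LimitForms.
Variables (K : fieldType) (n : nat).
Implicit Types (A g p : 'M[K]_n) (w : 'I_n -> nat).

(* The leading coefficient at t = 0 of the i-th compound of diag(t ^ w) * A,
   when A preserves the weight w. *)
Definition limit_compound i w A : 'M[K]_(ext_dim n i) :=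
  \matrix_(a, b) if min_weight w (enum_val a : multi_index n i)
                 then minor A (enum_val a) (enum_val b) else 0.

Lemma conj_compoundE i g (M : 'M[K]_(ext_dim n i)) (L : multi_index n i -> multi_index n i -> K) :
  (forall a b, M a b = L (enum_val a) (enum_val b)) -> forall a b,
  (compound i g *m M *m (compound i g)^T) a b =
  \sum_I \sum_J minor g (enum_val a) I * L I J * minor g (enum_val b) J.
Proof.
move=> ML a b; rewrite mxE sum_multi_index.
under [RHS]eq_bigr => c _ do rewrite sum_multi_index.
rewrite exchange_big; apply: eq_bigr => c _; rewrite mxE big_distrl; apply: eq_bigr => d _.
by rewrite [(compound i g)^T _ _]mxE !compoundE ML.
Qed.

Lemma min_weight_eq i w (I J : multi_index n i) :
  wsum w I = wsum w J -> min_weight w I = min_weight w J.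
Proof. by move=> e; apply: eq_forallb => L; rewrite e. Qed.

Lemma minor_wsum_eq i (w w' : 'I_n -> nat) g (I J : multi_index n i) :
  (forall x y, g x y != 0 -> w' x = w y) ->
  minor g I J != 0 -> wsum w' I = wsum w J.
Proof.
move=> gw /minor_neq0[s sP]; rewrite /wsum [RHS](reindex_perm s) /=.
by apply: eq_bigr => a _; apply/gw/sP.
Qed.

Lemma compound_row_neq0 i g a : g \in unitmx -> exists b, compound i g a b != 0.
Proof.
move=> ug; apply/existsP; apply: contraT => /existsPn h.
have /matrixP/(_ a a) := compoundV i ug; rewrite !mxE eqxx big1 => [/eqP|b _].
  by rewrite eq_sym oner_eq0.
by have := h b; rewrite negbK => /eqP ->; rewrite mul0r.
Qed.

Lemma minor_row_neq0 i g (I : multi_index n i) : g \in unitmx -> exists J, minor g I J != 0.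
Proof.
move=> /(@compound_row_neq0 i g (enum_rank I))[b]; rewrite compoundE enum_rankK.
by exists (enum_val b).
Qed.

Lemma minor_col_neq0 i g (J : multi_index n i) : g \in unitmx -> exists I, minor g I J != 0.
Proof.
rewrite -unitmx_tr => /(minor_row_neq0 J)[I]; rewrite minor_tr; by exists I.
Qed.

(** A nonzero minor of [g] joins index sets of equal total weight, so it carries minimal sets to
    minimal sets, and Cauchy-Binet can be applied within them. *)
Lemma limit_compound_transport i (w w' : 'I_n -> nat) g A : g \in unitmx ->
  (forall x y, g x y != 0 -> w' x = w y) ->
  compound i g *m limit_compound i w A *m (compound i g)^T =
  limit_compound i w' (g *m A *m g^T).
Proof.
move=> ug gw; apply/matrixP => a b.
rewrite (@conj_compoundE _ _ _ (fun I J => if min_weight w I then minor A I J else 0)); last first.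
  by move=> c d; rewrite mxE.
rewrite mxE minorM.
have mw (I J : multi_index n i) : minor g I J != 0 -> min_weight w' I = min_weight w J.
  move=> nz; apply/forallP/forallP => min L.
    have [L' nz'] := minor_col_neq0 L ug.
    by rewrite -(minor_wsum_eq gw nz) -(minor_wsum_eq gw nz').
  have [L' nz'] := minor_row_neq0 L ug.
  by rewrite (minor_wsum_eq gw nz) (minor_wsum_eq gw nz').
transitivity (\sum_I \sum_J if min_weight w' (enum_val a) then
   minor g (enum_val a) I * minor A I J * minor g (enum_val b) J else 0).
  apply: eq_bigr => I _; apply: eq_bigr => J _.
  case: (eqVneq (minor g (enum_val a) I) 0) => [->|/mw ->]; first by rewrite !mul0r if_same.
  by case: ifP => // _; rewrite mulr0 mul0r.
case: ifP => _; last by rewrite big1 // => I _; rewrite big1.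
rewrite exchange_big; apply: eq_bigr => J _; rewrite minorM big_distrl; apply: eq_bigr => I _.
by rewrite minor_tr.
Qed.

(** The unipotent radical of the parabolic subgroup of [w] acts trivially on the limit: in a Leibniz
    term ending at a minimal [J] no factor can raise the weight strictly, so only the Levi part [l]
    of [p] is seen. *)
Lemma limit_compound_parabolic i w p A : block_supported w A ->
  (forall x y, p x y != 0 -> (w x <= w y)%N) ->
  let l := \matrix_(x, y) if w x == w y then p x y else 0 in
  compound i p *m limit_compound i w A *m (compound i p)^T =
  limit_compound i w (l *m A *m l^T).
Proof.
move=> wA pw l.
have lw x y : l x y != 0 -> w x = w y by rewrite mxE; case: (w x =P w y) => // _; rewrite eqxx.
have Aw x y : A x y != 0 -> w x = w y by move=> nz; apply/eqP; apply: contraNT nz => /wA ->.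
have pl (I J : multi_index n i) : min_weight w J -> minor p I J = minor l I J.
  move=> /forallP/(_ I) minJ; apply: eq_bigr => s _; congr (_ * _).
  case: (boolP [forall a, w (tnth (val I) a) == w (tnth (val J) (s a))]) => [/forallP e|].
    by apply: eq_bigr => a _; rewrite !mxE e.
  move=> ne; have [a nea] := forallPn ne; rewrite [RHS](bigD1 a) //= !mxE (negbTE nea) mul0r.
  apply/eqP; apply: contraR ne; rewrite prodf_seq_neq0 => /allP nz.
  have le b : (w (tnth (val I) b) <= w (tnth (val J) (s b)))%N.
    by have := nz b (mem_index_enum _); rewrite mxE => /pw.
  have wJ : wsum w J = (\sum_b w (tnth (val J) (s b)))%N by rewrite /wsum (reindex_perm s).
  have [le0 <-] : (wsum w I <= \sum_b w (tnth (val J) (s b)) ?= iff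
     [forall b, w (tnth (val I) b) == w (tnth (val J) (s b))])%N.
    exact: (leqif_sum (fun b _ => leqif_eq (le b))).
  by rewrite -wJ eqn_leq minJ wJ le0.
apply/matrixP => a b.
rewrite (@conj_compoundE _ _ _ (fun I J => if min_weight w I then minor A I J else 0)); last first.
  by move=> c d; rewrite mxE.
rewrite mxE minorM.
transitivity (\sum_I \sum_J if min_weight w (enum_val a) then
   minor l (enum_val a) I * minor A I J * minor l (enum_val b) J else 0).
  apply: eq_bigr => I _; apply: eq_bigr => J _.
  case: (boolP (min_weight w I)) => mI; last first.
    rewrite mulr0 mul0r; case: ifP => // ma.
    case: (eqVneq (minor l (enum_val a) I) 0) => [->|nz]; first by rewrite !mul0r.
    by rewrite -(min_weight_eq (minor_wsum_eq lw nz)) ma in mI.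
  rewrite pl //.
  case: (eqVneq (minor l (enum_val a) I) 0) => [->|nz]; first by rewrite !mul0r if_same.
  rewrite (min_weight_eq (minor_wsum_eq lw nz)) mI.
  case: (eqVneq (minor A I J) 0) => [->|nzA]; first by rewrite mulr0 !mul0r.
  by rewrite pl // -(min_weight_eq (minor_wsum_eq Aw nzA)).
case: ifP => _; last by rewrite big1 // => I _; rewrite big1.
rewrite exchange_big; apply: eq_bigr => J _; rewrite minorM big_distrl; apply: eq_bigr => I _.
by rewrite minor_tr.
Qed.

End LimitForms.

Section NormalForm.
Variables (K : numClosedFieldType) (n : nat).
Implicit Types (A D h b g : 'M[K]_n) (w : 'I_n -> nat).

Lemma block_supported_transport (w w' : 'I_n -> nat) g A :
  (forall x y, g x y != 0 -> w' x = w y) ->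
  block_supported w A -> block_supported w' (g *m A *m g^T).
Proof.
move=> gw wA x y xy; rewrite mxE big1 // => c _; rewrite !mxE.
case: (eqVneq (g y c) 0) => [->|/gw yc]; first by rewrite mulr0.
rewrite big1 ?mul0r // => d _; case: (eqVneq (g x d) 0) => [->|/gw xd]; first by rewrite mul0r.
by rewrite wA ?mulr0 // -xd -yc.
Qed.

(** In the decomposition of [h], the upper triangular factor raises weights because [w] is monotone,
    and so acts through its Levi part. The permutation then replaces [w] by [w1], which need not be
    monotone, and the blocks of [w1] are reduced to an involution. *)
Lemma limit_normal_form h D w : h \in unitmx -> D^T = D -> D \in unitmx ->
  block_supported w D -> (forall x y : 'I_n, (x <= y)%N -> (w x <= w y)%N) ->
  exists b s w', [/\ lower_mx b, b \in unitmx, involutive s, forall x, w' (s x) = w' x &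
    forall i, compound i h *m limit_compound i w D *m (compound i h)^T =
      compound i b *m limit_compound i w' (function_mx K s) *m (compound i b)^T].
Proof.
move=> uh sD uD wD wmono.
have [b1 [c [t [lb1 ub1 lc uc hE]]]] := lower_perm_upper uh.
have cw x y : c^T x y != 0 -> (w x <= w y)%N.
  by rewrite mxE => nz; apply: wmono; rewrite leqNgt; apply: contra nz => /lc ->.
pose l : 'M[K]_n := \matrix_(x, y) if w x == w y then c^T x y else 0.
have lw x y : l x y != 0 -> w x = w y.
  by rewrite mxE; case: (w x =P w y) => // _; rewrite eqxx.
have ul : l \in unitmx.
  rewrite -unitmx_tr unitmxE det_lower; last first.
    by move=> x y xy; rewrite !mxE lc // if_same.
  by move: uc; rewrite unitmxE det_lower //; under [X in _ -> is_true (X \is a _)]eq_bigr do rewrite !mxE eqxx.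
pose A1 := l *m D *m l^T; pose P : 'M[K]_n := perm_mx t; pose w1 x := w (t x).
have Pw x y : P x y != 0 -> w1 x = w y.
  by rewrite !mxE; case: (t x =P y) => [<-|]; rewrite ?eqxx.
pose A2 := P *m A1 *m P^T.
have uP : P \in unitmx by apply: unitmx_perm.
have [|||s [si [b3 [lb3 ub3 wb3 sE]]]] := @congruent_involution K n w1 A2.
- by rewrite /A2 /A1 !trmx_mul !trmxK sD !mulmxA.
- by rewrite /A2 /A1 !unitmx_mul !unitmx_tr uP ul uD.
- by apply: (block_supported_transport Pw); apply: (block_supported_transport lw).
have w1A2 : block_supported w1 A2.
  by apply: (block_supported_transport Pw); apply: (block_supported_transport lw).
have b3w x y : b3 x y != 0 -> w1 x = w1 y.
  by move=> nz; apply/eqP; apply: contraNT nz => /wb3 ->.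
exists (b1 *m invmx b3), s, w1; split=> // [|| x |i].
- by apply: lower_mxM => //; apply: lower_mxV.
- by rewrite unitmx_mul ub1 unitmx_inv.
(* The matrix of [s] is supported on the blocks of [w1], and its entry at [(x, s x)] is 1. *)
- apply/esym/eqP; apply: contraTT isT => nw.
  have /matrixP/(_ x (s x)) := sE; rewrite (block_supported_transport b3w w1A2 nw) mxE eqxx.
  by move/eqP; rewrite oner_eq0.
have e1 : compound i c^T *m limit_compound i w D *m (compound i c^T)^T = limit_compound i w A1.
  exact: limit_compound_parabolic.
have e2 : compound i P *m limit_compound i w A1 *m (compound i P)^T = limit_compound i w1 A2.
  exact: limit_compound_transport.
have e3 : compound i b3 *m limit_compound i w1 A2 *m (compound i b3)^T =
    limit_compound i w1 (function_mx K s).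
  by rewrite sE; apply: limit_compound_transport.
have e4 : limit_compound i w1 A2 = compound i (invmx b3) *m
    limit_compound i w1 (function_mx K s) *m (compound i (invmx b3))^T.
  rewrite -e3 !mulmxA -compoundM mulVmx // compound1 mul1mx -!mulmxA -trmx_mul -compoundM.
  by rewrite mulVmx // compound1 trmx1 mulmx1.
rewrite hE !compoundM !trmx_mul.
transitivity (compound i b1 *m limit_compound i w1 A2 *m (compound i b1)^T).
  by rewrite -e2 -e1 !mulmxA.
by rewrite e4 !mulmxA.
Qed.

(** The canonical weight with the order of [w]; it is the label used by [block_involution] for
    offset 0 and the whole index set. *)
Definition rank_weight w (x : 'I_n) : nat := #|[set y | (w y < w x)%N]|.

Lemma leq_rank_weight w x y : (rank_weight w x <= rank_weight w y)%N = (w x <= w y)%N.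
Proof.
apply/idP/idP => [|xy]; last first.
  by apply: subset_leq_card; apply/subsetP => z; rewrite !inE => /leq_trans; apply.
apply: contraTT; rewrite -!ltnNge => yx; apply: proper_card; apply/properP; split.
  by apply/subsetP => z; rewrite !inE => /ltn_trans; apply.
by exists y; rewrite !inE ?ltnn.
Qed.

Lemma rank_weightK w x : rank_weight (rank_weight w) x = rank_weight w x.
Proof. by apply: eq_card => y; rewrite !inE !ltnNge leq_rank_weight. Qed.

Lemma eq_min_weight i w w' (I : multi_index n i) :
  (forall x y, (w x <= w y)%N = (w' x <= w' y)%N) -> min_weight w I = min_weight w' I.
Proof.
by move=> e; apply/min_weightP/min_weightP => h x y xI yI; have := h x y xI yI; rewrite e.
Qed.

Lemma eq_limit_compound i w w' A :
  (forall x y, (w x <= w y)%N = (w' x <= w' y)%N) -> limit_compound i w A = limit_compound i w' A.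
Proof. by move=> e; apply/matrixP => a b; rewrite !mxE (eq_min_weight _ e). Qed.

Lemma minor_function i s (I J : multi_index n i) : minor (function_mx K s) I J != 0 ->
  mset J = [set s x | x in mset I].
Proof.
move=> /minor_neq0[t tP].
have e a : s (tnth (val I) a) = tnth (val J) (t a).
  by have := tP a; rewrite mxE; case: (s _ =P _) => // _; rewrite eqxx.
apply/setP => y; apply/idP/imsetP => [/mi_tnthP[a ->]|[x /mi_tnthP[a ->] ->]].
  by exists (tnth (val I) (t^-1%g a)); rewrite ?mi_tnth // e permKV.
by rewrite e mi_tnth.
Qed.

Lemma function_mx_unit (s : 'I_n -> 'I_n) : involutive s -> function_mx K s \in unitmx.
Proof. by move=> /(function_mxK K)/mulmx1_unit[]. Qed.

(* Write the hypothesis as U M = c M' V^T with U and V lower triangular. On the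
   left the entry (a, j) is a nonzero multiple of M a j; on the right it needs an entry
   of M' in row a and a column not after j. *)
Lemma triangular_support i b c (M M' : 'M[K]_(ext_dim n i)) : lower_mx b -> b \in unitmx ->
  c != 0 -> compound i b *m M *m (compound i b)^T = c *: M' ->
  (forall a a' j, M a j != 0 -> M a' j != 0 -> a = a') ->
  forall a j, M a j != 0 -> exists2 j', M' a j' != 0 &
    (wsum val (enum_val j') < wsum val (enum_val j))%N || (j == j').
Proof.
move=> lb ub c0 eM colM a j nz; have lV := lower_mxV lb ub.
have {}eM : compound i b *m M = c *: (M' *m (compound i (invmx b))^T).
  rewrite scalemxAl -eM -!mulmxA -trmx_mul -compoundM mulVmx //.
  by rewrite compound1 trmx1 mulmx1.
have /matrixP/(_ a j) := eM; rewrite !mxE (bigD1 a) //= big1 ?addr0; last first.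
  move=> a' aa'; case: (eqVneq (M a' j) 0) => [->|nz']; first by rewrite mulr0.
  by rewrite (colM _ _ _ nz nz') eqxx in aa'.
move=> e; have nz1 : c * (\sum_j' M' a j' * (compound i (invmx b))^T j' j) != 0.
  rewrite -e mulf_neq0 // compoundE.
  exact: (@minor_unit_diag _ _ _ _ _ _ lb lV (mulmxV ub)).
have /existsP[j' nzj'] : [exists j', M' a j' * (compound i (invmx b))^T j' j != 0].
  apply: contraNT nz1 => /existsPn h; rewrite big1 ?mulr0 // => j' _.
  by have := h j'; rewrite negbK => /eqP.
exists j'; first by apply: contra nzj' => /eqP->; rewrite mul0r.
have : minor (invmx b) (enum_val j) (enum_val j') != 0.
  by apply: contra nzj'; rewrite mxE compoundE => /eqP->; rewrite mulr0.
by move=> /(minor_lower lV)/orP[->//|/eqP/enum_val_inj->]; rewrite eqxx orbT.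
Qed.

(** [triangular_support] is applied to [b] and then to its inverse. The column can only move down
    each time, and it returns to [j] because a row of [M] has one nonzero entry; so it never
    moved. *)
Lemma triangular_support_eq i b c (M M' : 'M[K]_(ext_dim n i)) : lower_mx b -> b \in unitmx ->
  c != 0 -> compound i b *m M *m (compound i b)^T = c *: M' ->
  (forall a a' j, M a j != 0 -> M a' j != 0 -> a = a') ->
  (forall a a' j, M' a j != 0 -> M' a' j != 0 -> a = a') ->
  (forall a j j', M a j != 0 -> M a j' != 0 -> j = j') ->
  forall a j, M a j != 0 -> M' a j != 0.
Proof.
move=> lb ub c0 eM colM colM' rowM a j nz.
have [j' nz' jj'] := triangular_support lb ub c0 eM colM nz.
have eM' : compound i (invmx b) *m M' *m (compound i (invmx b))^T = c^-1 *: M.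
  apply: (scalerI c0); rewrite scalerA divff // scale1r scalemxAl scalemxAr -eM.
  rewrite !mulmxA -compoundM mulVmx // compound1 mul1mx -!mulmxA -trmx_mul -compoundM.
  by rewrite mulVmx // compound1 trmx1 mulmx1.
have ub' : invmx b \in unitmx by rewrite unitmx_inv.
have [j'' nz'' j'j''] := triangular_support (lower_mxV lb ub) ub' (invr_neq0 c0) eM' colM' nz'.
have e := rowM _ _ _ nz nz''; rewrite -e in j'j''.
case/orP: jj' => [jj'|/eqP -> //]; case/orP: j'j'' => [j'j|/eqP <- //].
by have := ltn_trans jj' j'j; rewrite ltnn.
Qed.

Definition down_closed w (S : {set 'I_n}) : Prop := {in S & ~: S, forall x y, w x <= w y}%N.

(** The sublevel set of [x] gives [w' x <= w' y]. A tie is excluded by the set of all elements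
    strictly below [y] together with [y]: a down-closed set may cut a level anywhere, so this one
    contains [y] but not [x]. *)
Lemma weight_from_down_closed w w' :
  (forall S, down_closed w S -> down_closed w' S) ->
  (forall S, down_closed w' S -> down_closed w S) ->
  forall x y, (w x < w y)%N -> (w' x < w' y)%N.
Proof.
move=> h h' x y xy; rewrite ltnNge; apply/negP => yx'.
have : down_closed w' [set z | (w z <= w x)%N].
  by apply: h => z t; rewrite !inE -ltnNge => zx xt; apply: ltnW; apply: leq_ltn_trans xt.
move=> /(_ x y); rewrite !inE -ltnNge leqnn => /(_ isT xy) xy'.
have : down_closed w [set z | (w' z < w' y)%N || (z == y)].
  apply: h' => z t; rewrite !inE negb_or -leqNgt => zy /andP[yt _].
  by case/orP: zy => [/ltnW/leq_trans|/eqP->]; [apply|].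
move=> /(_ y x); rewrite !inE eqxx orbT negb_or -leqNgt yx' /=.
case: eqP xy => [->|_ xy]; first by rewrite ltnn.
by move=> /(_ isT isT); rewrite leqNgt xy.
Qed.

(** The set [S] has [x] as its only element of weight [w x], and both involutions preserve weights,
    so equal images of [S] force equal images of [x]. *)
Lemma involution_from_down_closed w (s s' : 'I_n -> 'I_n) :
  involutive s -> (forall x, w (s x) = w x) -> (forall x, w (s' x) = w x) ->
  (forall S, down_closed w S -> [set s x | x in S] = [set s' x | x in S]) -> s =1 s'.
Proof.
move=> si ws ws' h x; pose S := [set z | (w z < w x)%N || (z == x)].
have dS : down_closed w S.
  move=> z t; rewrite !inE negb_or -leqNgt => zx /andP[xt _].
  by case/orP: zx => [/ltnW/leq_trans|/eqP->]; [apply|].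
have : s' x \in [set s z | z in S] by rewrite (h S dS) imset_f // !inE eqxx orbT.
move=> /imsetP[z]; rewrite !inE => /orP[zx e|/eqP-> //].
by rewrite -(ws z) -e ws' ltnn in zx.
Qed.

Lemma limit_support i s w (a j : 'I_(ext_dim n i)) :
  limit_compound i w (function_mx K s) a j != 0 ->
  min_weight w (enum_val a) /\ mset (enum_val j) = [set s x | x in mset (enum_val a)].
Proof. by rewrite mxE; case: ifP => [m nz|]; rewrite ?eqxx //; split=> //; apply: minor_function. Qed.

Lemma limit_col s w i a a' j : injective s ->
  limit_compound i w (function_mx K s) a j != 0 ->
  limit_compound i w (function_mx K s) a' j != 0 -> a = a'.
Proof.
move=> sinj /limit_support[_ e1] /limit_support[_]; rewrite e1 => /(imset_inj sinj) e.
exact/enum_val_inj/mset_inj.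
Qed.

Lemma limit_row s w i a j j' :
  limit_compound i w (function_mx K s) a j != 0 ->
  limit_compound i w (function_mx K s) a j' != 0 -> j = j'.
Proof. by move=> /limit_support[_ e] /limit_support[_ e']; apply/enum_val_inj/mset_inj; rewrite e. Qed.

(** A down-closed set of size [i] is a nonzero row of the [i]-th limit, and its image under [s] is
    the column of the entry. Sizes 0 and [n], for which there is no factor, are trivial. *)
Lemma limit_congruent_down_closed b s s' (w w' : 'I_n -> nat) : lower_mx b -> b \in unitmx ->
  involutive s -> involutive s' ->
  (forall i, (0 < i < n)%N -> exists2 c, c != 0 &
    compound i b *m limit_compound i w (function_mx K s) *m (compound i b)^T =
    c *: limit_compound i w' (function_mx K s')) ->
  forall S, down_closed w S ->
    down_closed w' S /\ [set s x | x in S] = [set s' x | x in S].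
Proof.
move=> lb ub si si' h S dS.
have [S0|cS0] := posnP #|S|.
  by move/cards0_eq: S0 => ->; split; [move=> x y; rewrite inE|rewrite !imset0].
case: (ltnP #|S| n) => cSn; last first.
  have -> : S = setT by apply/eqP; rewrite eqEcard subsetT cardsT card_ord.
  split; first by move=> x y _; rewrite !inE.
  apply/eqP; rewrite eqEcard; apply/andP; split.
    by apply/subsetP => x _; apply/imsetP; exists (s' x); rewrite ?inE ?si'.
  by rewrite !card_imset //; apply: can_inj; eassumption.
have [I defI] := @mi_of_set n #|S| S erefl.
have [|c c0 e] := h #|S|; first by rewrite cS0.
have mI : min_weight w I by apply/min_weightP; rewrite defI.
have [J nz] := minor_row_neq0 I (function_mx_unit si).
have nz1 : limit_compound #|S| w (function_mx K s) (enum_rank I) (enum_rank J) != 0.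
  by rewrite mxE !enum_rankK mI.
have := triangular_support_eq lb ub c0 e (fun a a' j => @limit_col s w _ a a' j (can_inj si))
  (fun a a' j => @limit_col s' w' _ a a' j (can_inj si')) (fun a j j' => @limit_row s w _ a j j') nz1.
move=> /limit_support[]; have [_] := limit_support nz1.
by rewrite !enum_rankK defI => -> /min_weightP + ->; rewrite defI.
Qed.

Lemma limit_form_unique b s s' (w w' : 'I_n -> nat) : lower_mx b -> b \in unitmx ->
  involutive s -> involutive s' -> (forall x, w (s x) = w x) -> (forall x, w' (s' x) = w' x) ->
  (forall i, (0 < i < n)%N -> exists2 c, c != 0 &
    compound i b *m limit_compound i w (function_mx K s) *m (compound i b)^T =
    c *: limit_compound i w' (function_mx K s')) ->
  rank_weight w =1 rank_weight w' /\ s =1 s'.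
Proof.
move=> lb ub si si' ws ws' h.
have h1 := limit_congruent_down_closed lb ub si si' h.
have ub' : invmx b \in unitmx by rewrite unitmx_inv.
have h2 : forall S, down_closed w' S ->
    down_closed w S /\ [set s' x | x in S] = [set s x | x in S].
  apply: (limit_congruent_down_closed (lower_mxV lb ub) ub') => // i /h[c c0 e].
  exists c^-1; rewrite ?invr_eq0 //.
  apply: (scalerI c0); rewrite scalerA divff // scale1r scalemxAl scalemxAr -e.
  rewrite !mulmxA -compoundM mulVmx // compound1 mul1mx -!mulmxA -trmx_mul -compoundM.
  by rewrite mulVmx // compound1 trmx1 mulmx1.
have lt1 := weight_from_down_closed (fun S d => (h1 S d).1) (fun S d => (h2 S d).1).
have lt2 := weight_from_down_closed (fun S d => (h2 S d).1) (fun S d => (h1 S d).1).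
have ltE x y : (w x < w y)%N = (w' x < w' y)%N by apply/idP/idP => [/lt1|/lt2].
split=> [x|]; first by apply: eq_card => y; rewrite !inE ltE.
apply: (involution_from_down_closed si ws) => [x|S dS]; last exact: (h1 S dS).2.
by apply/eqP; rewrite eqn_leq; apply/andP; split; rewrite leqNgt ltE ws' ltnn.
Qed.

End NormalForm.

(** * Limits of diagonal matrices through ratios of consecutive entries *)

Section MonotoneIndices.
Variables n i : nat.

Lemma mi_of_increasing (f : 'I_i -> 'I_n) : (forall p q : 'I_i, p < q -> f p < f q)%N ->
  exists I : multi_index n i, forall p, tnth (val I) p = f p.
Proof.
move=> finc; have st : sorted ltn (map val (mktuple f)).
  apply/(sortedP 0%N) => p; rewrite size_map size_tuple => pi.
  have pi' : (p < i)%N := ltnW pi.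
  rewrite !(nth_map (f (Ordinal pi))) ?size_tuple //.
  have nE d q (qi : (q < i)%N) : nth d (mktuple f) q = f (Ordinal qi).
    by rewrite -(nth_mktuple f d (Ordinal qi)).
  by rewrite (nE _ _ pi') (nE _ _ pi); apply: finc => /=.
by exists (Sub (mktuple f) st) => p; rewrite SubK tnth_mktuple.
Qed.

Lemma mi_increasing (I : multi_index n i) (p q : 'I_i) :
  (p < q)%N -> (tnth (val I) p < tnth (val I) q)%N.
Proof.
move=> pq; have x0 : 'I_n := tnth (val I) p.
have := sorted_ltn_nth ltn_trans 0%N (mi_sorted I) p q.
rewrite !inE size_map size_tuple !ltn_ord => /(_ isT isT pq).
by rewrite !(nth_map x0) ?size_tuple // -!tnth_nth.
Qed.

Lemma mi_geq (I : multi_index n i) (p : 'I_i) : (p <= tnth (val I) p)%N.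
Proof.
case: p => p pi; elim: p pi => // p IHp pi.
have pi' : (p < i)%N := ltnW pi.
apply: leq_ltn_trans (IHp pi') _; exact: mi_increasing.
Qed.

End MonotoneIndices.

Lemma mi_initial n i : (i <= n)%N ->
  exists I : multi_index n i, forall p, tnth (val I) p = p :> nat.
Proof.
move=> le; have [//|I IE] := @mi_of_increasing n i (widen_ord le).
by exists I => p; rewrite IE.
Qed.

Section DiagonalLimit.
Variables (K : fieldType) (n : nat) (z : nat -> K).

(** For [z l = d_(l+1) / d_l] this telescopes to the product of the [d_x] over [I] divided by that
    over the first [i] indices. *)
Definition ratio_product i (I : multi_index n i) : K :=
  \prod_(p < i) \prod_(p <= l < tnth (val I) p) z l.

Lemma minor_diag i (d : 'rV[K]_n) (I J : multi_index n i) :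
  minor (diag_mx d) I J = (I == J)%:R * \prod_p d 0 (tnth (val I) p).
Proof.
case: eqP => [<-|/eqP neq].
  rewrite mul1r; transitivity (\det (diag_mx (\row_p d 0 (tnth (val I) p)))).
    congr (\det _); apply/matrixP => p q; rewrite !mxE (inj_eq (@mi_inj _ _ I)).
    by case: eqP.
  by rewrite det_diag; apply: eq_bigr => p _; rewrite mxE.
rewrite mul0r; apply/eqP; apply: contraNT neq => /minor_neq0[s sP].
apply/eqP/mset_sub/subsetP => _ /mi_tnthP[a ->]; have := sP a; rewrite mxE.
by case: (tnth (val I) a =P _) => [-> _|_]; rewrite ?mi_tnth // mulr0n eqxx.
Qed.

(** [D] has the given ratios with every zero replaced by 1, and [w] counts the zeros passed: a zero
    ratio stands for a factor t that tends to 0. *)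
Lemma ratio_product_limit : exists D w, [/\ D^T = D, D \in unitmx, block_supported w D,
  forall x y : 'I_n, (x <= y)%N -> (w x <= w y)%N &
  forall i, (i <= n)%N -> exists2 c, c != 0 & limit_compound i w D =
     c *: \matrix_(a, b) ((a == b)%:R * ratio_product (enum_val a : multi_index n i))].
Proof.
pose zeros x := (\sum_(0 <= l < x) (z l == 0%R))%N.
pose delta x := \prod_(0 <= l < x) (if z l == 0 then 1 else z l).
have delta0 x : delta x != 0.
  by rewrite prodf_seq_neq0; apply/allP => l _ /=; case: ifP => [_|/negbT//]; rewrite oner_eq0.
have zmono x y : (x <= y)%N -> (zeros x <= zeros y)%N.
  by move=> xy; rewrite /zeros (big_cat_nat (leq0n x) xy) /= leq_addr.
pose w (x : 'I_n) := zeros x; pose D : 'M[K]_n := diag_mx (\row_x delta x).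
exists D, w; split; first exact: tr_diag_mx.
- rewrite unitmxE /D det_diag unitfE prodf_seq_neq0; apply/allP => x _ /=.
  by rewrite mxE.
- by move=> x y xy; rewrite !mxE; case: (x =P y) xy => [->|]; rewrite ?eqxx.
- by move=> x y; apply: zmono.
move=> i le; have [T TE] := mi_initial le.
exists (\prod_(p < i) delta p); first by rewrite prodf_seq_neq0; apply/allP => p _ /=.
apply/matrixP => a b; rewrite [LHS]mxE [RHS]mxE [X in _ * X]mxE.
set I : multi_index n i := enum_val a.
rewrite minor_diag (inj_eq enum_val_inj) mulrCA mulrC.
case: (a =P b) => _; last by rewrite mulr0 mul0r if_same.
rewrite mulr1 mul1r.
have geI (p : 'I_i) : (zeros p <= w (tnth (val I) p))%N by apply/zmono/mi_geq.
have [le0 eq0] : (\sum_(p < i) zeros p <= wsum w I ?= iff [forall p : 'I_i, zeros p == w (tnth (val I) p)])%N.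
  exact: (leqif_sum (fun (p : 'I_i) _ => leqif_eq (geI p))).
have wT : wsum w T = (\sum_(p < i) zeros p)%N by apply: eq_bigr => p _; rewrite /w TE.
have -> : min_weight w I = [forall p : 'I_i, zeros p == w (tnth (val I) p)].
  apply/forallP/idP => [/(_ T)|].
    by rewrite -eq0 wT eqn_leq le0 => ->.
  rewrite -eq0 => /eqP <- J; apply: leq_sum => p _; exact/zmono/mi_geq.
(* The product vanishes exactly when a zero ratio lies between [p] and [x], that is, when the weight
   jumps there. *)
have zE (p x : nat) : (p <= x)%N ->
    delta p * \prod_(p <= l < x) z l = if zeros p == zeros x then delta x else 0.
  move=> px; have zx : zeros x = (zeros p + \sum_(p <= l < x) (z l == 0%R))%N.
    by rewrite /zeros (big_cat_nat (leq0n p) px).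
  rewrite zx -[X in X == _]addn0 eqn_add2l eq_sym sum_nat_seq_eq0.
  case: ifP => [/allP nz|/negbT/allPn[l]].
    rewrite /delta (big_cat_nat (leq0n p) px) /=; congr (_ * _).
    apply: eq_big_seq => l /nz /=; by case: (z l =P 0).
  rewrite mem_index_iota /= => lpx; case: (z l =P 0) => // zl _.
  by rewrite (bigD1_seq l) ?iota_uniq ?mem_index_iota //= zl mul0r mulr0.
rewrite /ratio_product -big_split /=.
under [RHS]eq_bigr => p _ do rewrite (zE _ _ (mi_geq I p)).
case: ifP => [/forallP e|/negbT/forallPn[p ne]].
  by apply: eq_bigr => p _; rewrite mxE; have /eqP := e p; rewrite /w => ->; rewrite eqxx.
by rewrite [RHS](bigD1 p) //=; move: ne; rewrite /w => /negbTE ->; rewrite mul0r.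
Qed.

End DiagonalLimit.

From mathcomp Require Import boolp classical_sets functions cardinality fsbigop mpoly.

Local Open Scope classical_set_scope.
Local Open Scope ring_scope.

(** * The closure of the smooth quadrics *)

Section FunctionSubrings.
Variables (X : Type) (K : fieldType) (C : (X -> K) -> Prop).

(** Two classes are used: functions polynomial on every line, for genericity, and fractions in the
    leading coefficients, for the chart. Both then contain minors, compounds and adjugates of their
    matrices. *)
Definition fun_subring : Prop :=
  [/\ forall c, C (fun=> c), forall F G, C F -> C G -> C (fun x => F x + G x) &
      forall F G, C F -> C G -> C (fun x => F x * G x)].

Hypothesis CP : fun_subring.

Lemma fsub_ext F G : F =1 G -> C F -> C G.
Proof. by move=> /funext ->. Qed.

Lemma fsub_sum I (r : seq I) (P : pred I) (F : I -> X -> K) :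
  (forall i, C (F i)) -> C (fun x => \sum_(i <- r | P i) F i x).
Proof.
have [Cc CD _] := CP; move=> CF; elim: r => [|i r IHr].
  by apply: fsub_ext (Cc 0) => x; rewrite big_nil.
case Pi: (P i).
  by apply: fsub_ext (CD _ _ (CF i) IHr) => x; rewrite big_cons Pi.
by apply: fsub_ext IHr => x; rewrite big_cons Pi.
Qed.

Lemma fsub_prod I (r : seq I) (P : pred I) (F : I -> X -> K) :
  (forall i, C (F i)) -> C (fun x => \prod_(i <- r | P i) F i x).
Proof.
have [Cc _ CM] := CP; move=> CF; elim: r => [|i r IHr].
  by apply: fsub_ext (Cc 1) => x; rewrite big_nil.
case Pi: (P i).
  by apply: fsub_ext (CM _ _ (CF i) IHr) => x; rewrite big_cons Pi.
by apply: fsub_ext IHr => x; rewrite big_cons Pi.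
Qed.

Lemma fsub_sub F G : C F -> C G -> C (fun x => F x - G x).
Proof.
have [Cc CD CM] := CP; move=> CF CG.
by apply: fsub_ext (CD _ _ CF (CM _ _ (Cc (-1)) CG)) => x; rewrite mulN1r.
Qed.

Definition fsub_mx m p (A : X -> 'M[K]_(m, p)) : Prop := forall i j, C (fun x => A x i j).

Lemma fsub_det m (A : X -> 'M[K]_m) : fsub_mx A -> C (fun x => \det (A x)).
Proof.
have [Cc _ CM] := CP; move=> CA; apply: fsub_sum => s; apply: CM; first exact: Cc.
by apply: fsub_prod => i; apply: CA.
Qed.

Lemma fsub_minor m i (A : X -> 'M[K]_m) (I J : multi_index m i) :
  fsub_mx A -> C (fun x => minor (A x) I J).
Proof. by move=> CA; apply: fsub_det => p q; apply: fsub_ext (CA _ _) => x; rewrite mxE. Qed.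

Lemma fsub_compound m i (A : X -> 'M[K]_m) : fsub_mx A -> fsub_mx (fun x => compound i (A x)).
Proof.
by move=> CA a b; apply: fsub_ext (fsub_minor (enum_val a) (enum_val b) CA) => x; rewrite compoundE.
Qed.

Lemma fsub_mulmx m p q (A : X -> 'M[K]_(m, p)) (B : X -> 'M[K]_(p, q)) :
  fsub_mx A -> fsub_mx B -> fsub_mx (fun x => A x *m B x).
Proof.
have [_ _ CM] := CP; move=> CA CB i j.
apply: (@fsub_ext (fun x => \sum_k A x i k * B x k j)) => [x|]; first by rewrite mxE.
by apply: fsub_sum => k; apply: CM.
Qed.

Lemma fsub_trmx m p (A : X -> 'M[K]_(m, p)) : fsub_mx A -> fsub_mx (fun x => (A x)^T).
Proof. by move=> CA i j; apply: fsub_ext (CA j i) => x; rewrite mxE. Qed.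

Lemma fsub_adj m (A : X -> 'M[K]_m) : fsub_mx A -> fsub_mx (fun x => \adj (A x)).
Proof.
have [Cc _ CM] := CP; move=> CA i j; apply: (@fsub_ext (fun x => cofactor (A x) j i)).
  by move=> x; rewrite mxE.
apply: CM; first exact: Cc.
by apply: fsub_det => p q; apply: fsub_ext (CA (lift j p) (lift i q)) => x; rewrite !mxE.
Qed.

Lemma fsub_const_mx m p (A : 'M[K]_(m, p)) : fsub_mx (fun=> A).
Proof. by have [Cc _ _] := CP => i j; apply: Cc. Qed.

End FunctionSubrings.

(** * Fractions of multidegree zero and closed conditions *)

Section HomogeneousFunctions.
Variables (K : fieldType) (n : nat).

Definition factors : Type := forall k : 'I_n.-1, 'M[K]_(ext_dim n k.+1).
Implicit Types (v : factors) (F G H : factors -> K) (e : 'I_n.-1 -> nat).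

Definition homogeneous_fun e F : Prop :=
  exists f : {mpoly K[#|{: coord_index n}|]},
    (forall m, m \in msupp f -> forall k,
       (\sum_(j | tag (enum_val j : coord_index n) == k) m j)%N = e k) /\
    forall v, f.@[coords v] = F v.

Lemma homogeneous_const c : homogeneous_fun (fun=> 0%N) (fun=> c).
Proof.
exists c%:MP; split=> [m|v]; last exact: mevalC.
rewrite msuppC; case: ifP => // _; rewrite inE => /eqP-> k.
by rewrite big1 // => j _; rewrite mnm0E.
Qed.

Lemma homogeneousD e F G : homogeneous_fun e F -> homogeneous_fun e G ->
  homogeneous_fun e (fun v => F v + G v).
Proof.
move=> [f [hf fE]] [g [hg gE]]; exists (f + g); split=> [m /msuppD_le|v].
  by rewrite mem_cat => /orP[/hf|/hg].
by rewrite mevalD fE gE.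
Qed.

Lemma homogeneousM e e' F G : homogeneous_fun e F -> homogeneous_fun e' G ->
  homogeneous_fun (fun k => e k + e' k)%N (fun v => F v * G v).
Proof.
move=> [f [hf fE]] [g [hg gE]]; exists (f * g); split=> [m /msuppM_le|v]; last by rewrite mevalM fE gE.
move=> /allpairsP[[m1 m2] [/= /hf h1 /hg h2 ->]] k.
by rewrite -h1 -h2 -big_split; apply: eq_bigr => j _; rewrite mnmDE.
Qed.

Lemma homogeneous_coord k a b :
  homogeneous_fun (fun l => (l == k) : nat) (fun v => v k a b).
Proof.
pose t : coord_index n := Tagged (fun k : 'I_n.-1 => ('I_(ext_dim n k.+1) * 'I_(ext_dim n k.+1))%type) (a, b).
exists 'X_(enum_rank t); split=> [m|v]; last by rewrite mevalXU /coords enum_rankK.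
rewrite msuppX inE => /eqP -> l; rewrite (eq_bigr (fun j => (j == enum_rank t) : nat)); last first.
  by move=> j _; rewrite mnm1E eq_sym.
case: (altP (l =P k)) => [->|lk].
  rewrite (bigD1 (enum_rank t)) ?enum_rankK //= eqxx big1 // => j /andP[_ /negbTE ->] //.
rewrite big1 // => j /eqP jl; case: eqP => // jt; move: jl; rewrite jt enum_rankK /= => e.
by rewrite e eqxx in lk.
Qed.

Lemma homogeneous_ext e e' F G : e =1 e' -> F =1 G -> homogeneous_fun e F -> homogeneous_fun e' G.
Proof. by move=> /funext -> /funext ->. Qed.

Lemma homogeneous_sum e I (r : seq I) (F : I -> factors -> K) :
  (forall i, homogeneous_fun e (F i)) -> homogeneous_fun e (fun v => \sum_(i <- r) F i v).
Proof.
move=> hF; elim: r => [|i r IHr].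
  by exists 0; split=> [m|v]; rewrite ?msupp0 ?meval0 ?big_nil.
by apply: homogeneous_ext (homogeneousD (hF i) IHr) => // v; rewrite [RHS]big_cons.
Qed.

Lemma homogeneous_scale e c F : homogeneous_fun e F -> homogeneous_fun e (fun v => c * F v).
Proof. by move=> hF; apply: homogeneous_ext (homogeneousM (homogeneous_const c) hF). Qed.

Lemma homogeneous_linear (k : 'I_n.-1) (c : 'M[K]_(ext_dim n k.+1)) :
  homogeneous_fun (fun l => (l == k) : nat) (fun v => \sum_a \sum_b c a b * v k a b).
Proof.
apply: homogeneous_sum => a; apply: homogeneous_sum => b.
exact: homogeneous_scale (homogeneous_coord a b).
Qed.

Lemma homogeneousX e F m : homogeneous_fun e F ->
  homogeneous_fun (fun k => m * e k)%N (fun v => F v ^+ m).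
Proof.
move=> hF; elim: m => [|m IHm].
  by apply: homogeneous_ext (homogeneous_const 1) => // v; rewrite expr0.
by apply: homogeneous_ext (homogeneousM hF IHm) => [k|v]; rewrite ?mulSn ?exprS.
Qed.

Variable lead : 'I_n.-1 -> factors -> K.
Hypothesis lead_hom : forall k, homogeneous_fun (fun l => (l == k) : nat) (lead k).

Lemma homogeneous_lead_prod e : homogeneous_fun e (fun v => \prod_k lead k v ^+ e k).
Proof.
have gen (r : seq 'I_n.-1) : homogeneous_fun (fun l => \sum_(k <- r) e k * (l == k))%N
    (fun v => \prod_(k <- r) lead k v ^+ e k).
  elim: r => [|k r IHr].
    by apply: homogeneous_ext (homogeneous_const 1) => [l|v]; rewrite big_nil.
  by apply: homogeneous_ext (homogeneousM (homogeneousX (e k) (lead_hom k)) IHr) => [l|v]; rewrite big_cons.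
apply: homogeneous_ext (gen (index_enum _)) => // l.
rewrite (bigD1 l) //= eqxx muln1 big1 ?addn0 // => k kl.
by rewrite eq_sym (negbTE kl) muln0.
Qed.

(** The numerator [H] has the multidegree of the denominator, so these are the regular functions of
    degree 0 where no lead vanishes. Equal degrees are also what makes sums homogeneous over a
    common denominator. *)
Definition lead_fraction F : Prop := exists e H, homogeneous_fun e H /\
  forall v, (forall k, lead k v != 0) -> F v * \prod_k lead k v ^+ e k = H v.

Lemma lead_fraction_subring : fun_subring lead_fraction.
Proof.
split=> [c|F G [e [H [hH HE]]] [e' [H' [hH' HE']]]|F G [e [H [hH HE]]] [e' [H' [hH' HE']]]].
- exists (fun=> 0%N), (fun=> c); split=> [|v _]; first exact: homogeneous_const.
  by rewrite big1 ?mulr1.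
- exists (fun k => e k + e' k)%N, (fun v => H v * \prod_k lead k v ^+ e' k + (\prod_k lead k v ^+ e k) * H' v).
  split.
    by apply: homogeneousD; apply: homogeneousM => //; apply: homogeneous_lead_prod.
  move=> v nz; under eq_bigr do rewrite exprD.
  by rewrite big_split /= -HE // -HE' //; ring.
- exists (fun k => e k + e' k)%N, (fun v => H v * H' v); split; first exact: homogeneousM.
  move=> v nz; under eq_bigr do rewrite exprD.
  by rewrite big_split /= -HE // -HE' //; ring.
Qed.

Lemma lead_fraction_div k F : homogeneous_fun (fun l => (l == k) : nat) F ->
  lead_fraction (fun v => F v / lead k v).
Proof.
move=> hF; exists (fun l => (l == k) : nat), F; split=> // v nz.
rewrite (bigD1 k) //= eqxx expr1 big1 ?mulr1; first by rewrite divfK.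
by move=> l /negbTE ->; rewrite expr0.
Qed.

End HomogeneousFunctions.

Lemma compound_neq0 (K : fieldType) n i (A : 'M[K]_n) : (i <= n)%N -> A \in unitmx ->
  compound i A != 0.
Proof.
move=> le uA; have [I _] := mi_initial le; have [b] := compound_row_neq0 (enum_rank I) uA.
by apply: contra => /eqP ->; rewrite mxE.
Qed.

Lemma exponent_leq n (k : 'I_n.-1) : (k.+1 <= n)%N.
Proof. by apply: leq_trans (ltn_ord k) (leq_pred n). Qed.

Section Closure.
Variables (K : fieldType) (n : nat).
Implicit Types (v : factors K n) (x : quadric_tuple K n).

Lemma complete_quadrics_proj x : complete_quadrics K n x -> proj_prod x.
Proof.
move=> xX; apply: xX => [|_ [A [sA uA] <-] k].
  exists set0; split=> //; apply/seteqP; split=> y; first by split.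
  by case.
split; first by rewrite dim_vline (compound_neq0 (exponent_leq k) uA).
by move=> M /vlineP[c ->]; rewrite linearZ /= -compound_tr sA.
Qed.

(** The zero set of [H] is a closed set containing the smooth quadrics. The scalars [c] appear
    because vanishing at a point is tested on all representatives. *)
Lemma complete_quadrics_vanish e (H : factors K n -> K) x v : homogeneous_fun e H ->
  complete_quadrics K n x -> (forall k, v k != 0 /\ x k = <[v k]>%VS) ->
  (forall A (c : 'I_n.-1 -> K), A^T = A -> A \in unitmx -> (forall k, c k != 0) ->
     H (fun k => c k *: compound k.+1 A) = 0) -> H v = 0.
Proof.
move=> [f [hf fE]] xX xv H0; rewrite -fE.
pose Z : set (quadric_tuple K n) := [set y | proj_prod y /\ forall g, [set f] g -> vanishes_at g y].
suff [_ /(_ f erefl v xv)] : Z x by [].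
apply: xX.
  by exists [set f]; split=> [g ->|//]; exists e.
move=> _ [A [sA uA] <-]; split.
  move=> k; split; first by rewrite dim_vline (compound_neq0 (exponent_leq k) uA).
  by move=> M /vlineP[c ->]; rewrite linearZ /= -compound_tr sA.
move=> g -> u uP; rewrite fE.
have uc k : exists c, u k = c *: compound k.+1 A.
  have [_ e2] := uP k; have : u k \in compound_point A k by rewrite e2 memv_line.
  by move=> /vlineP.
have [c cP] := fin_all_exists uc.
have -> : u = fun k => c k *: compound k.+1 A by apply: functional_extensionality_dep.
apply: H0 => // k; have [nz _] := uP k; apply: contra nz => /eqP e0.
by rewrite cP e0 scale0r.
Qed.

Lemma complete_quadrics_fraction_vanish lead F x v :
  (forall k, homogeneous_fun (fun l => (l == k) : nat) (lead k)) -> lead_fraction lead F ->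
  complete_quadrics K n x -> (forall k, v k != 0 /\ x k = <[v k]>%VS) ->
  (forall k, lead k v != 0) ->
  (forall A (c : 'I_n.-1 -> K), A^T = A -> A \in unitmx -> (forall k, c k != 0) ->
     let u := fun k => c k *: compound k.+1 A in
     (forall k, lead k u != 0) -> F u = 0) -> F v = 0.
Proof.
move=> hlead [e [H [hH HE]]] xX xv nz F0.
have prod_nz u (d : 'I_n.-1 -> nat) : (forall k, lead k u != 0) -> \prod_k lead k u ^+ d k != 0.
  by move=> nzu; rewrite prodf_seq_neq0; apply/allP => k _ /=; rewrite expf_neq0.
(* One extra factor of each lead makes the polynomial vanish also at smooth quadrics outside the
   chart, where nothing is known about [F]. *)
have hH' := homogeneousM hH (homogeneous_lead_prod hlead (fun=> 1%N)).
have := complete_quadrics_vanish hH' xX xv _; rewrite -HE //.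
move=> /(_ _)/eqP; rewrite !mulf_eq0 (negbTE (prod_nz _ _ nz)) (negbTE (prod_nz _ _ nz)) !orbF.
move=> h; apply/eqP; apply: h => A c sA uA c0; set u := fun k => _.
case: (boolP [forall k, lead k u != 0]) => [/forallP nzu|/forallPn[k]].
  by rewrite -HE // (F0 A c sA uA c0 nzu) !mul0r.
by rewrite negbK => /eqP e0; rewrite (bigD1 k) //= e0 expr1 mul0r mulr0.
Qed.

End Closure.

(** * Generic translates with nonzero leading coefficients *)

Section Generic.
Variables (K : numClosedFieldType) (n : nat).

Definition top_index (k : 'I_n.-1) : multi_index n k.+1 := sval (cid (mi_initial (exponent_leq k))).

Lemma top_indexE k p : tnth (val (top_index k)) p = p :> nat.
Proof. exact: (svalP (cid (mi_initial (exponent_leq k)))). Qed.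

Definition top_lead (h : 'M[K]_n) (k : 'I_n.-1) (v : factors K n) : K :=
  (compound k.+1 h *m v k *m (compound k.+1 h)^T)
    (enum_rank (top_index k)) (enum_rank (top_index k)).

(** This replaces polynomials in the matrix entries: a line through two points suffices to see that
    a product of nonzero functions is nonzero. *)
Definition polynomial_on_lines (F : 'M[K]_n -> K) : Prop :=
  forall S T, exists p : {poly K}, forall t, F (S + t *: T) = p.[t].

Lemma polynomial_on_lines_subring : fun_subring polynomial_on_lines.
Proof.
split=> [c|F G hF hG|F G hF hG] S T.
- by exists c%:P => t; rewrite hornerC.
- have [p pE] := hF S T; have [q qE] := hG S T.
  by exists (p + q) => t; rewrite hornerD pE qE.
- have [p pE] := hF S T; have [q qE] := hG S T.
  by exists (p * q) => t; rewrite hornerM pE qE.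
Qed.

Lemma polynomial_on_lines_id : fsub_mx polynomial_on_lines id.
Proof.
move=> i j S T; exists ((S i j)%:P + (T i j)%:P * 'X) => t.
by rewrite hornerD hornerM !hornerC hornerX !mxE mulrC.
Qed.

Lemma poly_eq0_of_roots (p : {poly K}) : (forall t, t != 0 -> p.[t] = 0) -> p = 0.
Proof.
move=> h; apply/eqP; apply: contraT => p0.
(* Characteristic 0 supplies more distinct nonzero roots than the degree allows. *)
pose rs : seq K := [seq i.+1%:R | i <- iota 0 (size p)].
have := @max_poly_roots _ p rs p0; rewrite size_map size_iota ltnn; apply.
  by apply/allP => _ /mapP[i _ ->]; apply/rootP/h; rewrite pnatr_eq0.
by rewrite map_inj_uniq ?iota_uniq // => i j /eqP; rewrite eqr_nat => /eqP[].
Qed.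

Lemma polynomial_on_lines_mul F G S T : polynomial_on_lines F -> polynomial_on_lines G ->
  F S != 0 -> G T != 0 -> exists S', F S' * G S' != 0.
Proof.
move=> hF hG FS GT; have [p pE] := hF S (T - S); have [q qE] := hG S (T - S).
apply: contrapT => h; have pq0 : p * q = 0.
  apply: poly_eq0_of_roots => t _; rewrite hornerM -pE -qE.
  by apply/eqP/negPn/negP => nz; apply: h; exists (S + t *: (T - S)).
move/eqP: pq0; rewrite mulf_eq0 => /orP[] /eqP e0.
  by move: (pE 0); rewrite scale0r addr0 e0 horner0 => e; rewrite e eqxx in FS.
by move: (qE 1); rewrite scale1r addrC subrK e0 horner0 => e; rewrite e eqxx in GT.
Qed.

Lemma polynomial_on_lines_common (I : eqType) (r : seq I) (F : I -> 'M[K]_n -> K) :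
  (forall i, polynomial_on_lines (F i)) -> (forall i, exists S, F i S != 0) ->
  exists S, forall i, i \in r -> F i S != 0.
Proof.
move=> hF nz; suff [S] : exists S, \prod_(i <- r) F i S != 0.
  by rewrite prodf_seq_neq0 => /allP h; exists S => i /h.
elim: r => [|i r [S nzS]]; first by exists 0; rewrite big_nil oner_eq0.
have [T nzT] := nz i.
have hP : polynomial_on_lines (fun S => \prod_(i <- r) F i S).
  exact: (fsub_prod polynomial_on_lines_subring).
have [S' nz'] := polynomial_on_lines_mul (hF i) hP nzT nzS.
by exists S'; rewrite big_cons.
Qed.

Lemma minor_map_conj i (S : 'M[K]_n) (I J : multi_index n i) :
  minor (map_mx Num.conj S) I J = (minor S I J)^*.
Proof. by rewrite /minor -det_map_mx; congr (\det _); apply/matrixP => p q; rewrite !mxE. Qed.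

(** Multiplication by [Q] moves an arbitrary column [J] of a compound to the leading position, so
    that it is seen by [top_lead]. *)
Lemma minor_select k (J : multi_index n (k : 'I_n.-1).+1) :
  exists Q : 'M[K]_n, forall I, minor Q I (top_index k) = (I == J)%:R.
Proof.
exists (\matrix_(x, y) if insub (val y) is Some p then (x == tnth (val J) p)%:R else 0) => I.
rewrite -(minor1 K I J); congr (\det _); apply/matrixP => p q.
by rewrite !mxE /= top_indexE valK.
Qed.

(* Otherwise the linear form u |-> sum of conj (v k) * u k vanishes on every
   compound of S S^T, hence at v, where it is a sum of squared norms. *)
Lemma exists_top_lead x v k : complete_quadrics K n x ->
  (forall k, v k != 0 /\ x k = <[v k]>%VS) -> exists h, top_lead h k v != 0.
Proof.
move=> xX xv; apply: contrapT => h0.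
have {}h0 h : top_lead h k v = 0.
  by apply/eqP/negPn/negP => nz; apply: h0; exists h.
pose M := v k; pose c : 'M[K]_(ext_dim n k.+1) := map_mx Num.conj M.
have : \sum_a \sum_b c a b * v k a b = 0.
  apply: (complete_quadrics_vanish (homogeneous_linear c) xX xv) => A e sA uA _.
  have [S AS] := sym_square_root sA uA; rewrite AS compoundM compound_tr.
  (* For [A = S S^T] the form is a sum over the columns of the compound of [S]: each term is the
     conjugate of the form [M] evaluated at a conjugated column, and such a value is a
     [top_lead]. *)
  transitivity (e k * \sum_j (\sum_a \sum_b (compound k.+1 S a j)^* * M a b * (compound k.+1 S b j)^*)^*).
    rewrite big_distrr /=.
    transitivity (\sum_j \sum_a \sum_b c a b * (e k * (compound k.+1 S a j * compound k.+1 S b j))).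
      rewrite [RHS]exchange_big; apply: eq_bigr => a _; rewrite [RHS]exchange_big.
      apply: eq_bigr => b _; rewrite !mxE !big_distrr; apply: eq_bigr => j _.
      by rewrite /= !mxE.
    apply: eq_bigr => j _; rewrite rmorph_sum big_distrr; apply: eq_bigr => a _.
    rewrite rmorph_sum big_distrr; apply: eq_bigr => b _; rewrite /= !rmorphM /= !conjCK !mxE.
    by ring.
  rewrite big1 ?mulr0 // => j _; apply/eqP; rewrite conjC_eq0; apply/eqP.
  have [Q QE] := minor_select (enum_val j).
  rewrite -[RHS](h0 (map_mx Num.conj S *m Q)^T) /top_lead.
  rewrite (@conj_compoundE _ _ _ _ _ (fun I J => M (enum_rank I) (enum_rank J))); last first.
    by move=> a b; rewrite !enum_valK.
  have mE I : minor (map_mx Num.conj S *m Q)^T (top_index k) I = (minor S I (enum_val j))^*.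
    rewrite minor_tr minorM (bigD1 (enum_val j)) //= big1 ?addr0 => [|J /negbTE JI].
      by rewrite QE eqxx mulr1 minor_map_conj.
    by rewrite QE JI mulr0.
  rewrite enum_rankK sum_multi_index; apply: eq_bigr => a _.
  rewrite sum_multi_index; apply: eq_bigr => b _.
  by rewrite !mE !enum_valK !compoundE.
move=> s0; have [nz _] := xv k; move/negP: nz; apply; apply/eqP/matrixP => a b.
have pos a' b' : 0 <= c a' b' * v k a' b'.
  by rewrite mxE mulrC -normCK exprn_ge0.
have /psumr_eq0P/(_ a isT) := s0; rewrite mxE.
move=> /(_ (fun a' _ => sumr_ge0 _ (fun b' _ => pos a' b')))/psumr_eq0P/(_ b isT).
move=> /(_ (fun b' _ => pos a b'))/eqP.
by rewrite mxE mulrC mul_conjC_eq0 => /eqP.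
Qed.

Lemma exists_top_leads x v : complete_quadrics K n x ->
  (forall k, v k != 0 /\ x k = <[v k]>%VS) ->
  exists2 h, h \in unitmx & forall k, top_lead h k v != 0.
Proof.
move=> xX xv; have PL := polynomial_on_lines_subring.
(* [None] adds the determinant to the list, so that the common point is invertible. *)
pose F (o : option 'I_n.-1) h := if o is Some k then top_lead h k v else \det h.
have [||h hP] := @polynomial_on_lines_common _ (enum {: option 'I_n.-1}) F.
- case=> [k|]; last exact: fsub_det PL _ _ polynomial_on_lines_id.
  have hc := fsub_compound PL (i := k.+1) polynomial_on_lines_id.
  apply: (fsub_mulmx PL (fsub_mulmx PL hc (fsub_const_mx PL _)) (fsub_trmx hc)).
- case=> [k|]; first exact: exists_top_lead xX xv.
  by exists 1%:M; rewrite /F det1 oner_eq0.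
exists h; first by rewrite unitmxE unitfE; apply: (hP None); rewrite mem_enum.
by move=> k; apply: (hP (Some k)); rewrite mem_enum.
Qed.

End Generic.

(** * The chart on which the factors of [L D L^T] are regular functions *)

Section Chart.
Variables (K : numClosedFieldType) (n : nat).

Lemma mi_step (k : 'I_n.-1) (j : nat) : (k <= j < n)%N ->
  exists I : multi_index n k.+1, forall q : 'I_k.+1,
    tnth (val I) q = (if q < k then q : nat else j)%N :> nat.
Proof.
move=> /andP[kj jn].
have lt (q : 'I_k.+1) : ((if q < k then q : nat else j) < n)%N.
  by case: ifP => // qk; apply: ltn_trans qk (leq_ltn_trans kj jn).
have [p q pq|I IE] := @mi_of_increasing n k.+1 (fun q => Ordinal (lt q)).
  have pk : (p < k)%N by apply: leq_trans pq _; rewrite -ltnS.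
  by rewrite /= pk; case: ifP => // _; apply: leq_trans kj.
by exists I => q; rewrite IE.
Qed.

(* {0, ..., k-1, j}; outside the range of mi_step, an arbitrary value. *)
Definition step_index (k : 'I_n.-1) (j : nat) : multi_index n k.+1 :=
  odflt (top_index k) [pick I : multi_index n k.+1 |
    [forall q : 'I_k.+1, tnth (val I) q == (if q < k then q : nat else j)%N :> nat]].

Lemma step_indexE (k : 'I_n.-1) (j : nat) (q : 'I_k.+1) : (k <= j < n)%N ->
  tnth (val (step_index k j)) q = (if q < k then q : nat else j)%N :> nat.
Proof.
move=> kjn; rewrite /step_index; case: pickP => [I /forallP/(_ q)/eqP //|h].
have [I IE] := mi_step kjn; have /negbT/negP[] := h I.
by apply/forallP => p; rewrite IE.
Qed.

Lemma minor_lower_top (L : 'M[K]_n) (k : 'I_n.-1) I : lower_mx L ->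
  minor L (top_index k) I != 0 -> I = top_index k.
Proof.
move=> lL /(minor_lower lL)/orP[|/eqP//]; rewrite ltnNge => /negP[].
by apply: leq_sum => p _; rewrite [X in (X <= _)%N](top_indexE p) mi_geq.
Qed.

Lemma minor_lower_top_top (L : 'M[K]_n) (k : 'I_n.-1) : lower_mx L -> (forall i, L i i = 1) ->
  minor L (top_index k) (top_index k) = 1.
Proof.
move=> lL L1; rewrite /minor det_lower; first by apply: big1 => p _; rewrite mxE L1.
by move=> p q pq; rewrite mxE lL // !top_indexE.
Qed.

(** This reads the entries of a unipotent [L] off its compounds: the selected submatrix is
    triangular with diagonal 1, ..., 1, [L x y]. *)
Lemma minor_lower_step (L : 'M[K]_n) (k : 'I_n.-1) (x y : 'I_n) : lower_mx L ->
  (forall i, L i i = 1) -> y = k :> nat -> (k <= x)%N ->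
  minor L (step_index k x) (top_index k) = L x y.
Proof.
move=> lL L1 yk kx; have kxn : (k <= x < n)%N by rewrite kx ltn_ord.
rewrite /minor det_lower.
  rewrite big_ord_recr /= big1 => [|p _].
    rewrite mul1r mxE; congr (L _ _); apply: val_inj; last by rewrite /= top_indexE yk.
    by rewrite /= step_indexE //= ltnn.
  rewrite mxE (_ : tnth _ _ = tnth (val (top_index k)) (widen_ord (leqnSn k) p)) ?L1 //.
  by apply: val_inj; rewrite /= step_indexE // top_indexE /= ltn_ord.
move=> p q pq; rewrite mxE lL // top_indexE step_indexE //.
by rewrite (leq_trans pq) // -ltnS.
Qed.

(* A lower triangular congruence reduces A to the matrix of an involution; the
   nonzero leading minors force it to preserve every initial segment. *)
Lemma LDL_decomposition (A : 'M[K]_n) : A^T = A -> A \in unitmx ->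
  (forall k, minor A (top_index k) (top_index k) != 0) ->
  exists (L : 'M[K]_n) (d : 'rV[K]_n), [/\ lower_mx L, forall i, L i i = 1, forall i, d 0 i != 0 &
    A = L *m diag_mx d *m L^T].
Proof.
move=> sA uA lead; have [|s [si [b [lb ub _ sE]]]] := @congruent_involution K n (fun=> 0%N) A sA uA.
  by move=> i j; rewrite eqxx.
have sle (x : 'I_n) : (s x <= x)%N.
  case: (ltnP x n.-1) => xn; last first.
    by apply: leq_trans xn; rewrite -ltnS prednK // (leq_ltn_trans _ (ltn_ord x)).
  have [k kx] : exists k : 'I_n.-1, k = x :> nat by exists (Ordinal xn).
  have : minor (function_mx K s) (top_index k) (top_index k) != 0.
    rewrite sE minorM (bigD1 (top_index k)) //= big1 ?addr0 => [|I Itop]; last first.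
      rewrite minor_tr; case: (eqVneq (minor b (top_index k) I) 0) => [->|nz]; first by rewrite mulr0.
      by rewrite (minor_lower_top lb nz) eqxx in Itop.
    rewrite minor_tr minorM (bigD1 (top_index k)) //= big1 ?addr0 => [|I Itop]; last first.
      case: (eqVneq (minor b (top_index k) I) 0) => [->|nz]; first by rewrite mul0r.
      by rewrite (minor_lower_top lb nz) eqxx in Itop.
    have nzb := minor_unit_diag (top_index k) lb (lower_mxV lb ub) (mulmxV ub).
    exact: (mulf_neq0 (mulf_neq0 nzb (lead k)) nzb).
  move=> /minor_function defs; have memtop (y : 'I_n) : (y \in mset (top_index k)) = (y <= x)%N.
    apply/idP/idP => [/mi_tnthP[p ->]|yx]; first by rewrite top_indexE -kx -ltnS.
    have yk : (y < k.+1)%N by rewrite ltnS kx.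
    have -> : y = tnth (val (top_index k)) (Ordinal yk).
      by apply: val_inj; rewrite /= top_indexE.
    exact: mi_tnth.
  by rewrite -memtop defs imset_f // memtop.
have s_id x : s x = x.
  by apply/val_inj/eqP; rewrite eqn_leq sle -{1}(si x) sle.
have bAb : b *m A *m b^T = 1%:M.
  by rewrite -sE; apply/matrixP => i j; rewrite !mxE s_id.
have lC := lower_mxV lb ub; have uC : invmx b \in unitmx by rewrite unitmx_inv.
(* Here [A = C C^T]; moving the squared diagonal of [C] into the middle factor makes [L]
   unipotent. *)
set C := invmx b in lC uC; have C0 i := lower_diag_neq0 i lC uC.
have AC : A = C *m C^T.
  rewrite -[LHS]mul1mx -(mulVmx ub) -[LHS]mulmx1 -[X in _ *m X]trmx1 -(mulVmx ub) trmx_mul.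
  by rewrite -/C !mulmxA -(mulmxA C b) -(mulmxA C (b *m A)) bAb mulmx1.
exists (C *m diag_mx (\row_i (C i i)^-1)), (\row_i (C i i ^+ 2)); split.
- by move=> i j ij; rewrite mul_mx_diag !mxE lC // mul0r.
- by move=> i; rewrite mul_mx_diag !mxE divff.
- by move=> i; rewrite mxE expf_neq0.
rewrite AC trmx_mul tr_diag_mx !mulmxA; congr (_ *m _).
apply/matrixP => i j; rewrite !mul_mx_diag !mxE -mulrA -mulrA.
by rewrite [X in _ * X](_ : _ = 1) ?mulr1 //; field.
Qed.

Variable h : 'M[K]_n.
Implicit Types (u v : factors K n) (k : 'I_n.-1).

Let topr k := enum_rank (top_index k).

Definition chart_form k u : 'M[K]_(ext_dim n k.+1) :=
  (top_lead h k u)^-1 *: (compound k.+1 h *m u k *m (compound k.+1 h)^T).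

(** For a smooth quadric these are the entries of [L], as ratios of minors in the leading columns.
    The last column has no exponent, but also no entry below the diagonal. *)
Definition chart_lower u : 'M[K]_n := \matrix_(x, y)
  if (insub (val y) : option 'I_n.-1) is Some k then
    if (k < x)%N then chart_form k u (enum_rank (step_index k x)) (topr k) else (x == y)%:R
  else (x == y)%:R.

(** The adjugate is the inverse here, since [chart_lower u] has determinant 1, and it keeps the
    entries fractions in the leads. *)
Definition chart_diag k u : 'M[K]_(ext_dim n k.+1) :=
  compound k.+1 (\adj (chart_lower u)) *m chart_form k u *m (compound k.+1 (\adj (chart_lower u)))^T.

(** The index sets {0, ..., l-1, l+1} and {0, ..., l} differ in one element, so the normalized
    diagonal entry is [d_(l+1) / d_l]. *)
Definition chart_ratio (l : nat) u : K :=
  if (insub l : option 'I_n.-1) is Some k then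
    chart_diag k u (enum_rank (step_index k l.+1)) (enum_rank (step_index k l.+1)) else 1.

Lemma chart_lower_lower u : lower_mx (chart_lower u).
Proof.
move=> x y xy; rewrite mxE (_ : x == y = false); last by apply/negbTE; rewrite neq_ltn xy.
case: insubP => // k _ ky; case: ifP => // kx.
by have := ltn_trans kx xy; rewrite [X in (X < _)%N]ky ltnn.
Qed.

Lemma chart_lower_diag u x : chart_lower u x x = 1.
Proof. by rewrite mxE eqxx; case: insubP => // k _ kx; rewrite [X in (X < _)%N]kx ltnn. Qed.

Lemma det_chart_lower u : \det (chart_lower u) = 1.
Proof.
rewrite det_lower; last exact: chart_lower_lower.
by apply: big1 => x _; apply: chart_lower_diag.
Qed.

Lemma adj_chart_lower u : \adj (chart_lower u) *m chart_lower u = 1%:M.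
Proof. by rewrite mul_adj_mx det_chart_lower. Qed.

Lemma homogeneous_conj_entry k a b :
  homogeneous_fun (fun l => (l == k) : nat)
    (fun u : factors K n => (compound k.+1 h *m u k *m (compound k.+1 h)^T) a b).
Proof.
pose c : 'M[K]_(ext_dim n k.+1) := \matrix_(i, j) (compound k.+1 h a i * compound k.+1 h b j).
apply: homogeneous_ext (homogeneous_linear c) => // u; rewrite mxE exchange_big.
apply: eq_bigr => j _; rewrite mxE big_distrl; apply: eq_bigr => i _.
by rewrite /c [c i j]mxE [(compound _ _)^T _ _]mxE mulrAC.
Qed.

Lemma homogeneous_top_lead k : homogeneous_fun (fun l => (l == k) : nat) (top_lead h k).
Proof. exact: homogeneous_conj_entry. Qed.

Let frac := lead_fraction (top_lead h).
Let frac_sub : fun_subring frac := lead_fraction_subring homogeneous_top_lead.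

Lemma chart_form_fraction k : fsub_mx frac (chart_form k).
Proof.
move=> a b; apply: fsub_ext (lead_fraction_div _ (homogeneous_conj_entry (k := k) a b)) => u.
by rewrite [RHS]mxE mulrC.
Qed.

Lemma chart_lower_fraction : fsub_mx frac chart_lower.
Proof.
have [Cc _ _] := frac_sub; move=> x y.
case E: (insub (val y) : option 'I_n.-1) => [k|].
  case kx: (k < x)%N.
    apply: fsub_ext (chart_form_fraction (enum_rank (step_index k x)) (topr k)) => u.
    by rewrite [RHS]mxE E kx.
  by apply: fsub_ext (Cc (x == y)%:R) => u; rewrite mxE E kx.
by apply: fsub_ext (Cc (x == y)%:R) => u; rewrite mxE E.
Qed.

Lemma chart_diag_fraction k : fsub_mx frac (chart_diag k).
Proof.
have hc := fsub_compound frac_sub (i := k.+1) (fsub_adj frac_sub chart_lower_fraction).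
exact: (fsub_mulmx frac_sub (fsub_mulmx frac_sub hc (chart_form_fraction (k := k))) (fsub_trmx hc)).
Qed.

Lemma chart_ratio_fraction l : frac (chart_ratio l).
Proof.
have [Cc _ _] := frac_sub; case E: (insub l : option 'I_n.-1) => [k|].
  apply: fsub_ext (chart_diag_fraction (enum_rank (step_index k l.+1)) (enum_rank (step_index k l.+1))) => u.
  by rewrite /chart_ratio E.
by apply: fsub_ext (Cc 1) => u; rewrite /chart_ratio E.
Qed.

Lemma chart_smooth (A : 'M[K]_n) (c : 'I_n.-1 -> K) : h \in unitmx -> A^T = A -> A \in unitmx ->
  (forall k, c k != 0) -> let u := fun k => c k *: compound k.+1 A in
  (forall k, top_lead h k u != 0) -> forall k a b,
  chart_diag k u a b = (a == b)%:R * ratio_product (chart_ratio^~ u) (enum_val a : multi_index n k.+1).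
Proof.
move=> uh sA uA c0 u lead.
pose A' := h *m A *m h^T.
have formE k : compound k.+1 h *m u k *m (compound k.+1 h)^T = c k *: compound k.+1 A'.
  by rewrite /u /A' !compoundM compound_tr -scalemxAr -scalemxAl.
have leadE k : top_lead h k u = c k * minor A' (top_index k) (top_index k).
  by rewrite /top_lead formE mxE compoundE enum_rankK.
have [||k|L [d [lL L1 d0 A'E]]] := @LDL_decomposition A'.
- by rewrite /A' !trmx_mul trmxK sA mulmxA.
- by rewrite /A' !unitmx_mul unitmx_tr uh uA.
- by have := lead k; rewrite leadE mulf_eq0 negb_or => /andP[].
pose P i (I : multi_index n i) := \prod_p d 0 (tnth (val I) p).
have minorA' k I J : minor A' I J = \sum_M minor L I M * P k.+1 M * minor L J M.
  rewrite A'E minorM; apply: eq_bigr => M _; rewrite minor_tr; congr (_ * _).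
  rewrite minorM (bigD1 M) //= big1 ?addr0 => [|M' /negbTE M'M].
    by rewrite minor_diag eqxx mul1r.
  by rewrite minor_diag M'M mul0r mulr0.
(* In the leading columns only one term of the expansion survives, so dividing by the leading minor
   leaves a minor of [L] alone. *)
have topA' k I : minor A' I (top_index k) = minor L I (top_index k) * P k.+1 (top_index k).
  rewrite minorA' (bigD1 (top_index k)) //= minor_lower_top_top // mulr1 big1 ?addr0 // => M Mtop.
  case: (eqVneq (minor L (top_index k) M) 0) => [->|nz]; first by rewrite mulr0.
  by rewrite (minor_lower_top lL nz) eqxx in Mtop.
have P0 i I : P i I != 0 by rewrite prodf_seq_neq0; apply/allP => p _ /=.
have leadE' k : top_lead h k u = c k * P k.+1 (top_index k).
  by rewrite leadE topA' minor_lower_top_top // mul1r.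
have cformE k : chart_form k u = (P k.+1 (top_index k))^-1 *: compound k.+1 A'.
  rewrite /chart_form formE leadE' scalerA invfM mulrAC mulVf ?mul1r //.
have lowerE : chart_lower u = L.
  apply/matrixP => x y; rewrite mxE; case: insubP => [k _ /= ky|].
    case: ltnP => kx.
      rewrite cformE mxE compoundE !enum_rankK topA' mulrCA mulVf // mulr1.
      by apply: minor_lower_step => //; apply: ltnW.
    case: (altP (x =P y)) => [->|xy]; first by rewrite L1.
    rewrite lL // ltn_neqAle; apply/andP; split; first by rewrite -val_eqE in xy.
    by rewrite -ky.
  rewrite -leqNgt => ny; case: (altP (x =P y)) => [->|xy]; first by rewrite L1.
  rewrite lL // ltn_neqAle; apply/andP; split; first by rewrite -val_eqE in xy.
  by apply: leq_trans ny; rewrite -ltnS prednK // (leq_ltn_trans _ (ltn_ord x)).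
have diagE k a b : chart_diag k u a b =
    (a == b)%:R * (P k.+1 (enum_val a) / P k.+1 (top_index k)).
  have LL := adj_chart_lower u; rewrite lowerE in LL.
  rewrite /chart_diag cformE lowerE -scalemxAr -scalemxAl A'E !compoundM compound_tr.
  rewrite !mulmxA -compoundM LL compound1 mul1mx -mulmxA -trmx_mul -compoundM LL compound1 trmx1 mulmx1.
  by rewrite mxE compoundE minor_diag (inj_eq enum_val_inj) mulrCA; congr (_ * _); apply: mulrC.
pose dn (l : nat) : K := if (insub l : option 'I_n) is Some x then d 0 x else 1.
have dnE (x : 'I_n) : dn x = d 0 x by rewrite /dn valK.
have dn0 l : dn l != 0 by rewrite /dn; case: insubP => // _; rewrite oner_eq0.
have ratioE l : (l.+1 < n)%N -> chart_ratio l u = dn l.+1 / dn l.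
  move=> ln; have ln' : (l < n.-1)%N by rewrite -ltnS prednK // (leq_ltn_trans _ ln).
  rewrite /chart_ratio; case: insubP => [k _ /= kl|]; last by rewrite ln'.
  have kln : (k <= l.+1 < n)%N by rewrite ln kl leqnSn.
  rewrite diagE eqxx mul1r enum_rankK /P !big_ord_recr /= invfM mulrACA [X in X * _](_ : _ = 1) ?mul1r.
    by rewrite -!dnE step_indexE // top_indexE /= ltnn kl.
  rewrite -prodf_div big1 // => p _; rewrite -!dnE step_indexE // top_indexE /= ltn_ord.
  by rewrite divff.
move=> k a b; rewrite diagE; congr (_ * _).
set I := enum_val a; rewrite /P -prodf_div; apply: eq_bigr => p _.
have telescope q m : (q <= m < n)%N -> dn m / dn q = \prod_(q <= l < m) chart_ratio l u.
  move=> /andP[]; rewrite leq_eqVlt => /orP[/eqP->|qm] mn; first by rewrite big_geq // divff.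
  rewrite (telescope_prodf_eq dn) // => l /andP[_ lm].
  by rewrite ratioE // (leq_ltn_trans lm).
by rewrite -!dnE top_indexE telescope // mi_geq ltn_ord.
Qed.

Lemma complete_quadrics_chart x v : h \in unitmx -> complete_quadrics K n x ->
  (forall k, v k != 0 /\ x k = <[v k]>%VS) -> (forall k, top_lead h k v != 0) ->
  exists g z, g \in unitmx /\ forall k, exists2 c, c != 0 &
    compound k.+1 g *m v k *m (compound k.+1 g)^T =
    c *: \matrix_(a, b) ((a == b)%:R * ratio_product z (enum_val a : multi_index n k.+1)).
Proof.
move=> uh xX xv lead; exists (\adj (chart_lower v) *m h), (chart_ratio^~ v); split.
  by rewrite unitmx_mul uh andbT; have [] := mulmx1_unit (adj_chart_lower v).
move=> k; exists (top_lead h k v) => //.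
transitivity (top_lead h k v *: chart_diag k v).
  rewrite /chart_diag /chart_form compoundM trmx_mul -scalemxAr -scalemxAl scalerA divff //.
  by rewrite scale1r !mulmxA.
congr (_ *: _); apply/matrixP => a b; apply/eqP; rewrite -subr_eq0 [X in _ - X]mxE; apply/eqP.
have [Cc CD CM] := frac_sub.
pose F u := chart_diag k u a b - (a == b)%:R * ratio_product (chart_ratio^~ u) (enum_val a : multi_index n k.+1).
have hF : frac F.
  apply: fsub_sub frac_sub _ _ (chart_diag_fraction a b) _.
  apply: CM; first exact: Cc.
  apply: (fsub_prod frac_sub) => p; apply: (fsub_prod frac_sub) => l; exact: chart_ratio_fraction.
apply: (complete_quadrics_fraction_vanish homogeneous_top_lead hF xX xv lead).
move=> A c sA uA c0 u nz; apply/eqP; rewrite subr_eq0; apply/eqP.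
exact: chart_smooth.
Qed.

End Chart.

(** * Weighted limits belong to the closure *)

Section Degenerations.
Variables (K : fieldType) (n : nat).
Implicit Types (A : 'M[K]_n) (w : 'I_n -> nat).

Definition limit_point w A : quadric_tuple K n := fun k => <[limit_compound k.+1 w A]>%VS.

Lemma limit_compound_neq0 i w A : (i <= n)%N -> A \in unitmx -> limit_compound i w A != 0.
Proof.
move=> le uA; have [I0 _] := mi_initial le.
case: (@arg_minnP _ I0 predT (wsum w) isT) => I _ Imin.
have [J nz] := minor_row_neq0 I uA; apply: contra nz => /eqP/matrixP/(_ (enum_rank I) (enum_rank J)).
rewrite !mxE !enum_rankK; have -> : min_weight w I by apply/forallP => L; apply: Imin.
by move->.
Qed.

Lemma limit_compound_sym i w A : A^T = A -> block_supported w A ->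
  (limit_compound i w A)^T = limit_compound i w A.
Proof.
move=> sA wA; apply/matrixP => a b; rewrite !mxE -[in LHS]sA minor_tr.
case: (eqVneq (minor A (enum_val a) (enum_val b)) 0) => [->|nz]; first by rewrite !if_same.
congr (if _ then _ else _); apply/esym/min_weight_eq/(minor_wsum_eq _ nz) => x y nz'.
by apply/eqP; apply: contraNT nz' => /wA ->.
Qed.

Lemma minor_diag_mul i (d : 'rV[K]_n) A (I J : multi_index n i) :
  minor (diag_mx d *m A) I J = (\prod_p d 0 (tnth (val I) p)) * minor A I J.
Proof.
rewrite minorM (bigD1 I) //= big1 ?addr0 => [|L LI]; first by rewrite minor_diag eqxx mul1r.
by rewrite minor_diag eq_sym (negbTE LI) !mul0r.
Qed.

End Degenerations.

Lemma vline_scale (K : fieldType) (U : vectType K) (c : K) (u : U) :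
  c != 0 -> <[c *: u]>%VS = <[u]>%VS.
Proof.
move=> c0; apply/eqP; rewrite eqEsubv -!memvE; apply/andP; split; apply/vlineP; first by exists c.
by exists c^-1; rewrite scalerA mulVf // scale1r.
Qed.

Lemma limit_point_complete (K : numClosedFieldType) n (w : 'I_n -> nat) (A : 'M[K]_n) :
  A^T = A -> A \in unitmx -> block_supported w A -> complete_quadrics K n (limit_point w A).
Proof.
move=> sA uA wA Z [F [homF ->]] smoothF; split.
  move=> k; split; first by rewrite dim_vline limit_compound_neq0 // exponent_leq.
  by move=> M /vlineP[c ->]; rewrite linearZ /= limit_compound_sym.
move=> f Ff v xv.
have [c cP] : exists c : 'I_n.-1 -> K, forall k, v k = c k *: limit_compound k.+1 w A.
  apply: (fin_all_exists (P := fun k c => v k = c *: limit_compound k.+1 w A)) => k.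
  have [_ e] := xv k; apply/vlineP; rewrite -/(limit_point w A k) e; exact: memv_line.
have c0 k : c k != 0.
  by have [nz _] := xv k; apply: contra nz => /eqP e; rewrite cP e scale0r.
have [I0 I0P] : exists I0 : forall k : 'I_n.-1, multi_index n k.+1, forall k, min_weight w (I0 k).
  apply: (fin_all_exists (P := fun (k : 'I_n.-1) (I : multi_index n k.+1) => min_weight w I)) => k.
  have [T _] := mi_initial (exponent_leq k).
  case: (@arg_minnP _ T predT (wsum w) isT) => I _ Imin; exists I; apply/forallP => L; exact: Imin.
(* Exponents are counted from their minimum, so that the curve [V] passes through [v] itself at t =
   0. *)
pose expo (k : 'I_n.-1) (I : multi_index n k.+1) := (wsum w I - wsum w (I0 k))%N.
pose V t : factors K n := fun k => c k *: \matrix_(a, b)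
  (t ^+ expo k (enum_val a) * minor A (enum_val a) (enum_val b)).
have V0 : V 0 = v.
  apply: functional_extensionality_dep => k; rewrite /V cP; congr (_ *: _).
  apply/matrixP => a b; rewrite !mxE expr0n /expo subn_eq0.
  have -> : (wsum w (enum_val a) <= wsum w (I0 k))%N = min_weight w (enum_val a).
    apply/idP/forallP => [h L|]; last exact.
    by apply: leq_trans h _; have /forallP := I0P k; apply.
  by case: ifP; rewrite ?mul1r ?mul0r.
pose q (j : 'I_#|{: coord_index n}|) : {poly K} := let t := enum_val j in
  (c (tag t) * minor A (enum_val (tagged t).1) (enum_val (tagged t).2))%:P *
  'X^(expo (tag t) (enum_val (tagged t).1)).
have qE t j : (q j).[t] = coords (V t) j.
  rewrite /q hornerM hornerC hornerXn /coords; move: (enum_val j) => [k [a b]].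
  by rewrite [RHS]mxE [X in _ = _ * X]mxE -mulrA; congr (_ * _); apply: mulrC.
pose p := \sum_(m <- msupp f) (f@_m)%:P * \prod_j q j ^+ m j.
have pE t : p.[t] = f.@[coords (V t)].
  rewrite mevalE horner_sum; apply: eq_bigr => m _; rewrite hornerM hornerC horner_prod.
  by congr (_ * _); apply: eq_bigr => j _; rewrite horner_exp qE.
rewrite -V0 -pE (_ : p = 0) ?horner0 //; apply: poly_eq0_of_roots => t t0.
pose T : 'M[K]_n := diag_mx (\row_x t ^+ w x).
have TE i (I J : multi_index n i) : minor (T *m A) I J = t ^+ wsum w I * minor A I J.
  rewrite minor_diag_mul; congr (_ * _); rewrite /wsum -prodrXr.
  by apply: eq_bigr => x _; rewrite mxE.
have uT : T *m A \in unitmx.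
  rewrite unitmx_mul uA andbT unitmxE det_diag unitfE prodf_seq_neq0.
  by apply/allP => x _; rewrite mxE expf_neq0.
have smoothT : smooth_quadrics (compound_point (T *m A)).
  exists (T *m A) => //; split=> //.
  (* Scaling the rows alone preserves symmetry because [A] pairs only indices of equal weight. *)
  apply/matrixP => x y; rewrite !mul_diag_mx !mxE -[in LHS]sA mxE.
  by case: (eqVneq (w x) (w y)) => [-> //|/wA ->]; rewrite !mulr0.
rewrite pE; have [_ /(_ f Ff)] := smoothF _ smoothT; apply => k.
have VE : V t k = (c k / t ^+ wsum w (I0 k)) *: compound k.+1 (T *m A).
  apply/matrixP => a b; rewrite !mxE -/(minor (T *m A) _ _) TE /expo -mulrA; congr (_ * _).
  rewrite mulrA; congr (_ * _).
  have le : (wsum w (I0 k) <= wsum w (enum_val a))%N by have /forallP := I0P k; apply.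
  by rewrite -{2}(subnKC le) exprD mulKf // expf_neq0.
have e0 : c k / t ^+ wsum w (I0 k) != 0 by rewrite mulf_neq0 ?invr_neq0 ?expf_neq0.
by rewrite VE vline_scale // scaler_eq0 negb_or e0 compound_neq0 // exponent_leq.
Qed.

(** * Borel orbits *)

Section Orbits.
Variables (K : numClosedFieldType) (n : nat).
Hypothesis n_gt0 : (0 < n)%N.
Implicit Types (g h b : 'M[K]_n) (v : factors K n).

Definition line_tuple v : quadric_tuple K n := fun k => <[v k]>%VS.

Definition conj_factors h v : factors K n :=
  fun k => compound k.+1 h *m v k *m (compound k.+1 h)^T.

Lemma conj_factorsM g h v : conj_factors g (conj_factors h v) = conj_factors (g *m h) v.
Proof.
by apply: functional_extensionality_dep => k; rewrite /conj_factors compoundM trmx_mul !mulmxA.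
Qed.

Lemma conj_factors1 v : conj_factors 1%:M v = v.
Proof.
by apply: functional_extensionality_dep => k; rewrite /conj_factors compound1 trmx1 mul1mx mulmx1.
Qed.

Lemma quadric_act_line g v : quadric_act g (line_tuple v) = line_tuple (conj_factors (invmx g^T) v).
Proof.
apply: functional_extensionality_dep => k.
rewrite /quadric_act /line_tuple limg_line lfunE /= /conj_factors -compound_tr trmx_inv trmxK.
by rewrite mulmxA.
Qed.

(** The inverse transpose turns upper triangular matrices into lower triangular ones, and scalars
    make up for the determinant. *)
Lemma borel_orbitE v : borel_orbit (line_tuple v) =
  [set y | exists h, [/\ lower_mx h, h \in unitmx & y = line_tuple (conj_factors h v)]].
Proof.
apply/seteqP; split=> y /=.
  move=> [g [det_g upper_g] <-]; exists (invmx g^T); rewrite quadric_act_line; split=> //.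
    apply: lower_mxV; first by move=> i j ij; rewrite mxE upper_g.
    by rewrite unitmxE det_tr det_g unitr1.
  by rewrite unitmx_inv unitmxE det_tr det_g unitr1.
move=> [h [lh uh ->]]; have det0 : \det h != 0 by rewrite -unitfE -unitmxE.
(* Division by an [n]-th root of the determinant gives determinant 1 and leaves every line
   unchanged. *)
pose r := n.-root (\det h); have rn : r ^+ n = \det h by apply: rootCK.
have r0 : r != 0 by apply: contra det0 => /eqP r0; rewrite -rn r0 expr0n eqn0Ngt n_gt0.
pose h' := r^-1 *: h; have lh' : lower_mx h' by move=> i j ij; rewrite mxE lh // mulr0.
have det1 : \det h' = 1 by rewrite detZ exprVn rn mulVf.
have uh' : h' \in unitmx by rewrite unitmxE det1 unitr1.
exists (invmx h'^T).
  split; first by rewrite det_inv det_tr det1 invr1.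
  by move=> i j ji; rewrite -trmx_inv mxE (lower_mxV lh' uh').
rewrite quadric_act_line trmx_inv trmxK invmxK; apply: functional_extensionality_dep => k.
rewrite /line_tuple /conj_factors compoundZ linearZ /= -scalemxAr -!scalemxAl scalerA.
by rewrite vline_scale // mulf_neq0 // expf_neq0 // invr_neq0.
Qed.

Lemma borel_orbit_refl v : borel_orbit (line_tuple v) (line_tuple v).
Proof.
rewrite borel_orbitE; exists 1%:M; rewrite unitmx1 conj_factors1; split=> //.
by move=> i j ij; rewrite mxE (_ : i == j = false) //; apply/negbTE; rewrite neq_ltn ij.
Qed.

Lemma borel_orbit_conj b v : lower_mx b -> b \in unitmx ->
  borel_orbit (line_tuple (conj_factors b v)) = borel_orbit (line_tuple v).
Proof.
move=> lb ub; rewrite !borel_orbitE; apply/seteqP; split=> y /= [h [lh uh ->]].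
  exists (h *m b); rewrite conj_factorsM unitmx_mul uh ub; split=> //.
  exact: lower_mxM.
exists (h *m invmx b); rewrite conj_factorsM -mulmxA mulVmx // mulmx1 unitmx_mul uh unitmx_inv ub.
by split=> //; apply: lower_mxM => //; apply: lower_mxV.
Qed.

Definition normal_form (sw : {ffun 'I_n -> 'I_n} * {ffun 'I_n -> 'I_n.+1}) : quadric_tuple K n :=
  limit_point (fun x => sw.2 x : nat) (function_mx K sw.1).

Definition normal_data := [pred sw : {ffun 'I_n -> 'I_n} * {ffun 'I_n -> 'I_n.+1} |
  block_involution 0 [set: 'I_n] sw].

Lemma normal_dataP (s : {ffun 'I_n -> 'I_n}) (w : {ffun 'I_n -> 'I_n.+1}) :
  reflect [/\ involutive s, forall x, w (s x) = w x &
              forall x, rank_weight (fun y => w y : nat) x = w x] ((s, w) \in normal_data).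
Proof.
apply: (iffP (block_involutionP _ _ _ _)) => [[/involution_onP[si _] _ ws wr]|[si ws wr]]; split=> //.
- by move=> x; apply: ws; rewrite finset.inE.
- move=> x; rewrite wr ?finset.inE // add0n; apply: eq_card => y; rewrite !finset.inE //.
- by apply/involution_onP; split=> // x; rewrite finset.inE.
- by move=> x; rewrite finset.inE.
- by move=> x _; rewrite -[LHS]wr add0n; apply: eq_card => y; rewrite !finset.inE.
Qed.

Lemma normal_form_complete sw : sw \in normal_data -> complete_quadrics K n (normal_form sw).
Proof.
case: sw => s w /normal_dataP[si ws _]; apply: limit_point_complete.
- exact: tr_function_mx.
- exact: function_mx_unit.
- by move=> x y; rewrite mxE /=; case: (s x =P y) => // <-; rewrite ws eqxx.
Qed.

Lemma borel_orbit_normal_form x : complete_quadrics K n x ->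
  exists2 sw, sw \in normal_data & borel_orbit x = borel_orbit (normal_form sw).
Proof.
move=> xX; have xP := complete_quadrics_proj xX.
have [v xv] : exists v : factors K n, forall k, v k != 0 /\ x k = <[v k]>%VS.
  apply: (fin_all_exists (P := fun k u => u != 0 /\ x k = <[u]>%VS)) => k.
  have [dim1 _] := xP k; exists (vpick (x k)).
  have nz : vpick (x k) != 0 by rewrite vpick0 -dimv_eq0 dim1.
  split=> //; apply/eqP; rewrite eq_sym eqEdim -memvE memv_pick dim1 dim_vline nz.
  by [].
have [h uh lead] := exists_top_leads xX xv.
have [g [z [ug gv]]] := complete_quadrics_chart uh xX xv lead.
have [D [w [sD uD wD wmono limD]]] := ratio_product_limit n z.
have ug' : invmx g \in unitmx by rewrite unitmx_inv.
have [b [s [w' [lb ub si w's bE]]]] := limit_normal_form ug' sD uD wD wmono.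
have rank_lt y : (rank_weight w' y < n.+1)%N.
  by rewrite ltnS -[leqRHS]card_ord; apply: max_card.
(* Ranks replace [w']: they have the same order, hence the same limits, and they fit into
   ['I_n.+1]. *)
pose sw := ([ffun y => s y] : {ffun 'I_n -> 'I_n}, [ffun y => inord (rank_weight w' y)] : {ffun 'I_n -> 'I_n.+1}).
have swE y : sw.2 y = rank_weight w' y :> nat by rewrite ffunE inordK.
exists sw.
  apply/normal_dataP; split=> y.
  - by rewrite !ffunE si.
  - apply: val_inj; rewrite /= !(swE : forall y, nat_of_ord ([ffun y => inord (rank_weight w' y)] y) = _).
    by rewrite ffunE; apply: eq_card => t; rewrite !finset.inE w's.
  - rewrite swE -[RHS]rank_weightK; apply: eq_card => t; rewrite !finset.inE !swE //.
have xE : x = line_tuple (conj_factors b (fun k => limit_compound k.+1 w' (function_mx K s))).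
  apply: functional_extensionality_dep => k; have [_ ->] := xv k.
  have [c c0 gvk] := gv k; have [d d0 limk] := limD k.+1 (exponent_leq k).
  have -> : v k = (c / d) *: (compound k.+1 (invmx g) *m limit_compound k.+1 w D *m
      (compound k.+1 (invmx g))^T).
    rewrite limk -scalemxAr -scalemxAl scalerA divfK // scalemxAl scalemxAr -gvk.
    rewrite !mulmxA -compoundM mulVmx // compound1 mul1mx -mulmxA -trmx_mul -compoundM.
    by rewrite mulVmx // compound1 trmx1 mulmx1.
  by rewrite vline_scale ?mulf_neq0 ?invr_neq0 // bE.
rewrite xE borel_orbit_conj //; congr borel_orbit; apply: functional_extensionality_dep => k.
rewrite /normal_form /limit_point /line_tuple.
have -> : function_mx K sw.1 = function_mx K s by apply/matrixP => i j; rewrite !mxE ffunE.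
by rewrite (@eq_limit_compound K n _ _ w') // => y t; rewrite !swE leq_rank_weight.
Qed.

Lemma normal_form_inj sw sw' : sw \in normal_data -> sw' \in normal_data ->
  borel_orbit (normal_form sw) = borel_orbit (normal_form sw') -> sw = sw'.
Proof.
case: sw => s w; case: sw' => s' w' /normal_dataP[si ws wr] /normal_dataP[s'i w's' w'r] e.
have : borel_orbit (normal_form (s, w)) (normal_form (s', w')).
  by rewrite e; apply: borel_orbit_refl.
rewrite (_ : normal_form (s, w) = line_tuple (fun k => limit_compound k.+1 (fun x => w x : nat) (function_mx K s))) //.
rewrite borel_orbitE => -[h [lh uh eh]].
have [|rw ss] := limit_form_unique lh uh si s'i (fun x => congr1 val (ws x)) (fun x => congr1 val (w's' x)).
  move=> [|i] // /andP[_ ilt]; have ilt' : (i < n.-1)%N by rewrite -ltnS prednK.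
  pose k := Ordinal ilt'; pose u k := limit_compound k.+1 (fun x => w x : nat) (function_mx K s).
  have ek : <[limit_compound k.+1 (fun x => w' x : nat) (function_mx K s')]>%VS =
    <[conj_factors h u k]>%VS := congr1 (fun x : quadric_tuple K n => x k) eh.
  have := memv_line (conj_factors h u k); rewrite -ek => /vlineP[c ec].
  (* With [c = 0], undoing the congruence would make a limit compound vanish. *)
  exists c => //; apply/eqP => c0; have := congr1 (fun M => invmx (compound i.+1 h) *m M *m
    (invmx (compound i.+1 h))^T) ec.
  have uch : compound i.+1 h \in unitmx by apply: compound_unit.
  rewrite c0 scale0r mulmx0 mul0mx /conj_factors !mulmxA mulVmx // mul1mx -mulmxA -trmx_mul.
  rewrite mulVmx // trmx1 mulmx1 => /eqP; apply/negP/limit_compound_neq0; first exact: ltnW.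
  exact: function_mx_unit.
congr pair; apply/ffunP => y; first exact: ss.
by apply: val_inj; rewrite /= -wr -w'r rw.
Qed.

Lemma card_borel_orbits : (borel_orbits K n #= `I_#|normal_data|)%card.
Proof.
have -> : borel_orbits K n = (fun sw => borel_orbit (normal_form sw)) @` [set` normal_data].
  apply/seteqP; split=> O /=.
    by move=> [x xX <-]; have [sw swN ->] := borel_orbit_normal_form xX; exists sw.
  by move=> [sw swN <-]; exists (normal_form sw) => //; apply: normal_form_complete.
apply: card_eq_trans (inj_card_eq _) _.
  by move=> sw sw' /set_mem swN /set_mem sw'N; apply: normal_form_inj.
have -> : [set` normal_data] = enum_val @` [set: 'I_#|normal_data|].
  apply/seteqP; split=> sw /=; last by move=> [i _ <-]; apply: enum_valP.
  by move=> swN; exists (enum_rank_in swN sw) => //; apply: enum_rankK_in.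
apply: card_eq_trans (inj_card_eq _) _; first by move=> i j _ _; apply: enum_val_inj.
by rewrite card_eq_sym; apply: card_II.
Qed.

End Orbits.

Lemma sum_partition_seqs n : (0 < n)%N ->
  \big[addn/0%N]_(las \in partition_seqs n) syt_count (skew_diagram las) = block_count n n.
Proof.
move=> n0; rewrite -(sum_block_sequences (leqnn n)) (fsbig_seq _ _ (block_sequences_uniq n n)).
suff -> : partition_seqs n = [set` block_sequences n n] by [].
apply/seteqP; split=> las /=.
  move=> [_ al s]; rewrite mem_block_sequences // al s /= eqxx //.
rewrite mem_block_sequences // => /andP[al /eqP s]; split=> //.
by case: (las) s n0 => //= <-.
Qed.

Local Open Scope card_scope.

Theorem theorem1p1 (R : realType) (n : nat) (hn : (1 <= n)%N) :
  borel_orbits R[i] n #=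
    `I_(\big[addn/0%N]_(las \in partition_seqs n) syt_count (skew_diagram las)).
Proof.
rewrite sum_partition_seqs //; have := card_borel_orbits R[i] hn.
have -> : #|normal_data n| = block_count n n; last by [].
have := @card_block_involution 'I_n n 0 [set: 'I_n]%SET n.
by rewrite cardsT card_ord leqnn => /(_ isT (leqnSn n)).
Qed.
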